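(* Let $m, n$ be positive integers with $m \le n$, let $U$ be an open subset of $\mathbf{R}^n$, let $V \in \mathbf{IV}_m(U)$ be an integral varifold such that $\|\delta V\|$ is a Radon measure and $\|\delta V\|$ is absolutely continuous with respect to $\|V\|$, let $E$ be $\|V\| + \|\delta V\|$ measurable, and suppose that $W = V \llcorner (E \times \mathbf{G}(n,m))$ satisfies $$\|\delta V\| = \|\delta W\| + \|\delta(V-W)\|.$$ Then $V\partial E = 0$.
   Context: $\mathbf{G}(n,m)$ is the Grassmannian of $m$-dimensional linear subspaces of $\mathbf{R}^n$. An $m$-dimensional varifold in $U$ is a Radon measure $V$ on $U \times \mathbf{G}(n,m)$; its weight is $\|V\|(A) = V(A \times \mathbf{G}(n,m))$. $V$ is integral, $V\in\mathbf{IV}_m(U)$, if there are countably many positive integers $c_i$ and $\mathscr{H}^m$ measurable, countably $(\mathscr{H}^m,m)$ rectifiable sets $E_i \subset U$ with $V(f) = \sum_i c_i \int_{E_i} f(x, \mathrm{Tan}^m(\mathscr{H}^m \llcorner E_i, x)) \, d\mathscr{H}^m x$ for continuous compactly supported $f$ on $U\times\mathbf{G}(n,m)$ ($\mathrm{Tan}^m$ denoting the approximate tangent plane). $V\llcorner (E\times \mathbf{G}(n,m))$ is the restriction of the measure $V$ to $E\times\mathbf{G}(n,m)$. The first variation is the distribution $\delta V(g) = \int \mathrm{trace}(S_\natural \circ Dg(x)) \, dV(x,S)$ for $g \in C_c^\infty(U,\mathbf{R}^n)$, with $S_\natural$ the orthogonal projection onto $S$. For a distribution $T$ on $C_c^\infty(U,\mathbf{R}^n)$,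 $\|T\|$ is the largest Borel regular measure over $U$ with $\|T\|(G) = \sup\{T(g) : g \in C_c^\infty(U,\mathbf{R}^n), \operatorname{spt} g \subset G, |g| \le 1\}$ for every open $G \subset U$. If $\|T\|$ is a Radon measure, $T$ is extended uniquely by continuity to $\mathbf{L}_1(\|T\|,\mathbf{R}^n)$, and for a $\|T\|$ measurable set $A$, the distribution $T\llcorner A$ is $(T\llcorner A)(g) = T(g_A)$, where $g_A = g$ on $A$ and $g_A = 0$ on $U\setminus A$. If $\|\delta V\|$ is a Radon measure and $E$ is $\|V\|+\|\delta V\|$ measurable, the distributional $V$ boundary of $E$ is the distribution $$V\partial E = (\delta V)\llcorner E - \delta\big(V\llcorner (E\times\mathbf{G}(n,m))\big).$$ For Radon measures $\phi,\psi$ on $U$, let $\psi_\phi(A) = \inf\{\psi(B) : B \text{ Borel}, \phi(A\setminus B)=0\}$ for $A\subset U$; $\psi$ is absolutely continuous with respect to $\phi$ if $\psi_\phi=\psi$ (equivalently, $\phi(A)=0$ implies $\psi(A)=0$). *)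

(* Defs.v *)
From HB Require Import structures.
From mathcomp Require Import all_boot all_order all_algebra.
From mathcomp Require Import all_classical all_reals all_analysis.

Set Implicit Arguments.
Unset Strict Implicit.
Unset Printing Implicit Defensive.

Import Order.TTheory GRing.Theory Num.Theory.
Import numFieldNormedType.Exports.

Local Open Scope classical_set_scope.
Local Open Scope ring_scope.

(* Conventions.  As in Federer's and Allard's works, a measure is an outer
   measure defined on all subsets, and measurable means Caratheodory
   measurable.  A measure over an open subset U of X is an outer measure on the
   subsets of X vanishing on the complement of U.  A vector field over U with
   compact support in U is a function on the whole space, vanishing off U.  The
   norm of the library on 'rV[R]_n is the maximum norm (it gives the usual
   topology); metric notions use the Euclidean norm enorm. *)

Section OuterMeasures.
Context {R : realType} {T : Type}.
Local Open Scope ereal_scope.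
Implicit Types mu : {outer_measure set T -> \bar R}.

Definition ozero : set T -> \bar R := fun=> 0.

Let ozero_ss : sigma_subadditive ozero.
Proof. by move=> F; exact: nneseries_ge0. Qed.

HB.instance Definition _ := isOuterMeasure.Build R T ozero
  erefl (fun=> lexx 0) (fun _ _ _ => lexx 0) ozero_ss.

Definition orestr mu (D : set T) : set T -> \bar R := fun A => mu (A `&` D).

Let orestr0 mu D : orestr mu D set0 = 0.
Proof. by rewrite /orestr set0I outer_measure0. Qed.

Let orestr_ge0 mu D A : 0 <= orestr mu D A.
Proof. exact: outer_measure_ge0. Qed.

Let orestr_le mu D : {homo orestr mu D : A B / A `<=` B >-> A <= B}.
Proof. by move=> A B AB; apply: le_outer_measure; exact: setSI. Qed.

Let orestr_ss mu D : sigma_subadditive (orestr mu D).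
Proof.
move=> F; rewrite /orestr setI_bigcupl.
exact: outer_measure_sigma_subadditive.
Qed.

HB.instance Definition _ mu D := isOuterMeasure.Build R T (orestr mu D)
  (orestr0 mu D) (orestr_ge0 mu D) (@orestr_le mu D) (@orestr_ss mu D).

End OuterMeasures.

Definition ointegral {R : realType} {T : pointedType}
    (mu : {outer_measure set T -> \bar R}) (D : set T) (f : T -> \bar R) :
    \bar R :=
  @integral _ (caratheodory_type mu) R mu D f.

Definition borel {T : topologicalType} : set (set T) := <<s (@open T) >>.

(* Federer 2.2.5 *)
Definition radon {R : realType} {T : topologicalType} (U : set T)
    (mu : {outer_measure set T -> \bar R}) : Prop :=
  [/\ mu (~` U) = 0%E,
      (forall K, compact K -> K `<=` U -> (mu K < +oo)%E),
      (forall G, open G -> G `<=` U -> mu.-caratheodory G /\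
         mu G = ereal_sup [set mu K | K in [set K | compact K /\ K `<=` G]]) &
      (forall A, A `<=` U ->
         mu A = ereal_inf
           [set mu G | G in [set G | [/\ open G, A `<=` G & G `<=` U]]])].

(* Federer 2.2.3 *)
Definition borel_regular {R : realType} {T : topologicalType} (U : set T)
    (mu : {outer_measure set T -> \bar R}) : Prop :=
  [/\ mu (~` U) = 0%E,
      (forall G, open G -> G `<=` U -> mu.-caratheodory G) &
      (forall A, A `<=` U ->
         exists B, [/\ borel B, A `<=` B, B `<=` U & mu B = mu A])].

Definition ac_part {R : realType} {T : topologicalType}
    (psi phi : set T -> \bar R) (A : set T) : \bar R :=
  ereal_inf [set psi B | B in [set B | borel B /\ phi (A `\` B) = 0%E]].

Definition abs_continuous {R : realType} {T : topologicalType} (U : set T)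
    (psi phi : set T -> \bar R) : Prop :=
  forall A, A `<=` U -> ac_part psi phi A = psi A.

Definition fsupport {T : topologicalType} {V : zmodType} (f : T -> V) : set T :=
  closure [set x | f x != 0].

Definition Cc {R : realType} {T : topologicalType} (U : set T) :
    set (T -> R^o) :=
  [set f | [/\ continuous f, compact (fsupport f) & fsupport f `<=` U]].

Section Euclidean.
Context {R : realType}.

Definition enorm {n} (v : 'rV[R]_n) : R := Num.sqrt (\sum_i v 0 i ^+ 2).

Definition ecball {n} (a : 'rV[R]_n) (r : R) : set 'rV[R]_n :=
  [set x | enorm (x - a) <= r].

(* Volume of the unit ball of R^m, by the recursion
   alpha (m + 2) = alpha m * 2 pi / (m + 2). *)
Fixpoint alpha (m : nat) : R :=
  match m with
  | 0 => 1
  | 1 => 2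
  | (k.+1 as k').+1 => alpha k * (2 * pi / k'.+1%:R)
  end.

Definition ediam {n} (S : set 'rV[R]_n) : \bar R :=
  ereal_sup [set (enorm (p.1 - p.2))%:E | p in S `*` S].

Section Hausdorff.
Variables (n m : nat).
Local Open Scope ereal_scope.

Definition hausdorff_gauge (S : set 'rV[R]_n) : \bar R :=
  if S == set0 then 0 else (alpha m / 2 ^+ m)%:E * ediam S ^+ m.

Definition hausdorff_size (delta : R) (A : set 'rV[R]_n) : \bar R :=
  ereal_inf [set \sum_(k <oo) hausdorff_gauge (F k) |
    F in [set F : (set 'rV[R]_n)^nat |
      A `<=` \bigcup_k F k /\ forall k, ediam (F k) <= delta%:E]].

(* hausdorff_size delta A increases as delta decreases to 0 *)
Definition hausdorff (A : set 'rV[R]_n) : \bar R :=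
  ereal_sup [set hausdorff_size delta A | delta in [set d | (0 < d)%R]].

Let alpha_ge0 k : (0 <= alpha k)%R.
Proof.
suff: ((0 <= alpha k) /\ (0 <= alpha k.+1))%R by case.
elim: k => [|k [h1 h2]]; split=> //=.
by rewrite mulr_ge0// divr_ge0// mulr_ge0// pi_ge0.
Qed.

Let gauge_ge0 S : 0 <= hausdorff_gauge S.
Proof.
rewrite /hausdorff_gauge; case: ifPn => // /set0P[x Sx].
rewrite mule_ge0 ?lee_fin ?divr_ge0// expe_ge0//.
apply: ereal_sup_ubound; exists (x, x) => //=.
by rewrite subrr /enorm big1 ?sqrtr0// => i _; rewrite mxE expr0n.
Qed.

Let size_ge0 d A : 0 <= hausdorff_size d A.
Proof. by apply: le_ereal_inf_tmp => _ [F _ <-]; exact: nneseries_ge0. Qed.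

Let size0 d : hausdorff_size d set0 = 0.
Proof.
apply/eqP; rewrite eq_le size_ge0 andbT.
apply: ereal_inf_lbound; exists (fun=> set0).
  split=> [//|k]; rewrite /ediam setX0 image_set0 ereal_sup0; exact: leNye.
by rewrite eseries0// => k _ _; rewrite /hausdorff_gauge eqxx.
Qed.

Let size_le d : {homo hausdorff_size d : A B / A `<=` B >-> A <= B}.
Proof.
move=> A B AB; apply: ereal_inf_le_tmp => _ [F [BF dF] <-].
by exists F => //; split=> //; exact: subset_trans BF.
Qed.

Let size_ss d : sigma_subadditive (hausdorff_size d).
Proof.
move=> A; have [[i ioo]|] := pselect (exists i, hausdorff_size d (A i) = +oo).
  rewrite (eseries_pinfty _ _ ioo) ?leey// => k _.
  by rewrite -ltNye (lt_le_trans _ (size_ge0 _ _)).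
rewrite -forallNE => Aoo.
apply/lee_addgt0Pr => _/posnumP[e].
rewrite (le_trans _ (epsilon_trick _ _ _))//.
pose P i (B : (set 'rV[R]_n)^nat) := (A i `<=` \bigcup_k B k /\
  forall k, ediam (B k) <= d%:E) /\ \sum_(k <oo) hausdorff_gauge (B k) <=
    hausdorff_size d (A i) + (e%:num / (2 ^ i.+1)%:R)%:E.
have [G PG] : {G : ((set 'rV[R]_n)^nat)^nat & forall i, P i (G i)}.
  apply: (@choice _ _ P) => i.
  have Sfin : hausdorff_size d (A i) \is a fin_num.
    by rewrite ge0_fin_numE// ltey; apply/eqP; exact: Aoo.
  have en1 : (0 < e%:num / (2 ^ i.+1)%:R)%R by [].
  have [_ [B cB <-] /ltW xS] := lb_ereal_inf_adherent en1 Sfin.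
  by exists B.
have muG_ge0 x : 0 <= (hausdorff_gauge \o uncurry G) x by exact: gauge_ge0.
apply: (@le_trans _ _ (\esum_(i in setT) (hausdorff_gauge \o uncurry G) i)).
  apply: ereal_inf_lbound => /=.
  have /card_esym/ppcard_eqP[f] := card_nat2.
  exists (uncurry G \o f).
    split=> [t [i _ Ait]|k]; last first.
      by rewrite /=; case: (f k) => i j; exact: (PG i).1.2.
    have [j _ Gijt] := (PG i).1.1 t Ait.
    by exists (f^-1%FUN (i, j)) => //=; rewrite invK ?inE.
  rewrite -(esum_pred_image (hausdorff_gauge \o uncurry G) _ xpredT)
    ?[fun=> _]set_true//.
  by rewrite image_eq.
rewrite (_ : esum _ _ = \sum_(i <oo) \sum_(j <oo ) hausdorff_gauge (G i j));
    last first.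
  pose J : nat -> set (nat * nat) := fun i => [set (i, j) | j in setT].
  rewrite (_ : setT = \bigcup_k J k); last first.
    by rewrite predeqE => -[a b]; split => // _; exists a => //; exists b.
  rewrite esum_bigcupT /=; last 2 first.
    - apply/trivIsetP => i j _ _ ij.
      rewrite predeqE => -[k l] /=; split => //= -[] [_] _ [<-{k} _].
      by move=> [m' _] [] /esym/eqP; rewrite (negbTE ij).
    - by move=> /= [k l]; exact: gauge_ge0.
  rewrite -(image_id [set: nat]) -fun_true esum_pred_image//; last first.
    by move=> k _; exact: esum_ge0.
  apply: eq_eseriesr => /= j _.
  rewrite -(esum_pred_image (hausdorff_gauge \o uncurry G) (pair j) predT)//=;
    last by move=> ? ? _ _; exact: (@can_inj _ _ _ snd).
  by congr esum; rewrite predeqE => -[a b]; split; move=> [i _ <-]; exists i.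
apply: lee_nneseries => [i _ _|i _]; last exact: (PG i).2.
by apply: nneseries_ge0 => j _ _; exact: gauge_ge0.
Qed.

Let hausdorff0 : hausdorff set0 = 0.
Proof.
rewrite /hausdorff (_ : image _ _ = [set 0]) ?ereal_sup1//.
apply/seteqP; split=> [_ [d _ <-]|_ ->]; first exact: size0.
by exists 1%R => /=; rewrite ?size0.
Qed.

Let hausdorff_ge0 A : 0 <= hausdorff A.
Proof.
apply: le_trans (size_ge0 1 A) _.
by apply: ereal_sup_ubound; exists 1%R => /=.
Qed.

Let hausdorff_le : {homo hausdorff : A B / A `<=` B >-> A <= B}.
Proof.
move=> A B AB; apply: ge_ereal_sup => _ [d d0 <-].
by apply: le_trans (size_le d AB) _; apply: ereal_sup_ubound; exists d.
Qed.

Let hausdorff_ss : sigma_subadditive hausdorff.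
Proof.
move=> F; apply: ge_ereal_sup => _ [d d0 <-].
apply: le_trans (size_ss d F) _; apply: lee_nneseries => [i _ _|i _]; first exact: size_ge0.
by apply: ereal_sup_ubound; exists d.
Qed.

HB.instance Definition _ := isOuterMeasure.Build R 'rV[R]_n hausdorff
  hausdorff0 hausdorff_ge0 hausdorff_le hausdorff_ss.

End Hausdorff.

(* Federer 3.2.14 *)
Definition countably_rectifiable {n} (m : nat) (E : set 'rV[R]_n) : Prop :=
  exists (A : nat -> set 'rV[R]_m) (f : nat -> 'rV[R]_m -> 'rV[R]_n),
    [/\ (forall k, bounded_set (A k)),
        (forall k, [lipschitz f k x | x in A k]) &
        hausdorff m (E `\` \bigcup_k (f k @` A k)) = 0%E].

(* Federer 3.1.21 *)
Definition tangent_cone {n} (S : set 'rV[R]_n) (a : 'rV[R]_n) :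
    set 'rV[R]_n :=
  [set v | forall e : R, 0 < e -> exists x r,
    [/\ S x, 0 < r, enorm (x - a) < e & enorm (r *: (x - a) - v) < e]].

Definition density_zero {n} (m : nat) (phi : set 'rV[R]_n -> \bar R)
    (a : 'rV[R]_n) : Prop :=
  (phi (ecball a r) * ((alpha m * r ^+ m)^-1)%:E)%E @[r --> 0^'+] --> 0%E.

(* Federer 3.2.16 *)
Definition approx_tangent {n} (m : nat)
    (phi : {outer_measure set 'rV[R]_n -> \bar R}) (a : 'rV[R]_n) :
    set 'rV[R]_n :=
  \bigcap_(S in [set S | density_zero m (orestr phi (~` S)) a])
    tangent_cone S a.

(* v *m orth_proj S is the orthogonal projection of v on S *)
Definition orth_proj {n} (S : {vspace 'rV[R]_n}) : 'M[R]_n :=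
  xget 0 [set P | forall v, v *m P \in S /\
                    forall w, w \in S -> (v - v *m P) *m w^T = 0].

End Euclidean.

(* The condition m <= n is a parameter because the measurable types of the
   library are nonempty. *)
Definition grassmannian (R : realType) (n m : nat) (mn : (m <= n)%N) : Type :=
  {S : {vspace 'rV[R]_n} | \dim S == m}.

Section Grassmannian.
Context {R : realType} {n m : nat} {mn : (m <= n)%N}.
Let G := grassmannian R mn.

HB.instance Definition _ := Choice.on G.

Lemma grassmannian_inhabited :
  \dim (<<take m (vbasis {:'rV[R]_n})>>%VS : {vspace 'rV[R]_n}) == m.
Proof.
have sz : size (vbasis {:'rV[R]_n}) = n.
  rewrite size_tuple dimvf dim_matrix; exact: mul1n.
have /catl_free : free (take m (vbasis {:'rV[R]_n}) ++ drop m (vbasis {:'rV[R]_n})).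
  by rewrite cat_take_drop; exact: basis_free (vbasisP _).
by rewrite /free size_takel ?sz.
Qed.

HB.instance Definition _ := isPointed.Build G
  (exist (fun S : {vspace 'rV[R]_n} => \dim S == m) _ grassmannian_inhabited).

(* Usually written S_natural. *)
Definition gproj (S : G) : 'M[R]_n := orth_proj (sval S).

(* The topology of G(n,m) is that given by the identification of S with
   its orthogonal projection. *)
HB.instance Definition _ := Topological.copy G (initial_topology gproj).

End Grassmannian.

Section Distributions.
Context {R : realType} {n : nat}.
Notation field := ('rV[R]_n -> 'rV[R]_n).
Implicit Types (U : set 'rV[R]_n) (g : field).

Fixpoint Ck (k : nat) g : Prop :=
  match k with
  | 0 => continuous g
  | k.+1 => (forall x, differentiable g x) /\ forall v, Ck k ('D_v g)
  end.

Definition test_field U : set field :=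
  [set g | [/\ forall k, Ck k g, compact (fsupport g) & fsupport g `<=` U]].

(* Only the values of a distribution on test_field U matter. *)
Definition vdistribution := field -> R.
Implicit Types T : vdistribution.

Definition has_variation U T (mu : {outer_measure set 'rV[R]_n -> \bar R}) :
    Prop :=
  borel_regular U mu /\
  forall G, open G -> G `<=` U ->
    mu G = ereal_sup [set (T g)%:E | g in
      [set g | [/\ test_field U g, fsupport g `<=` G &
                   forall x, enorm (g x) <= 1]]].

Definition largest_variation U T
    (mu : {outer_measure set 'rV[R]_n -> \bar R}) : Prop :=
  has_variation U T mu /\
  forall nu, has_variation U T nu -> forall A, (nu A <= mu A)%E.

(* ||T||; the default value ozero is irrelevant, a largest measure exists for
   every linear T. *)
Definition dist_variation U T : {outer_measure set 'rV[R]_n -> \bar R} :=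
  match pselect (exists mu, largest_variation U T mu) with
  | left h => sval (cid h)
  | right _ => ozero
  end.

(* Extension by continuity of T to L_1(||T||, R^n): the value at h is the limit
   of T g_k for any test fields g_k converging to h in L_1(||T||, R^n). *)
Definition dist_extend U T (h : field) : R :=
  xget 0 [set y | exists g : nat -> field,
    [/\ forall k, test_field U (g k),
        ointegral (dist_variation U T) U (fun x => (enorm (g k x - h x))%:E)
          @[k --> \oo] --> 0%E &
        T (g k) @[k --> \oo] --> y]].

Definition dist_restr U T (A : set 'rV[R]_n) : vdistribution :=
  fun g => dist_extend U T (fun x => if x \in A then g x else 0).

End Distributions.

Section Varifolds.
Context {R : realType} {n m : nat} {mn : (m <= n)%N}.
Notation G := (grassmannian R mn).
Implicit Types (U E : set 'rV[R]_n)
  (V : {outer_measure set ('rV[R]_n * G) -> \bar R}).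

Definition vint V (f : 'rV[R]_n * G -> R) : R :=
  fine (ointegral V setT (EFin \o f)).

Definition weight V : set 'rV[R]_n -> \bar R := fun A => V (A `*` setT).

Definition varifold U V : Prop := radon (U `*` setT) V.

Definition integral_varifold U V : Prop :=
  varifold U V /\
  exists (c : nat -> nat) (E : nat -> set 'rV[R]_n) (tau : nat -> 'rV[R]_n -> G),
    (forall i,
      [/\ (0 < c i)%N, E i `<=` U,
          (hausdorff m : set 'rV[R]_n -> \bar R).-caratheodory (E i),
          countably_rectifiable m (E i) &
          hausdorff m [set x | E i x /\
            approx_tangent m (orestr (hausdorff m) (E i)) x
              <> [set v | v \in sval (tau i x)]] = 0%E]) /\
    forall f, Cc (U `*` setT) f ->
      ointegral V setT (EFin \o f) =
      (\sum_(i <oo) (c i)%:R%:E *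
        ointegral (hausdorff m) (E i) (fun x => (f (x, tau i x))%:E))%E.

(* The first variation of a linear functional L on functions on U x G(n,m);
   that of a varifold V is first_variation (vint V), and that of the difference
   V - W is first_variation (vint V \- vint W).  Linear maps act on row vectors
   from the right, so that 'J g x *m gproj S is the matrix of the composition of
   Dg(x) followed by the projection on S. *)
Definition first_variation (L : ('rV[R]_n * G -> R) -> R) : vdistribution :=
  fun g => L (fun p => \tr ('J g p.1 *m gproj p.2)).

Definition vrestr V E : {outer_measure set ('rV[R]_n * G) -> \bar R} :=
  orestr V (E `*` setT).

Definition vboundary U V E : vdistribution :=
  dist_restr U (first_variation (vint V)) E
    \- first_variation (vint (vrestr V E)).

End Varifolds.

(* Main.v *)
(* Write T for the first variation of W, N for its total variation, M for that of
   the first variation of V and mu for the weight of V.  The hypothesis is used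
   only through N <= M << mu, and the crux is that N vanishes on U minus E;
   symmetrically, the variation of V - W vanishes on E.  Given this, if test
   fields g_k converge in L_1(M) to g on E and to 0 off E, then
   delta V (g_k) = T (g_k) + delta (V - W) (g_k) converges to T g.

   Let K be a compact part of U minus E.  There W has density 0 mu almost
   everywhere, hence M almost everywhere, while, V being at least Hausdorff
   measure on its carrier, the upper density of W is bounded below at W almost
   every point.  By the monotonicity identity a drop of the density ratio around
   such a point at distance about r from K has to be paid for by first variation,
   so that with theta -> 0 the mass of W near K is at most C theta r N(Q) for a
   neighborhood Q of K, by a Vitali covering.  Cutting a field off near K at scale
   r multiplies derivatives by 1 / r only, whence N(K) <= C theta N(Q). *)

Require Import Defs.
From HB Require Import structures.
From mathcomp Require Import all_boot all_order all_algebra.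
From mathcomp Require Import all_classical all_reals all_analysis.
From mathcomp Require Import measurable_realfun ring lra.

Set Implicit Arguments.
Unset Strict Implicit.
Unset Printing Implicit Defensive.

Import Order.TTheory GRing.Theory Num.Theory.
Import numFieldNormedType.Exports.

Local Open Scope classical_set_scope.
Local Open Scope ring_scope.

(** * Euclidean norm *)

(** Integrality enters through two comparisons with the Hausdorff measure H: H of X within a carrier
    E i is at most the weight of X, and a compact set that is H null within every carrier has weight
    0. The density statements follow from these by coverings. The constants have to be chosen in the
    right order. The factor theta is fixed before the scale r: as W has density 0 off E, the balls
    of radius 4 r around most points there have, for small r, mass at most [iso_small] (theta r)^m.
    The isoperimetric estimate then runs at scale theta r, while the cutoff lives at scale r, and
    the gain theta survives. This requires a gradient bound C / r for the cutoff with C independent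
    of K and r. First variations are treated as linear functionals on test fields, not as vector
    measures with a density. Where a field would be integrated against such a density, it is sliced
    dyadically, into annuli or level sets of its norm, and each slice is bounded by its supremum
    times the variation of a set. The constant factor lost in this way does not affect limits. *)

Section EuclideanNorm.
Context {R : realType} {n : nat}.
Implicit Types (u v w a b : 'rV[R]_n) (r s : R).

Definition edot u v : R := \sum_i u 0 i * v 0 i.

Lemma edotC u v : edot u v = edot v u.
Proof. by apply: eq_bigr => i _; rewrite mulrC. Qed.

Lemma edotDl u v w : edot (u + v) w = edot u w + edot v w.
Proof. by rewrite -big_split; apply: eq_bigr => i _; rewrite mxE mulrDl. Qed.

Lemma edotZl (c : R) u v : edot (c *: u) v = c * edot u v.
Proof. by rewrite mulr_sumr; apply: eq_bigr => i _; rewrite mxE mulrA. Qed.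

Lemma edotDr u v w : edot u (v + w) = edot u v + edot u w.
Proof. by rewrite edotC edotDl !(edotC u). Qed.

Lemma edotZr (c : R) u v : edot u (c *: v) = c * edot u v.
Proof. by rewrite edotC edotZl edotC. Qed.

Lemma edotNl u v : edot (- u) v = - edot u v.
Proof. by rewrite -scaleN1r edotZl mulN1r. Qed.

Lemma edotNr u v : edot u (- v) = - edot u v.
Proof. by rewrite edotC edotNl edotC. Qed.

Lemma edot_ge0 u : 0 <= edot u u.
Proof. by apply: sumr_ge0 => i _; rewrite -expr2 sqr_ge0. Qed.

Lemma edot_eq0 u : edot u u = 0 -> u = 0.
Proof.
move=> /psumr_eq0P h; apply/rowP => i; rewrite mxE; apply/eqP.
by rewrite -sqrf_eq0 expr2; apply/eqP/h => // j _; rewrite -expr2 sqr_ge0.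
Qed.

Lemma edotE u v : edot u v = (u *m v^T) 0 0.
Proof. by rewrite mxE; apply: eq_bigr => i _; rewrite mxE. Qed.

Lemma edot_mul u v (P : 'M[R]_n) : edot (u *m P) v = edot u (v *m P^T).
Proof. by rewrite !edotE trmx_mul trmxK mulmxA. Qed.

Lemma enormE u : enorm u = Num.sqrt (edot u u).
Proof. by congr Num.sqrt; apply: eq_bigr => i _; rewrite expr2. Qed.

Lemma enorm_ge0 u : 0 <= enorm u. Proof. exact: sqrtr_ge0. Qed.

Lemma sqr_enorm u : enorm u ^+ 2 = edot u u.
Proof. by rewrite enormE sqr_sqrtr// edot_ge0. Qed.

Lemma edot_le_enorm u v : edot u v <= enorm u * enorm v.
Proof.
have [v0|v0] := eqVneq (edot v v) 0.
  rewrite (edot_eq0 v0) /edot big1 ?mulr_ge0 ?enorm_ge0// => i _.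
  by rewrite mxE mulr0.
have vp : 0 < edot v v by rewrite lt_neqAle eq_sym v0 edot_ge0.
apply: le_trans (ler_norm _) _; rewrite -ler_sqr ?nnegrE//; last first.
  by rewrite mulr_ge0// enorm_ge0.
rewrite real_normK ?num_real// exprMn !sqr_enorm.
have := edot_ge0 (edot v v *: u - edot u v *: v).
rewrite !(edotDl, edotDr, edotNl, edotNr, edotZl, edotZr) (edotC v u).
set a := edot u u; set b := edot v v; set c := edot u v => h.
have {}h : 0 <= b * (a * b - c ^+ 2) by apply: le_trans h _; lra.
by move: h; rewrite pmulr_rge0// subr_ge0.
Qed.

Lemma edot_abs_le_enorm u v : `|edot u v| <= enorm u * enorm v.
Proof.
rewrite ler_norml edot_le_enorm andbT lerNl -edotNl.
apply: le_trans (edot_le_enorm _ _) _.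
by rewrite !enormE edotNl edotNr opprK.
Qed.

Lemma enormN u : enorm (- u) = enorm u.
Proof. by rewrite !enormE edotNl edotNr opprK. Qed.

Lemma enormB u v : enorm (u - v) = enorm (v - u).
Proof. by rewrite -enormN opprB. Qed.

Lemma enormZ (c : R) u : enorm (c *: u) = `|c| * enorm u.
Proof. by rewrite !enormE edotZl edotZr mulrA -expr2 sqrtrM ?sqr_ge0// sqrtr_sqr. Qed.

Lemma enorm0 : enorm (0 : 'rV[R]_n) = 0.
Proof. by rewrite -(scale0r 0) enormZ normr0 mul0r. Qed.

Lemma enorm_triangle u v : enorm (u + v) <= enorm u + enorm v.
Proof.
rewrite -ler_sqr ?nnegrE ?enorm_ge0 ?addr_ge0 ?enorm_ge0//.
rewrite sqr_enorm sqrrD !sqr_enorm edotDl !edotDr (edotC v u).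
have := edot_le_enorm u v; lra.
Qed.

Lemma enorm_triangleB u v w : enorm (u - w) <= enorm (u - v) + enorm (v - w).
Proof. by have := enorm_triangle (u - v) (v - w); rewrite addrA subrK. Qed.

Lemma enorm_eq0 u : enorm u = 0 -> u = 0.
Proof. by move=> h; apply: edot_eq0; rewrite -sqr_enorm h expr0n. Qed.

Lemma coord_le_enorm u i : `|u 0 i| <= enorm u.
Proof.
rewrite -sqrtr_sqr; apply: ler_wsqrtr; rewrite (bigD1 i)//= lerDl.
by apply: sumr_ge0 => j _; exact: sqr_ge0.
Qed.

Lemma norm_le_enorm u : `|u| <= enorm u.
Proof.
rewrite /Num.norm/= mx_normrE; apply: bigmax_le; first exact: enorm_ge0.
by move=> [i j] _ /=; rewrite (ord1 i) coord_le_enorm.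
Qed.

Lemma coord_le_norm u i : `|u 0 i| <= `|u|.
Proof.
rewrite [leRHS]/Num.norm/= mx_normrE.
exact: (le_bigmax_cond _ (fun x : 'I_1 * 'I_n => `|u x.1 x.2|) (j := (0, i))).
Qed.

Lemma enorm_le_norm u : enorm u <= n%:R * `|u|.
Proof.
rewrite -ler_sqr ?nnegrE ?enorm_ge0 ?mulr_ge0// sqr_enorm exprMn.
apply: (@le_trans _ _ (\sum_(i < n) `|u| ^+ 2)).
  apply: ler_sum => i _; rewrite -expr2 -real_normK ?num_real//.
  by rewrite lerXn2r ?nnegrE// coord_le_norm.
rewrite sumr_const card_ord -[leLHS]mulr_natl ler_wpM2r ?sqr_ge0//.
by rewrite -natrX ler_nat; case: (n) => // k; rewrite leq_pmulr.
Qed.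

Lemma enorm_dist u v : `|enorm u - enorm v| <= enorm (u - v).
Proof.
rewrite ler_norml lerBrDl lerBlDl.
have := enorm_triangleB u v 0; have := enorm_triangleB v u 0.
by rewrite !subr0 (enormB v u); lra.
Qed.

Lemma enorm_lipschitz_continuous (f : 'rV[R]_n -> R) (C : R) : 0 <= C ->
  (forall x y, `|f x - f y| <= C * enorm (x - y)) -> continuous f.
Proof.
move=> C0 fC x; apply/(@cvgrPdist_lt _ _ _ (nbhs x) (nbhs_filter x)) => e e0.
have D0 : 0 < C * n%:R + 1 by rewrite ltr_wpDl// mulr_ge0.
have : \forall y \near x, `|x - y| < e / (C * n%:R + 1).
  apply/nbhs_ballP; exists (e / (C * n%:R + 1)) => [|y].
    by rewrite /= divr_gt0.
  by rewrite -ball_normE.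
apply: filterS => y; rewrite ltr_pdivlMr// => h.
apply: le_lt_trans (fC _ _) _; apply: le_lt_trans h.
apply: (@le_trans _ _ (C * (n%:R * `|x - y|))).
  by rewrite ler_wpM2l// enorm_le_norm.
by rewrite mulrDr mulr1 mulrA mulrC lerDl.
Qed.

Lemma enormB_continuous a : continuous (fun x : 'rV[R]_n => enorm (x - a)).
Proof.
apply: (@enorm_lipschitz_continuous _ 1) => // x y.
by apply: le_trans (enorm_dist _ _) _; rewrite mul1r opprB addrA subrK.
Qed.

Definition eoball a (r : R) : set 'rV[R]_n := [set x | enorm (x - a) < r].

Lemma eoball_open a r : open (eoball a r).
Proof.
rewrite (_ : eoball a r = (fun x => enorm (x - a)) @^-1` [set y | y < r])//.
by apply: open_comp => [x _|]; [exact: enormB_continuous|exact: open_lt].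
Qed.

Lemma ecball_closed a r : closed (ecball a r).
Proof.
rewrite (_ : ecball a r = (fun x => enorm (x - a)) @^-1` [set y | y <= r])//.
by apply: closed_comp => [x _|]; [exact: enormB_continuous|exact: closed_le].
Qed.

Lemma ecball_compact a r : compact (ecball a r).
Proof.
apply: bounded_closed_compact; last exact: ecball_closed.
exists (r + `|a|); split; first exact: num_real.
move=> x rx y /= yr; apply: le_trans (ltW rx).
rewrite -(subrK a y); apply: le_trans (ler_normD _ _) _.
by rewrite lerD2r (le_trans (norm_le_enorm _)).
Qed.

Lemma open_eoball (G : set 'rV[R]_n) a : open G -> G a ->
  exists2 r, 0 < r & eoball a r `<=` G.
Proof.
move=> oG Ga; have /nbhs_ballP[e /= e0 eG] : nbhs a G by exact: open_nbhs_nbhs.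
exists e => // x ax; apply: eG; rewrite -ball_normE /= distrC.
exact: le_lt_trans (norm_le_enorm _) ax.
Qed.

Lemma eoball_center a r : 0 < r -> eoball a r a.
Proof. by rewrite /eoball/= subrr enorm0. Qed.

Lemma eoball_sub_ecball a r s : r <= s -> eoball a r `<=` ecball a s.
Proof. by move=> rs x /ltW /le_trans; exact. Qed.

Lemma ecball_sub_eoball a r s : r < s -> ecball a r `<=` eoball a s.
Proof. by move=> rs x /le_lt_trans; exact. Qed.

Lemma ecball_sub a b r s : enorm (a - b) + r <= s -> ecball a r `<=` ecball b s.
Proof.
move=> h x; rewrite /ecball/= => xr; apply: le_trans (enorm_triangleB x a b) _.
by apply: le_trans h; rewrite addrC lerD2l.
Qed.

End EuclideanNorm.

(** * Smooth functions and cutoffs *)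

Section SmoothFunctions.
Context {R : realType} {V : normedModType R}.
Implicit Types (f g : V -> R) (F : R -> R).

(** Scalar counterpart of [Ck]: closure under products, inverses, exponentials and logarithms is
    proved here and carried over to vector fields by coordinates in [CkP]. *)
Fixpoint Ckr (k : nat) f : Prop :=
  match k with
  | 0 => continuous f
  | k.+1 => (forall x, differentiable f x) /\ forall v, Ckr k ('D_v f)
  end.

Definition smooth f := forall k, Ckr k f.

Lemma CkrS k f : Ckr k.+1 f -> Ckr k f.
Proof.
elim: k f => [|k IH] f [df Df]; first by move=> x; exact: differentiable_continuous.
by split=> // v; apply: IH; exact: Df.
Qed.

Lemma eq_Ckr k f g : f =1 g -> Ckr k f -> Ckr k g.
Proof. by move=> /funext ->. Qed.

Lemma CkrD k f g : Ckr k f -> Ckr k g -> Ckr k (fun x => f x + g x).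
Proof.
elim: k f g => [|k IH] f g.
  by move=> cf cg x; apply: (@cvgD _ _ _ _ _ f g); [exact: cf|exact: cg].
move=> [df Df] [dg Dg]; split=> [x|v].
  exact: (@differentiableD _ _ _ f g).
apply: eq_Ckr (IH _ _ (Df v) (Dg v)) => x.
by rewrite -(@deriveD _ _ _ f g) //; exact: diff_derivable.
Qed.

Lemma Ckr_cst k (c : R) : Ckr k (fun=> c).
Proof.
elim: k c => [|k IH] c; first by move=> x; exact: cvg_cst.
split=> [x|v]; first exact: differentiable_cst.
by apply: eq_Ckr (IH 0) => x; rewrite derive_cst.
Qed.

Lemma CkrM k f g : Ckr k f -> Ckr k g -> Ckr k (fun x => f x * g x).
Proof.
elim: k f g => [|k IH] f g.
  by move=> cf cg x; apply: (@cvgM _ _ _ _ f g); [exact: cf|exact: cg].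
move=> fS gS; have [df Df] := fS; have [dg Dg] := gS; split=> [x|v].
  exact: (@differentiableM _ _ f g).
apply: eq_Ckr (CkrD (IH _ _ (CkrS fS) (Dg v)) (IH _ _ (CkrS gS) (Df v))) => x.
by rewrite (@deriveM _ _ f g) //; exact: diff_derivable.
Qed.

Lemma smoothM f g : smooth f -> smooth g -> smooth (fun x => f x * g x).
Proof. by move=> fs gs k; exact: CkrM. Qed.

Lemma smoothD f g : smooth f -> smooth g -> smooth (fun x => f x + g x).
Proof. by move=> fs gs k; exact: CkrD. Qed.

Lemma smooth_cst c : smooth (fun=> c).
Proof. by move=> k; exact: Ckr_cst. Qed.

Lemma smoothN f : smooth f -> smooth (fun x => - f x).
Proof.
move=> fs k; apply: eq_Ckr (CkrM (Ckr_cst k (-1)) (fs k)) => x.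
by rewrite mulN1r.
Qed.

Lemma smoothB f g : smooth f -> smooth g -> smooth (fun x => f x - g x).
Proof. by move=> fs gs; apply: smoothD => //; exact: smoothN. Qed.

Lemma smooth_sum (I : Type) (s : seq I) (f : I -> V -> R) :
  (forall i, smooth (f i)) -> smooth (fun x => \sum_(i <- s) f i x).
Proof.
move=> fs; elim: s => [|i s IH] k.
  by apply: eq_Ckr (Ckr_cst k 0) => x; rewrite big_nil.
by apply: eq_Ckr (CkrD (fs i k) (IH k)) => x; rewrite big_cons.
Qed.

Lemma derive_comp1 F f x v d : differentiable f x -> is_derive (f x) 1 F d ->
  differentiable (F \o f) x /\ 'D_v (F \o f) x = d * 'D_v f x.
Proof.
move=> df [dF dFE].
have dF' : differentiable F (f x) by exact/derivable1_diffP.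
have dc : differentiable (F \o f) x by exact: differentiable_comp.
split=> //; rewrite deriveE// diff_comp//= deriveE// deriv1E//= derive1E dFE.
by rewrite mulrC.
Qed.

Lemma CkrV k f : (forall x, f x != 0) -> Ckr k f -> Ckr k (fun x => (f x)^-1).
Proof.
move=> f0; elim: k => [cf x|k IH fS]; first by apply: cvgV => //; exact: cf.
have [df Df] := fS.
have e x v := @derive_comp1 (@GRing.inv R) f x v _ (df x)
  (is_deriveV (f0 x) (is_derive_id (f x) 1)).
split=> [x|v]; first by have [] := e x 0.
apply: eq_Ckr (CkrM (CkrM (Ckr_cst k (-1)) (CkrM (IH (CkrS fS)) (IH (CkrS fS))))
  (Df v)) => x.
have [_ ->] := e x v; rewrite scaler1 mulN1r -expr2 -exprVn.
by congr (_ * _); rewrite ?exprVn.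
Qed.

Lemma Ckr_expR k f : Ckr k f -> Ckr k (fun x => expR (f x)).
Proof.
elim: k => [cf x|k IH fS].
  by apply: (@cvg_comp _ _ _ f expR); [exact: cf|exact: continuous_expR].
have [df Df] := fS; have e x v := derive_comp1 v (df x) (is_derive_expR (f x)).
split=> [x|v]; first by have [] := e x 0.
apply: eq_Ckr (CkrM (IH (CkrS fS)) (Df v)) => x.
by have [_ ->] := e x v.
Qed.

Lemma Ckr_ln k f : (forall x, 0 < f x) -> Ckr k f -> Ckr k (fun x => ln (f x)).
Proof.
move=> f0; elim: k => [cf x|k IH fS].
  by apply: (@cvg_comp _ _ _ f (@ln R)); [exact: cf|exact: continuous_ln].
have [df Df] := fS; have e x v := derive_comp1 v (df x) (is_derive1_ln (f0 x)).
split=> [x|v]; first by have [] := e x 0.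
have f0' x : f x != 0 by rewrite gt_eqF.
apply: eq_Ckr (CkrM (CkrV f0' (CkrS fS)) (Df v)) => x.
by have [_ ->] := e x v.
Qed.

(* The functions t^-p exp (-1/t), extended by 0 to t <= 0, are closed under
   differentiation up to linear combinations. *)
Definition flat (p : nat) (t : R) : R :=
  if 0 < t then t^-1 ^+ p * expR (- t^-1) else 0.

(** The exponential of 1/t dominates the term of order p + 2 of its series. The factor t^2 that is
    left over makes every [flat p] differentiable at 0 with derivative 0. *)
Lemma flat_bound p t : 0 <= flat p t <= (p.+2)`!%:R * t ^+ 2.
Proof.
rewrite /flat; case: ifPn => [t0|_]; last by rewrite lexx mulr_ge0// sqr_ge0.
have ti0 : 0 < t^-1 by rewrite invr_gt0.
rewrite mulr_ge0 ?exprn_ge0 ?expR_ge0 ?(ltW ti0)//=.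
rewrite expRN ler_pdivrMr ?expR_gt0//.
have := expR_ge1Dxn p.+1 (ltW ti0).
set E := expR _ => h.
have {h} : t^-1 ^+ p.+2 / p.+2`!%:R <= E by apply: le_trans h; rewrite lerDr.
rewrite ler_pdivrMr ?ltr0n ?fact_gt0// => h.
have : t^-1 ^+ p.+2 * t ^+ 2 <= E * p.+2`!%:R * t ^+ 2 by rewrite ler_wpM2r// sqr_ge0.
rewrite -addn2 exprD -mulrA -exprMn mulVf ?gt_eqF// expr1n mulr1 addn2.
by move=> h2; rewrite mulrC mulrA.
Qed.

Lemma is_derive_flat (p : nat) (t : R) :
  is_derive t (1 : R) (flat p) (- p%:R * flat p.+1 t + flat p.+2 t).
Proof.
have [t0|t0|t0] := ltgtP t 0.
- have near0 : \forall y \near t, (fun=> 0 : R) y = flat p y.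
    have /= : \forall y \near t, y < 0 by exact: lt_nbhsl.
    by apply: filterS => y y0; rewrite /flat ltNge (ltW y0).
  rewrite /flat ltNge (ltW t0)/= mulr0 addr0.
  exact: (near_eq_is_derive near0 (is_derive_cst 0 t 1)).
- have near0 : \forall y \near t, (fun t => t^-1 ^+ p * expR (- t^-1)) y = flat p y.
    have /= : \forall y \near t, 0 < y by exact: lt_nbhsr.
    by apply: filterS => y y0; rewrite /flat y0.
  apply: (near_eq_is_derive near0).
  have tn0 : t != 0 by rewrite gt_eqF.
  rewrite /flat t0.
  have h1 : is_derive t 1 (@GRing.inv R) (- t ^- 2 *: 1) by exact: is_deriveV.
  have h2 : is_derive t 1 (fun t : R => t^-1 ^+ p)
      ((p%:R * t^-1 ^+ p.-1) *: (- t ^- 2 *: 1)).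
    have := is_deriveX p h1.
    rewrite (_ : (_ ^+ p) = (fun t => t^-1 ^+ p)) ?exprfctE//.
  have h3 : is_derive t 1 (fun t : R => expR (- t^-1))
      (expR (- t^-1) * - (- t ^- 2 *: 1)).
    exact: (is_derive1_comp (is_derive_expR _) (is_deriveN h1)).
  apply: (is_derive_eq (is_deriveM h2 h3)).
  rewrite !scaler1 !/(_ *: _)/= -exprVn.
  case: (p) => [|q] /=; first by rewrite !expr0; ring.
  by rewrite !exprS; ring.
rewrite t0 /flat ltxx mulr0 addr0.
have bnd s : `|flat p s| <= (p.+2)`!%:R * `|s| ^+ 2.
  by have /andP[h1 h2] := flat_bound p s; rewrite ger0_norm// real_normK ?num_real.
have c0 : 0 < (p.+2)`!%:R :> R by rewrite ltr0n fact_gt0.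
(* By the quadratic bound the difference quotient at the origin is at most a constant times |s|. *)
have h : (fun h : R => h^-1 *: (flat p (h *: 1 + 0) - flat p 0)) @ 0^' --> (0 : R).
  apply/cvgrPdist_lt => e e0; near=> s.
  have s0 : s != 0 by near: s; exact: nbhs_dnbhs_neq.
  rewrite sub0r normrN /flat ltxx subr0 -/(flat p _) addr0 scaler1.
  rewrite /(_ *: _)/= normrM normfV mulrC ltr_pdivrMr ?normr_gt0//.
  apply: le_lt_trans (bnd _) _; rewrite expr2 mulrA ltr_pM2r ?normr_gt0//.
  rewrite mulrC -ltr_pdivlMr//.
  by near: s; apply: dnbhs0_lt; rewrite divr_gt0.
apply: DeriveDef; first by apply/cvg_ex; exists 0.
by apply: cvg_lim h => //.
Unshelve. all: end_near. Qed.

Lemma Ckr_flat k p f : Ckr k f -> Ckr k (fun x => flat p (f x)).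
Proof.
elim: k p => [|k IH] p fS.
  move=> x; apply: (@cvg_comp _ _ _ f (flat p)); first exact: fS.
  apply: differentiable_continuous; apply/derivable1_diffP.
  by have [] := is_derive_flat p (f x).
have [df Df] := fS; have e x v := derive_comp1 v (df x) (is_derive_flat p (f x)).
split=> [x|v]; first by have [] := e x 0.
apply: eq_Ckr (CkrM (CkrD (CkrM (Ckr_cst k (- p%:R)) (IH p.+1 (CkrS fS)))
  (IH p.+2 (CkrS fS))) (Df v)) => x.
by have [_ ->] := e x v.
Qed.

End SmoothFunctions.

Section Step.
Context {R : realType}.
Implicit Types t : R.

(** Smooth transition from 1, for t at most 1/4, to 0, for t at least 1/2. It is applied to squared
    ratios: [bump a r] is 1 up to distance r / 2 and 0 from distance r / sqrt 2 on, in particular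
    from 3/4 r on. *)
Definition step t : R :=
  flat 0 (1 / 2 - t) / (flat 0 (1 / 2 - t) + flat 0 (t - 1 / 4)).

Lemma flat_ge0 p t : 0 <= flat p t.
Proof. by have /andP[] := flat_bound p t. Qed.

Lemma flat_le0 p t : t <= 0 -> flat p t = 0.
Proof. by move=> t0; rewrite /flat ltNge t0. Qed.

Lemma flat0_gt0 t : 0 < t -> 0 < flat 0 t.
Proof. by move=> t0; rewrite /flat t0 mul1r expR_gt0. Qed.

Lemma flat0_ge t : 1 / 8 <= t -> flat 0 (1 / 8 : R) <= flat 0 t.
Proof.
move=> t8; have t0 : 0 < t by apply: lt_le_trans t8; lra.
have h : 0 < 1 / 8 :> R by lra.
rewrite /flat t0 h !mul1r ler_expR lerN2 lef_pV2 ?posrE//; lra.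
Qed.

(** The two arguments add up to 1/4, so one of them is at least 1/8. *)
Lemma step_den t : flat 0 (1 / 8 : R) <= flat 0 (1 / 2 - t) + flat 0 (t - 1 / 4).
Proof.
have [h|h] := leP (1 / 8) (1 / 2 - t).
  by apply: le_trans (flat0_ge h) _; rewrite lerDl flat_ge0.
have {}h : 1 / 8 <= t - 1 / 4 by lra.
by apply: le_trans (flat0_ge h) _; rewrite lerDr flat_ge0.
Qed.

Lemma step_den_gt0 t : 0 < flat 0 (1 / 2 - t) + flat 0 (t - 1 / 4).
Proof. by apply: lt_le_trans (step_den t); apply: flat0_gt0; lra. Qed.

Lemma step_ge0 t : 0 <= step t.
Proof. by rewrite /step divr_ge0 ?flat_ge0// ltW// step_den_gt0. Qed.

Lemma step_le1 t : step t <= 1.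
Proof. by rewrite /step ler_pdivrMr ?step_den_gt0// [leRHS]mul1r lerDl flat_ge0. Qed.

Lemma step1 t : t <= 1 / 4 -> step t = 1.
Proof.
move=> h; have := step_den_gt0 t.
rewrite /step (@flat_le0 0 (t - 1 / 4)) ?addr0; last by lra.
by move=> h1; rewrite divff// gt_eqF.
Qed.

Lemma step0 t : 1 / 2 <= t -> step t = 0.
Proof. by move=> h; rewrite /step flat_le0 ?mul0r//; lra. Qed.

Lemma smooth_step (V : normedModType R) (f : V -> R) :
  smooth f -> smooth (fun x => step (f x)).
Proof.
move=> fs k; apply: CkrM.
  by apply: Ckr_flat; apply: CkrD; [exact: Ckr_cst|exact: smoothN].
apply: CkrV; first by move=> x; rewrite gt_eqF// step_den_gt0.
apply: CkrD; apply: Ckr_flat; apply: CkrD => //.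
- exact: Ckr_cst.
- exact: smoothN.
- exact: Ckr_cst.
Qed.

Definition dstep t : R :=
  - (flat 2 (1 / 2 - t) * flat 0 (t - 1 / 4) +
     flat 0 (1 / 2 - t) * flat 2 (t - 1 / 4)) /
  (flat 0 (1 / 2 - t) + flat 0 (t - 1 / 4)) ^+ 2.

Lemma is_derive_step t : is_derive t (1 : R) step (dstep t).
Proof.
have hA : is_derive t (1 : R) (fun s : R => flat 0 (1 / 2 - s)) (- flat 2 (1 / 2 - t)).
  have h1 : is_derive t (1 : R) (fun s : R => 1 / 2 - s) (0 - 1).
    exact: (is_deriveB (is_derive_cst _ _ _) (is_derive_id _ _)).
  have := @is_derive1_comp _ (flat 0) (fun s => 1 / 2 - s) t _ _
    (is_derive_flat 0 (1 / 2 - t)) h1.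
  by rewrite oppr0 mul0r add0r sub0r mulrN1.
have hB : is_derive t (1 : R) (fun s : R => flat 0 (s - 1 / 4)) (flat 2 (t - 1 / 4)).
  have h1 : is_derive t (1 : R) (fun s : R => s - 1 / 4) (1 - 0).
    exact: (is_deriveB (is_derive_id _ _) (is_derive_cst _ _ _)).
  have := @is_derive1_comp _ (flat 0) (fun s => s - 1 / 4) t _ _
    (is_derive_flat 0 (t - 1 / 4)) h1.
  by rewrite oppr0 mul0r add0r addr0 mulr1.
have d0 : flat 0 (1 / 2 - t) + flat 0 (t - 1 / 4) != 0.
  by rewrite gt_eqF// step_den_gt0.
have hV := @is_deriveV _ (fun s => flat 0 (1 / 2 - s) + flat 0 (s - 1 / 4)) t _ 1 d0
  (is_deriveD hA hB).
apply: (is_derive_eq (is_deriveM hA hV)).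
rewrite /dstep !/(_ *: _)/=.
by field.
Qed.

Lemma dstep_le0 t : dstep t <= 0.
Proof.
rewrite /dstep mulNr oppr_le0 divr_ge0 ?sqr_ge0//.
by rewrite addr_ge0// mulr_ge0// flat_ge0.
Qed.

Lemma dstep_eq0 t : t <= 1 / 4 \/ 1 / 2 <= t -> dstep t = 0.
Proof.
rewrite /dstep => -[h|h].
  by rewrite !(@flat_le0 _ (t - 1 / 4)) ?mulr0 ?addr0 ?oppr0 ?mul0r//; lra.
by rewrite !(@flat_le0 _ (1 / 2 - t)) ?mul0r ?addr0 ?oppr0 ?mul0r//; lra.
Qed.

(** By [flat_bound], [flat 2] is at most 4! = 24 on [0, 1/4]; 48 leaves a margin of a factor 2, and
    the denominator is the lower bound of [step_den]. *)
Definition Cstep : R := 48 / flat 0 (1 / 8 : R).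

Lemma Cstep_ge0 : 0 <= Cstep. Proof. by rewrite divr_ge0// flat_ge0. Qed.

Lemma dstep_ge t : - Cstep <= dstep t.
Proof.
have [h|h1] := leP t (1 / 4); first by rewrite dstep_eq0 ?oppr_le0 ?Cstep_ge0//; left.
have [h|h2] := leP (1 / 2) t; first by rewrite dstep_eq0 ?oppr_le0 ?Cstep_ge0//; right.
rewrite /dstep mulNr lerN2.
have b8 : 0 < flat 0 (1 / 8 : R) by apply: flat0_gt0; lra.
have b s : 0 <= s <= 1 / 4 -> flat 2 s <= 24 :> R.
  move=> /andP[s0 s1]; have /andP[_ /le_trans] := flat_bound 2 s; apply.
  have -> : (4`!)%:R = 24 :> R by [].
  have : s ^+ 2 <= 1 by rewrite expr_le1//; lra.
  by move=> ?; lra.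
have bA := b (1 / 2 - t) ltac:(lra); have bB := b (t - 1 / 4) ltac:(lra).
have := step_den t; have := step_den_gt0 t.
have := flat_ge0 2 (1 / 2 - t); have := flat_ge0 2 (t - 1 / 4).
have := flat_ge0 0 (1 / 2 - t); have := flat_ge0 0 (t - 1 / 4).
rewrite /Cstep.
move: bA bB b8.
set A' := flat 2 _; set B' := flat 2 _; set A := flat 0 (1 / 2 - t).
set B := flat 0 (t - 1 / 4); set m := flat 0 (1 / 8).
move=> bA bB m0 B0 A0 B'0 A'0 D0 mD.
rewrite ler_pdivrMr ?exprn_gt0// -mulrA mulrCA ler_pdivlMl//.
apply: (@le_trans _ _ (m * (48 * (A + B)))).
  by rewrite ler_wpM2l ?(ltW m0)//; nra.
by rewrite mulrCA ler_wpM2l// expr2 ler_wpM2r// ltW.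
Qed.

End Step.

(** * Smooth vector fields and divergence along a plane *)

Section Fields.
Context {R : realType} {n : nat}.
Notation field := ('rV[R]_n -> 'rV[R]_n).
Implicit Types (g h : field) (f : 'rV[R]_n -> R) (U : set 'rV[R]_n).

Lemma Ckr_coord k i : Ckr k (fun x : 'rV[R]_n => x 0 i).
Proof.
have D v x : 'D_v (fun x : 'rV[R]_n => x 0 i) x = v 0 i.
  have -> : v 0 i = ('D_v (@id 'rV[R]_n) x) 0 i by rewrite derive_id.
  by rewrite derive_mx ?mxE//; exact: derivable_id.
case: k => [|k]; first by move=> x; exact: coord_continuous.
split=> [x|v]; first exact: differentiable_coord.
by apply: eq_Ckr (Ckr_cst k (v 0 i)) => x; rewrite D.
Qed.

Lemma smooth_coord i : smooth (fun x : 'rV[R]_n => x 0 i).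
Proof. by move=> k; exact: Ckr_coord. Qed.

Lemma derive_coord g x v i : differentiable g x ->
  ('D_v g x) 0 i = 'D_v (fun y => g y 0 i) x.
Proof. by move=> dg; rewrite derive_mx ?mxE//; exact: diff_derivable. Qed.

Lemma differentiable_coordP g x :
  differentiable g x <-> forall i, differentiable (fun y => g y 0 i) x.
Proof.
split=> [dg i|dg].
  apply: (@differentiable_comp _ _ _ _ g (fun y : 'rV[R]_n => y 0 i)) => //.
  exact: differentiable_coord.
rewrite (_ : g = \sum_(i < n) (fun y => g y 0 i *: delta_mx 0 i)).
  by apply: differentiable_sum => i; apply: differentiableZl.
by apply/funext => y; rewrite fct_sumE [LHS]row_sum_delta.
Qed.

Lemma CkP k g : Ck k g <-> forall i, Ckr k (fun x => g x 0 i).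
Proof.
elim: k g => [|k IH] g /=.
  split=> [cg i x|cg x].
    apply: (@cvg_comp _ _ _ g (fun y : 'rV[R]_n => y 0 i)); first exact: cg.
    exact: coord_continuous.
  rewrite (_ : g = \sum_(i < n) (fun y => g y 0 i *: delta_mx 0 i)); last first.
    by apply/funext => y; rewrite fct_sumE [LHS]row_sum_delta.
  rewrite /continuous_at; elim/big_ind: _ => [|f1 f2 h1 h2|i _].
  - exact: (@cvg_cst _ (0 : 'rV[R]_n) _ (nbhs x) (nbhs_filter x)).
  - exact: (@cvgD _ _ _ (nbhs x) (nbhs_filter x) f1 f2 _ _ h1 h2).
  - exact: (@cvgZr_tmp _ _ _ (nbhs x) (nbhs_filter x) _ _ _ (cg i x)).
split=> [[dg Dg] i|gi].
  split=> [x|v]; first exact: (differentiable_coordP g x).1.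
  apply: eq_Ckr ((IH _).1 (Dg v) i) => x.
  exact: derive_coord.
have dg x : differentiable g x by apply/differentiable_coordP => i; exact: (gi i).1.
split=> // v; apply/IH => i; apply: eq_Ckr ((gi i).2 v) => x.
by rewrite derive_coord.
Qed.

Lemma fsupport_sub (C : set 'rV[R]_n) (W : zmodType) (g : 'rV[R]_n -> W) :
  closed C -> (forall x, ~ C x -> g x = 0) -> fsupport g `<=` C.
Proof.
move=> cC gC; rewrite (closure_id C).1//; apply: closure_subset => x /= /eqP gx.
by apply: contrapT => /gC.
Qed.

Lemma fsupport0 (W : zmodType) (g : 'rV[R]_n -> W) x : ~ fsupport g x -> g x = 0.
Proof.
move=> h; apply: contrapT => /eqP gx; apply: h; exact: subset_closure.
Qed.

Lemma test_fieldP U g (K : set 'rV[R]_n) : compact K -> K `<=` U ->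
  (forall i, smooth (fun x => g x 0 i)) -> (forall x, ~ K x -> g x = 0) ->
  test_field U g.
Proof.
move=> cK KU gs gK.
have clK : closed K by apply: compact_closed => //; exact: norm_hausdorff.
have sK := fsupport_sub clK gK; split => //.
- by move=> k; apply/CkP => i; exact: gs.
- by apply: subclosed_compact cK sK; exact: closed_closure.
- exact: subset_trans KU.
Qed.

Lemma test_field_smooth U g i : test_field U g -> smooth (fun x => g x 0 i).
Proof. by move=> [gs _ _] k; exact: (CkP k g).1. Qed.

Lemma test_field_diff U g x : test_field U g -> differentiable g x.
Proof. by move=> [/(_ 1%N)[]]. Qed.

Lemma smooth_diff f x : smooth f -> differentiable f x.
Proof. by move=> /(_ 1%N)[]. Qed.

Lemma smooth_continuous f : smooth f -> continuous f.
Proof. by move=> /(_ 0%N). Qed.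

Lemma test_fieldD U g h : test_field U g -> test_field U h ->
  test_field U (fun x => g x + h x).
Proof.
move=> tg th; have [_ cg gU] := tg; have [_ ch hU] := th.
apply: (@test_fieldP U _ (fsupport g `|` fsupport h)).
- exact: compactU.
- by rewrite subUset.
- move=> i k; apply: eq_Ckr (CkrD (test_field_smooth i tg k) (test_field_smooth i th k)).
  by move=> x; rewrite mxE.
- by move=> x /not_orP[/fsupport0 -> /fsupport0 ->]; rewrite addr0.
Qed.

Lemma test_fieldZ U g f : test_field U g -> smooth f ->
  test_field U (fun x => f x *: g x).
Proof.
move=> tg sf; have [_ cg gU] := tg.
apply: (@test_fieldP U _ (fsupport g)) => //.
- move=> i k; apply: eq_Ckr (CkrM (sf k) (test_field_smooth i tg k)).
  by move=> x; rewrite mxE.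
- by move=> x /fsupport0 ->; rewrite scaler0.
Qed.

Lemma test_field0 U : test_field U (fun=> 0).
Proof.
apply: (@test_fieldP U _ set0) => //; first exact: compact0.
by move=> i k; apply: eq_Ckr (Ckr_cst k 0) => x; rewrite mxE.
Qed.

Definition sqdist (a x : 'rV[R]_n) : R := edot (x - a) (x - a).

Lemma smooth_sqdist a : smooth (sqdist a).
Proof.
have h i : smooth (fun x : 'rV[R]_n => (x - a) 0 i).
  move=> k; apply: eq_Ckr (CkrD (Ckr_coord k i) (Ckr_cst k (- a 0 i))) => x.
  by rewrite !mxE.
by apply: smooth_sum => i; apply: smoothM.
Qed.

Lemma derive_sqdist a x v : 'D_v (sqdist a) x = 2 * edot v (x - a).
Proof.
have e (i : 'I_n) : is_derive x v (fun y : 'rV[R]_n => (y - a) 0 i) (v 0 i).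
  have h1 : is_derive x v (fun y : 'rV[R]_n => y 0 i) (v 0 i).
    apply: DeriveDef; first exact/diff_derivable/differentiable_coord.
    by rewrite -(@derive_coord id x v i) ?derive_id//; exact: differentiable_id.
  have := is_deriveB h1 (is_derive_cst (a 0 i) x v).
  rewrite subr0; congr is_derive; apply/funext => y.
  by rewrite !mxE.
have := is_derive_sum (fun i => is_deriveM (e i) (e i)).
rewrite (_ : \sum_(i < n) _ = sqdist a); last first.
  by apply/funext => y; rewrite fct_sumE.
move=> [_ ->]; rewrite /edot mulr_sumr; apply: eq_bigr => i _.
by rewrite /(_ *: _)/= mulrC mulr_natl mulr2n.
Qed.

Lemma differentiable_scale f g x : differentiable f x -> differentiable g x ->
  differentiable (fun y => f y *: g y) x.
Proof.
move=> df dg; apply/differentiable_coordP => i.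
rewrite (_ : (fun _ => _) = f * (fun y => g y 0 i)).
  by apply: differentiableM => //; exact: (differentiable_coordP g x).1.
by apply/funext => y; rewrite mxE.
Qed.

Lemma derive_scale f g x v : differentiable f x -> differentiable g x ->
  'D_v (fun y => f y *: g y) x = 'D_v f x *: g x + f x *: 'D_v g x.
Proof.
move=> df dg; have dfg := differentiable_scale df dg.
apply/rowP => i; rewrite derive_coord// !mxE derive_coord//.
rewrite (_ : (fun _ => _) = f * (fun y => g y 0 i)); last first.
  by apply/funext => y; rewrite mxE.
rewrite deriveM; first by rewrite addrC [g x 0 i *: _]mulrC.
  exact: diff_derivable.
by apply: diff_derivable; exact: (differentiable_coordP g x).1.
Qed.

(* The divergence of g along the plane with orthogonal projection P. *)
Definition pdiv (P : 'M[R]_n) g x : R := \tr ('J g x *m P).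

Lemma pdivE P g x : differentiable g x ->
  pdiv P g x = \sum_i ('D_(delta_mx 0 i) g x *m P) 0 i.
Proof.
move=> dg; apply: eq_bigr => i _; rewrite deriveEjacobian// -mulmxA.
by rewrite -rowE [RHS]mxE.
Qed.

Lemma pdivD P g h x : differentiable g x -> differentiable h x ->
  pdiv P (fun y => g y + h y) x = pdiv P g x + pdiv P h x.
Proof.
move=> dg dh; rewrite !pdivE//; last exact: differentiableD.
rewrite -big_split; apply: eq_bigr => i _ /=.
by rewrite (@deriveD _ _ _ g h) ?mulmxDl ?mxE//; exact: diff_derivable.
Qed.

Lemma pdiv_scale P f g x : differentiable f x -> differentiable g x ->
  pdiv P (fun y => f y *: g y) x = f x * pdiv P g x + 'D_(g x *m P) f x.
Proof.
move=> df dg; rewrite !pdivE//; last exact: differentiable_scale.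
have e i : ('D_(delta_mx 0 i) (fun y => f y *: g y) x *m P) 0 i =
    'D_(delta_mx 0 i) f x * (g x *m P) 0 i + f x * ('D_(delta_mx 0 i) g x *m P) 0 i.
  by rewrite derive_scale// mulmxDl -!scalemxAl [LHS]mxE; congr (_ + _);
    rewrite [LHS]mxE.
under eq_bigr do rewrite e.
rewrite big_split/= -mulr_sumr addrC; congr (_ + _).
rewrite [in RHS](row_sum_delta (g x *m P)) deriveE// linear_sum.
by apply: eq_bigr => i _; rewrite linearZ/= -deriveE// mulrC.
Qed.

Lemma pdiv_id P a x : pdiv P (fun y => y - a) x = \tr P.
Proof.
have dg : differentiable (fun y : 'rV[R]_n => y - a) x.
  by apply: differentiableB => //; exact: differentiable_id.
rewrite pdivE//; apply: eq_bigr => i _.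
rewrite (@deriveB _ _ _ id (cst a)) ?derive_id ?derive_cst ?subr0.
- by rewrite -rowE mxE.
- exact: derivable_id.
- exact: derivable_cst.
Qed.

End Fields.

(** * Cutoff functions with controlled gradient *)

Section Cutoff.
Context {R : realType} {n : nat}.
Implicit Types (K G : set 'rV[R]_n) (a x v : 'rV[R]_n) (r : R).

Lemma derive_step (f : 'rV[R]_n -> R) x v : differentiable f x ->
  'D_v (fun y => step (f y)) x = dstep (f x) * 'D_v f x.
Proof. by move=> df; have [_] := derive_comp1 v df (is_derive_step (f x)). Qed.

Definition bump a r x : R := step (sqdist a x / r ^+ 2).

Lemma sqdist_ge0 a x : 0 <= sqdist a x. Proof. exact: edot_ge0. Qed.

Lemma sqdistE a x : sqdist a x = enorm (x - a) ^+ 2.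
Proof. by rewrite sqr_enorm. Qed.

Lemma smooth_bump a r : smooth (bump a r).
Proof.
by apply: smooth_step; apply: smoothM; [exact: smooth_sqdist|exact: smooth_cst].
Qed.

Lemma bump1 a r x : 0 < r -> enorm (x - a) <= r / 2 -> bump a r x = 1.
Proof.
move=> r0 h; apply: step1; rewrite ler_pdivrMr ?exprn_gt0// sqdistE.
have := enorm_ge0 (x - a); nra.
Qed.

Lemma bump0 a r x : 0 < r -> 3 / 4 * r <= enorm (x - a) -> bump a r x = 0.
Proof.
move=> r0 h; apply: step0; rewrite ler_pdivlMr ?exprn_gt0// sqdistE; nra.
Qed.

Lemma derive_bump a r x v :
  'D_v (bump a r) x = dstep (sqdist a x / r ^+ 2) * (2 * edot v (x - a) / r ^+ 2).
Proof.
have ds := smooth_diff x (smooth_sqdist a).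
have e : (fun y => sqdist a y / r ^+ 2) = (r ^+ 2)^-1 \*: sqdist a.
  by apply/funext => y; rewrite /= mulrC.
rewrite /bump derive_step; last by rewrite e; exact: differentiableZ.
congr (_ * _); rewrite e deriveZ; last exact: diff_derivable.
by rewrite derive_sqdist; exact: mulrC.
Qed.

Lemma derive_bump_le a r x v : 0 < r ->
  `|'D_v (bump a r) x| <= 2 * Cstep / r * enorm v.
Proof.
move=> r0; rewrite derive_bump normrM.
have C0 : 0 <= Cstep :> R := Cstep_ge0.
have [h|h] := leP (1 / 2) (sqdist a x / r ^+ 2).
  rewrite dstep_eq0; last by right.
  by rewrite normr0 mul0r mulr_ge0 ?enorm_ge0// divr_ge0 ?(ltW r0)// mulr_ge0.
have h1 : `|dstep (sqdist a x / r ^+ 2)| <= Cstep.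
  by rewrite ler0_norm ?dstep_le0// lerNl dstep_ge.
have h2 : enorm (x - a) <= r.
  move: h; rewrite ltr_pdivrMr ?exprn_gt0// sqdistE => h.
  rewrite leNgt; apply/negP => h2; nra.
have -> : 2 * Cstep / r * enorm v = Cstep * (2 * (enorm v * r) / r ^+ 2).
  by field; rewrite gt_eqF.
have r2 : 0 <= (r ^+ 2)^-1 by rewrite invr_ge0 sqr_ge0.
rewrite ler_pM// ?normr_ge0// !normrM normr_nat (ger0_norm r2).
rewrite ler_wpM2r// ler_pM2l//.
apply: le_trans (edot_abs_le_enorm _ _) _.
by rewrite ler_wpM2l ?enorm_ge0.
Qed.

Lemma compact_ecover K (rho : 'rV[R]_n -> R) : compact K ->
  (forall a, K a -> 0 < rho a) ->
  exists s : seq 'rV[R]_n, (forall a, a \in s -> K a) /\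
    forall x, K x -> exists2 a, a \in s & eoball a (rho a) x.
Proof.
rewrite compact_cover => cK K0.
have [||D' D'K KD'] := cK _ K (fun a => eoball a (rho a)).
- by move=> a _; exact: eoball_open.
- by move=> x Kx; exists x => //; apply: eoball_center; exact: K0.
exists (finmap.enum_fset D'); split; first by move=> a /D'K; rewrite inE.
by move=> x /KD'[a /= aD xa]; exists a.
Qed.

Definition thick K r : set 'rV[R]_n := [set x | exists2 a, K a & enorm (x - a) <= r].

Lemma thick_compact K r : compact K -> compact (thick K r).
Proof.
move=> cK.
rewrite (_ : thick K r = (fun p : 'rV[R]_n * 'rV[R]_n => p.1 + p.2) @`
    (K `*` ecball 0 r)); last first.
  apply/seteqP; split=> [x [a Ka xa]|y [[a b] /= [Ka]]].
    exists (a, x - a); last by rewrite /= addrC subrK.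
    by split; rewrite //= /ecball/= subr0.
  by rewrite /ecball/= subr0 => br <-; exists a => //; rewrite addrAC subrr add0r.
apply: continuous_compact; last by apply: compact_setX => //; exact: ecball_compact.
apply: continuous_subspaceT => p; apply: add_continuous.
Qed.

(** Lebesgue number argument: K is covered by finitely many balls of half the admissible radii, and
    the least of these radii is a margin. *)
Lemma thick_margin K G : compact K -> open G -> K `<=` G ->
  exists2 r, 0 < r & thick K r `<=` G.
Proof.
move=> cK oG KG.
pose P a r := 0 < r /\ eoball a (2 * r) `<=` G.
have [rho rhoP] : exists rho : 'rV[R]_n -> R, forall a, K a -> P a (rho a).
  have h a : exists r, K a -> P a r.
    have [Ka|nK] := pselect (K a); last by exists 0.
    have [r r0 rG] := open_eoball oG (KG _ Ka).
    exists (r / 2) => _; split; first by rewrite divr_gt0.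
    by rewrite mulrC divfK.
  by have [f fP] := choice h; exists f.
have [s [sK Ks]] := compact_ecover cK (fun a Ka => (rhoP a Ka).1).
exists (\big[Num.min/1]_(a <- s) rho a).
  rewrite big_seq; elim/big_ind: _ => //.
    by move=> x y x0 y0; rewrite lt_min x0.
  by move=> a /sK /rhoP[].
move=> x [y /Ks[a sa ay] xy]; apply: (rhoP a (sK _ sa)).2.
rewrite /eoball/=; apply: le_lt_trans (enorm_triangleB x y a) _.
rewrite mulr_natl mulr2n ler_ltD//; apply: le_trans xy _.
exact: (ge_bigmin_seq _ a xpredT).
Qed.

(** One factor bounds the derivative of the bumps, the other that of the outer [step] in
    [smooth_cutoff]. *)
Definition Ccut : R := Cstep ^+ 2.

(** The gradient bound must not depend on the number of balls covering K, which rules out sums and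
    products of bumps. A smooth maximum is used instead: the derivative of u = b^-1 ln (sum of exp
    (b f_a)) is a weighted mean of those of the bumps f_a, hence obeys their common bound. The bumps
    have radius 4 r around centers whose r-balls cover K, so that some f_a is 1 on [thick K r] and
    all vanish off [thick K (3 * r)]. *)
Lemma smooth_cutoff K r : 0 < r -> compact K ->
  exists chi : 'rV[R]_n -> R, [/\ smooth chi, forall x, 0 <= chi x <= 1,
    forall x, thick K r x -> chi x = 1,
    forall x, ~ thick K (3 * r) x -> chi x = 0 &
    forall x v, `|'D_v chi x| <= Ccut / r * enorm v].
Proof.
move=> r0 cK; have [s [sK Ks]] := compact_ecover cK (fun _ _ => r0).
have [s0|s0] := eqVneq s [::].
  exists (fun=> 0); split => //.
  - exact: smooth_cst.
  - by move=> x; rewrite lexx ler01.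
  - by move=> x [a /Ks[]]; rewrite s0.
  - move=> x v; rewrite derive_cst normr0 mulr_ge0 ?enorm_ge0//.
    by rewrite divr_ge0 ?sqr_ge0// ltW.
pose N : R := (size s)%:R.
have N1 : 1 <= N by rewrite ler1n lt0n size_eq0.
(* Where all bumps vanish, u = ln N / b is at most 1/4, so that [step] is 1; where one of them is 1,
   u is at least 1, so that [step] is 0. *)
pose b : R := 4 * ln N + 1.
have lnN : 0 <= ln N by rewrite ln_ge0.
have b0 : 0 < b by rewrite /b; lra.
pose f a := bump a (4 * r).
pose S x : R := \sum_(a <- s) expR (b * f a x).
have r4 : 0 < 4 * r by rewrite mulr_gt0.
have fs a : smooth (f a) by exact: smooth_bump.
have Ss : smooth S.
  apply: smooth_sum => a k; apply: Ckr_expR; apply: CkrM; first exact: Ckr_cst.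
  exact: fs.
have S0 x : 0 < S x.
  have [c sc] : exists c, c \in s.
    by case: (s) s0 => // c t _; exists c; rewrite mem_head.
  rewrite /S (big_rem c)//= ltr_wpDr ?expR_gt0//.
  by apply: sumr_ge0 => d _; exact: expR_ge0.
pose u x := b^-1 * ln (S x).
have us : smooth u.
  by move=> k; apply: CkrM; [exact: Ckr_cst|apply: Ckr_ln].
have Du x v : `|'D_v u x| <= Cstep / (2 * r) * enorm v.
  have dS := smooth_diff x Ss.
  have dlnS : differentiable (fun y => ln (S y)) x.
    by apply: smooth_diff => k; apply: Ckr_ln.
  have -> : u = b^-1 \*: (fun y => ln (S y)) by [].
  rewrite deriveZ; last exact: diff_derivable.
  have [_ /= ->] := derive_comp1 v dS (is_derive1_ln (S0 x)).
  have -> : 'D_v S x = \sum_(a <- s) b * (expR (b * f a x) * 'D_v (f a) x).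
    rewrite /S; elim: (s) => [|a t IH].
      rewrite big_nil (_ : (fun _ => _) = cst 0) ?derive_cst//.
      by apply/funext => y; rewrite big_nil.
    have se c : smooth (fun y => expR (b * f c y)).
      by move=> k; apply: Ckr_expR; apply: CkrM; [exact: Ckr_cst|exact: fs].
    rewrite big_cons -IH (_ : (fun y => \sum_(c <- _ :: _) _) =
      (fun y => expR (b * f a y)) + (fun y => \sum_(c <- t) expR (b * f c y))).
      rewrite deriveD; last 2 first.
      - by apply: diff_derivable; exact: smooth_diff.
      - by apply: diff_derivable; apply: smooth_diff; exact: smooth_sum.
      congr (_ + _).
      have df : differentiable (b \*: f a) x.
        by apply: differentiableZ; exact: smooth_diff.
      have [_] := derive_comp1 v df (is_derive_expR (b * f a x)).
      rewrite deriveZ; last by apply: diff_derivable; exact: smooth_diff.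
      by move=> /= ->; rewrite mulrCA.
    by apply/funext => y; rewrite big_cons.
  rewrite -mulr_sumr /(_ *: _)/= mulrCA mulKf ?gt_eqF//.
  rewrite normrM normfV (gtr0_norm (S0 x)) mulrC ler_pdivrMr//.
  apply: le_trans (ler_norm_sum _ _ _) _; rewrite mulr_sumr.
  apply: ler_sum => a _; rewrite normrM (gtr0_norm (expR_gt0 _)) mulrC.
  rewrite ler_wpM2r ?expR_ge0//; apply: le_trans (derive_bump_le _ _ _ r4) _.
  by rewrite le_eqVlt; apply/orP; left; apply/eqP; field; rewrite gt_eqF.
exists (fun x => 1 - step (u x)); split.
- by apply: smoothB; [exact: smooth_cst|exact: smooth_step].
- by move=> x; rewrite subr_ge0 step_le1 lerBlDr lerDl step_ge0.
- move=> x [y /Ks[a sa ay] xy]; rewrite step0 ?subr0//.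
  apply: (@le_trans _ _ 1); first by lra.
  rewrite /u mulrC ler_pdivlMr// mul1r -[leLHS]expRK ler_ln ?posrE ?expR_gt0//.
  rewrite /S (big_rem a)//= -[leLHS]addr0 lerD//.
    rewrite /f bump1 ?mulr1//; apply: le_trans (enorm_triangleB x y a) _.
    by move: ay; rewrite /eoball/= => ay; lra.
  by apply: sumr_ge0 => c _; exact: expR_ge0.
- move=> x xK; have Sx : S x = N.
    rewrite /S big_seq (eq_bigr (fun=> 1)) => [|a sa].
      by rewrite -big_seq big_const_seq count_predT iter_addr addr0.
    rewrite /f bump0 ?mulr0 ?expR0//.
    have -> : 3 / 4 * (4 * r) = 3 * r by lra.
    rewrite leNgt; apply/negP => h; apply: xK; exists a; [exact: sK|exact: ltW].
  rewrite /u Sx step1 ?subrr// mulrC ler_pdivrMr//.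
  by rewrite /b; lra.
- move=> x v.
  have ds : differentiable (fun y => step (u y)) x.
    by apply: smooth_diff; exact: smooth_step.
  rewrite (_ : (fun _ => _) = cst 1 - (fun y => step (u y)))//.
  rewrite deriveB ?derive_cst//; last exact: diff_derivable.
  rewrite sub0r normrN derive_step; last exact: smooth_diff.
  rewrite normrM.
  have h1 : `|dstep (u x)| <= Cstep by rewrite ler0_norm ?dstep_le0// lerNl dstep_ge.
  apply: (@le_trans _ _ (Cstep * (Cstep / (2 * r) * enorm v))).
    by apply: ler_pM => //; exact: Du.
  rewrite mulrA ler_wpM2r ?enorm_ge0// /Ccut expr2 -mulrA.
  rewrite ler_wpM2l ?Cstep_ge0// ler_wpM2l ?Cstep_ge0//.
  by rewrite lef_pV2 ?posrE ?mulr_gt0//; lra.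
Qed.

(** That chi is 1 on an open set O around K, and not just on K, keeps the support of (1 - chi) g
    away from K. *)
Lemma smooth_urysohn K G : compact K -> open G -> K `<=` G ->
  exists chi : 'rV[R]_n -> R, exists O L : set 'rV[R]_n,
  [/\ [/\ smooth chi, forall x, 0 <= chi x <= 1 & forall x, O x -> chi x = 1],
      [/\ open O & K `<=` O],
      [/\ compact L, O `<=` L & L `<=` G] &
      forall x, ~ L x -> chi x = 0].
Proof.
move=> cK oG KG; have [r r0 rG] := thick_margin cK oG KG.
have r3 : 0 < r / 3 by rewrite divr_gt0.
have [chi [cs c01 c1 c0 _]] := smooth_cutoff r3 cK.
exists chi, (\bigcup_(a in K) eoball a (r / 3)), (thick K r); split.
- split => // x [a Ka xa]; apply: c1; exists a => //; exact: ltW.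
- split; first by apply: bigcup_open => a _; exact: eoball_open.
  by move=> x Kx; exists x => //; exact: eoball_center.
- split => //; first exact: thick_compact.
  move=> x [a Ka xa]; exists a => //; apply: le_trans (ltW xa) _; lra.
- by move=> x; rewrite -[X in thick K X](divfK (_ : 3 != 0)) // mulrC; exact: c0.
Qed.

End Cutoff.

(** * Compactness of the Grassmannian *)

Section OrthogonalProjection.
Context {R : realType} {n : nat}.
Implicit Types (S : {vspace 'rV[R]_n}) (P Q : 'M[R]_n) (u v w : 'rV[R]_n).

Definition is_proj S P := forall v, v *m P \in S /\
  forall w, w \in S -> (v - v *m P) *m w^T = 0.

Lemma is_proj_unique S P Q : is_proj S P -> is_proj S Q -> P = Q.
Proof.
move=> hP hQ; apply/row_matrixP => i; rewrite !rowE.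
set v := delta_mx 0 i; apply/eqP; rewrite -subr_eq0; apply/eqP/edot_eq0.
have [vP vP0] := hP v; have [vQ vQ0] := hQ v.
have dS : v *m P - v *m Q \in S by rewrite memvB.
rewrite edotE -[in X in X *m _](subrKA v) addrC -opprB mulmxBl.
by rewrite [X in X - _]vQ0// vP0// subrr mxE.
Qed.

(* With the rows of B a basis of S, the projection is B^T (B B^T)^-1 B. *)
Lemma orth_proj_spec S : [/\ is_proj S (orth_proj S),
  (orth_proj S)^T = orth_proj S & \tr (orth_proj S) = (\dim S)%:R].
Proof.
pose b := vbasis S.
pose B : 'M[R]_(\dim S, n) := \matrix_(i < \dim S) b`_i.
have mulB (c : 'rV_(\dim S)) : c *m B = \sum_i c 0 i *: b`_i.
  by rewrite mulmx_sum_row; apply: eq_bigr => i _; rewrite rowK.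
have memB v : (v \in S) -> exists c, v = c *m B.
  move=> vS; exists (\row_i coord b i v); rewrite mulB {1}(coord_vbasis vS).
  by apply: eq_bigr => i _; rewrite mxE.
have Bmem c : c *m B \in S.
  rewrite mulB; apply: memv_suml => i _; apply: memvZ.
  by apply: vbasis_mem; rewrite mem_nth// size_tuple.
have Binj (c : 'rV_(\dim S)) : c *m B = 0 -> c = 0.
  rewrite mulB => h; apply/rowP => i; rewrite mxE.
  exact: (elimT freeP (basis_free (vbasisP S)) (fun i => c 0 i) h i).
pose G := B *m B^T.
have Gu : G \in unitmx.
  rewrite -row_free_unit -kermx_eq0; apply/rowV0P => c /sub_kermxP cG.
  apply: Binj; apply: edot_eq0.
  by rewrite edotE trmx_mul mulmxA -(mulmxA c) cG mul0mx mxE.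
pose P := B^T *m invmx G *m B.
have PP : is_proj S P.
  move=> v; split; first by rewrite /P !mulmxA; exact: Bmem.
  move=> w /memB[c ->]; rewrite trmx_mul mulmxBl /P !mulmxA.
  by rewrite -(mulmxA _ B B^T) -/G -(mulmxA _ (invmx G) G) mulVmx// mulmx1 subrr.
have Porth : orth_proj S = P.
  rewrite /orth_proj; case: xgetP => [Q _ hQ|/(_ P)//].
  exact: (@is_proj_unique S).
rewrite Porth; split => //.
  have GT : G^T = G by rewrite /G trmx_mul trmxK.
  by rewrite /P !trmx_mul trmx_inv GT trmxK mulmxA.
by rewrite /P -mulmxA mxtrace_mulC -mulmxA -/G mulVmx// mxtrace1.
Qed.

Lemma orth_proj_idem S : orth_proj S *m orth_proj S = orth_proj S.
Proof.
have [hP _ _] := orth_proj_spec S; apply/row_matrixP => i; rewrite rowE mulmxA.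
rewrite rowE; set v := delta_mx 0 i.
have [vP _] := hP v; have [vPP h] := hP (v *m orth_proj S).
apply/esym/eqP; rewrite -subr_eq0; apply/eqP/edot_eq0; rewrite edotE h ?mxE//.
by rewrite memvB.
Qed.

Lemma proj_image P : P *m P = P -> P^T = P ->
  exists S : {vspace 'rV[R]_n}, is_proj S P.
Proof.
move=> PP PT; exists (limg (linfun (mulmxr P))) => v; split.
  by have := memv_img (linfun (mulmxr P)) (memvf v); rewrite lfunE.
move=> w /memv_imgP[u _ ->]; rewrite lfunE/= trmx_mul PT mulmxBl !mulmxA.
by rewrite -(mulmxA v P P) PP subrr.
Qed.

End OrthogonalProjection.

Section GrassmannianTheory.
Context {R : realType} {n m : nat} {mn : (m <= n)%N}.
Notation G := (grassmannian R mn).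
Implicit Types S : G.

Lemma gproj_trace S : \tr (gproj S) = m%:R.
Proof. by have [_ _ ->] := orth_proj_spec (sval S); rewrite (eqP (svalP S)). Qed.

Lemma gproj_sym S : (gproj S)^T = gproj S.
Proof. by have [] := orth_proj_spec (sval S). Qed.

Lemma gproj_idem S : gproj S *m gproj S = gproj S.
Proof. exact: orth_proj_idem. Qed.

Lemma edot_gproj S (v : 'rV[R]_n) : edot (v *m gproj S) v = enorm (v *m gproj S) ^+ 2.
Proof.
by rewrite sqr_enorm [RHS]edot_mul gproj_sym -mulmxA gproj_idem edotC.
Qed.

Lemma enorm_gproj S (v : 'rV[R]_n) : enorm (v *m gproj S) <= enorm v.
Proof.
have := edot_le_enorm (v *m gproj S) v; rewrite edot_gproj expr2.
have [->|h] := eqVneq (enorm (v *m gproj S)) 0; first by rewrite enorm_ge0.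
by rewrite ler_pM2l// lt_neqAle eq_sym h enorm_ge0.
Qed.

Definition proj_set : set 'M[R]_n :=
  [set P | [/\ P *m P = P, P^T = P & \tr P = m%:R]].

Lemma gproj_range : range (@gproj R n m mn) = proj_set.
Proof.
apply/seteqP; split=> [_ [S _ <-]|P [PP PT Ptr]].
  by split; [exact: gproj_idem|exact: gproj_sym|exact: gproj_trace].
have [S hS] := proj_image PP PT.
have [hS' _ tr] := orth_proj_spec S.
have e := is_proj_unique hS hS'.
have dS : \dim S == m.
  by rewrite -(eqr_nat R) -tr -e Ptr.
by exists (exist _ S dS) => //; rewrite /gproj /= -e.
Qed.

(** As P is symmetric and idempotent, P_kk is the sum of the squares of row k; so P_kk^2 <= P_kk,
    P_kk <= 1, and all entries are bounded by 1. The defining conditions are polynomial equations in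
    the entries, hence closed. Vectorizing the matrices reduces the claim to row vectors. *)
Lemma proj_set_compact : compact proj_set.
Proof.
have vc : continuous (@vec_mx R n n).
  move=> x; apply/(@cvgrPdist_lt _ _ _ (nbhs x) (nbhs_filter x)) => e e0.
  apply/nbhs_ballP; exists e => // y; rewrite -ball_normE /=.
  apply: le_lt_trans; rewrite -linearB /=.
  rewrite [leLHS]/Num.norm/= mx_normrE; apply: bigmax_le => // -[i j] _ /=.
  by rewrite mxE; exact: coord_le_norm.
rewrite (_ : proj_set = @vec_mx R n n @` (@vec_mx R n n @^-1` proj_set)); last first.
  rewrite image_preimage// eqEsubset; split => // P _.
  by exists (mxvec P) => //; exact: mxvecK.
apply: continuous_compact; first exact: continuous_subspaceT.
apply: bounded_closed_compact.
  exists 1; split; first exact: num_real.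
  move=> x x1 v /= [PP PT _]; apply: le_trans (ltW x1).
  rewrite [leLHS]/Num.norm/= mx_normrE; apply: bigmax_le => // -[i0 k] _ /=.
  rewrite (ord1 i0); case/mxvec_indexP: k => i j.
  rewrite -[v]vec_mxK mxvecE; move: PP PT; move: (vec_mx v) => P PP PT.
  have h k l : P k l ^+ 2 <= P k k.
    have sym k' l' : P l' k' = P k' l' by rewrite -[in LHS]PT mxE.
    rewrite -[in leRHS]PP mxE (bigD1 l)//= sym -expr2 lerDl.
    by apply: sumr_ge0 => l' _; rewrite sym -expr2 sqr_ge0.
  have h1 : P i i <= 1 by have := h i i; nra.
  rewrite -sqrtr_sqr -[leRHS]sqrtr1; apply: ler_wsqrtr.
  exact: le_trans (h i j) h1.
pose e i j (v : 'rV[R]_(n * n)) := v 0 (mxvec_index i j).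
have es i j : smooth (e i j) by exact: smooth_coord.
have cl (f : 'rV[R]_(n * n) -> R) : smooth f -> closed [set v | f v = 0].
  move=> fs; rewrite (_ : [set _ | _] = f @^-1` [set 0])//.
  apply: closed_comp; last exact: closed_eq.
  by move=> x _; exact: smooth_continuous.
rewrite (_ : _ @^-1` _ =
  (\bigcap_(i in setT) \bigcap_(j in setT)
     [set v | \sum_k e i k v * e k j v - e i j v = 0]) `&`
  (\bigcap_(i in setT) \bigcap_(j in setT) [set v | e j i v - e i j v = 0]) `&`
  [set v | \sum_i e i i v - m%:R = 0]); last first.
  apply/seteqP; split=> [v [PP PT Ptr]|v [[hP hT] htr]].
    split; first split.
    - move=> i _ j _ /=; apply/eqP; rewrite subr_eq0; apply/eqP.
      transitivity ((vec_mx v *m vec_mx v) i j); last by rewrite PP mxE.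
      by rewrite mxE; apply: eq_bigr => k _; rewrite !mxE.
    - move=> i _ j _ /=; apply/eqP; rewrite subr_eq0; apply/eqP.
      transitivity ((vec_mx v)^T i j); first by rewrite !mxE.
      by rewrite PT mxE.
    - rewrite /= -[X in _ - X]Ptr; apply/eqP; rewrite subr_eq0; apply/eqP.
      by apply: eq_bigr => i _; rewrite mxE.
  split.
  - apply/matrixP => i j; have /eqP := hP i I j I; rewrite subr_eq0 => /eqP h.
    rewrite [RHS]mxE -[RHS]h mxE; apply: eq_bigr => k _.
    by rewrite !mxE.
  - apply/matrixP => i j; have /eqP := hT i I j I; rewrite subr_eq0 => /eqP h.
    by rewrite !mxE.
  - move/eqP : htr; rewrite subr_eq0 => /eqP <-.
    by apply: eq_bigr => i _; rewrite mxE.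
apply: closedI; first apply: closedI.
- apply: closed_bigI => i _; apply: closed_bigI => j _; apply: cl.
  apply: smoothB => //; apply: smooth_sum => k; exact: smoothM.
- apply: closed_bigI => i _; apply: closed_bigI => j _; apply: cl.
  exact: smoothB.
- apply: cl; apply: smoothB; last exact: smooth_cst.
  exact: smooth_sum.
Qed.

Lemma gproj_continuous : continuous (@gproj R n m mn).
Proof. exact: initial_continuous. Qed.

(** The topology is initial along [gproj], whose range is compact, so a cluster point of the image
    filter lifts to one in G. *)
Lemma grassmannian_compact : compact [set: G].
Proof.
move=> F PF FT.
have FP : (@gproj R n m mn @ F) proj_set.
  rewrite /fmap/= -gproj_range; apply: filterS FT => S _ /=.
  by exists S.
have [P [PC clP]] := proj_set_compact (fmap_proper_filter _ PF) FP.
move: PC; rewrite -gproj_range => -[S _ SP]; exists S; split=> // A B FA.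
rewrite nbhsE => -[B' [[Q oQ <-] QS] QB].
have : (@gproj R n m mn @` A `&` Q) !=set0.
  apply: clP.
    by apply: (@filterS _ F _ A) => // a Aa; exists a.
  by apply: open_nbhs_nbhs; split=> //; rewrite -SP.
by move=> [_ [[a Aa <-] Oa]]; exists a; split=> //; exact: QB.
Qed.

End GrassmannianTheory.

(** * Outer measures *)

HB.instance Definition _ (A B : ptopologicalType) := Pointed.on (A * B)%type.

Section Caratheodory.
Context {R : realType} {T : pointedType}.
Implicit Types (mu : {outer_measure set T -> \bar R}) (A B D : set T).
Local Open Scope ereal_scope.

Lemma carathP mu A : (forall X, mu X < +oo -> mu (X `&` A) + mu (X `\` A) <= mu X) ->
  mu.-caratheodory A.
Proof.
move=> h; apply: le_caratheodory_measurable => X.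
have [Xoo|] := ltP (mu X) +oo; first by have := h X Xoo; rewrite setDE.
by rewrite leye_eq => /eqP ->; rewrite leey.
Qed.

Lemma carath_null mu A : mu A = 0 -> mu.-caratheodory A.
Proof.
move=> A0; apply: carathP => X _.
have -> : mu (X `&` A) = 0.
  apply/eqP; rewrite eq_le outer_measure_ge0 andbT -A0.
  by apply: le_outer_measure; exact: subIsetr.
by rewrite add0e; apply: le_outer_measure; exact: subDsetl.
Qed.

Lemma carath_orestr mu D A : mu.-caratheodory A ->
  (orestr mu D : {outer_measure set T -> \bar R}).-caratheodory A.
Proof.
move=> cA X; rewrite /orestr /= [LHS](cA (X `&` D)).
by congr (mu _ + mu _); rewrite setIAC.
Qed.

Lemma outer_measure_fin mu A : mu A < +oo -> mu A \is a fin_num.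
Proof. by move=> h; rewrite ge0_fin_numE// outer_measure_ge0. Qed.

Lemma carathD mu A B : mu.-caratheodory B -> B `<=` A ->
  mu A = mu B + mu (A `\` B).
Proof. by move=> cB BA; rewrite (cB A) (setIidr BA) setDE. Qed.

Lemma carath_le_sub mu A B (e : R) : mu.-caratheodory B -> B `<=` A ->
  mu B < +oo -> mu A < mu B + e%:E -> mu (A `\` B) < e%:E.
Proof.
move=> cB BA Boo; rewrite (carathD cB BA) lteD2lE//.
exact: outer_measure_fin.
Qed.

Lemma outer_measure_cup_cvg mu (F : nat -> set T) :
  (forall k, mu.-caratheodory (F k)) -> {homo F : i j / (i <= j)%N >-> (i <= j)%O} ->
  mu (F k) @[k --> \oo] --> mu (\bigcup_k F k).
Proof.
move=> cF hF.
have cU : mu.-caratheodory (\bigcup_k F k) by exact: caratheodory_measurable_bigcup.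
pose F' : (set (caratheodory_type mu))^nat := F.
exact: (@nondecreasing_cvg_mu _ (caratheodory_type mu) R
  (mu : measure (caratheodory_type mu) R) F' cF cU hF).
Qed.

Lemma outer_measure_cup_le mu (F : nat -> set T) (c : \bar R) :
  (forall k, mu.-caratheodory (F k)) -> {homo F : i j / (i <= j)%N >-> (i <= j)%O} ->
  (forall k, mu (F k) <= c) -> mu (\bigcup_k F k) <= c.
Proof.
move=> cF hF Fc; have := outer_measure_cup_cvg cF hF => h.
rewrite -(cvg_lim _ h)//; apply: lime_le; first by apply/cvg_ex; eexists; exact: h.
by apply: nearW.
Qed.

Lemma outer_measure_bigcup0 mu (F : nat -> set T) :
  (forall k, mu (F k) = 0) -> mu (\bigcup_k F k) = 0.
Proof.
move=> F0; apply/eqP; rewrite eq_le outer_measure_ge0 andbT.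
apply: le_trans (outer_measure_sigma_subadditive mu F) _.
by rewrite eseries0.
Qed.

Lemma outer_measure_le0 mu A B : A `<=` B -> mu B = 0 -> mu A = 0.
Proof.
move=> AB B0; apply/eqP; rewrite eq_le outer_measure_ge0 andbT -B0.
exact: le_outer_measure.
Qed.

Lemma carathI mu A B : mu.-caratheodory A -> mu.-caratheodory B ->
  mu.-caratheodory (A `&` B).
Proof. exact: caratheodory_measurable_setI. Qed.

Lemma carathDD mu A B : mu.-caratheodory A -> mu.-caratheodory B ->
  mu.-caratheodory (A `\` B).
Proof. exact: caratheodory_measurable_setD. Qed.

Lemma carathC mu A : mu.-caratheodory A -> mu.-caratheodory (~` A).
Proof. exact: caratheodory_measurable_setC. Qed.

End Caratheodory.

(** * Integration of continuous functions against outer measures *)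

Section OuterIntegral.
Context {R : realType} {X : ptopologicalType}.
Implicit Types (mu : {outer_measure set X -> \bar R}) (f : X -> R).

(** The part of [radon] that the integration lemmas rely on. It passes to restrictions to arbitrary
    sets, hence from V to [vrestr V D]. *)
Definition opens_carath mu := forall G : set X, open G -> mu.-caratheodory G.

Lemma closed_carath mu C : opens_carath mu -> closed C -> mu.-caratheodory C.
Proof.
move=> omu cC; rewrite -(setCK C); apply: carathC; apply: omu.
exact: closed_openC.
Qed.

Lemma opens_carath_orestr mu D : opens_carath mu ->
  opens_carath (orestr mu D : {outer_measure set X -> \bar R}).
Proof. by move=> omu G /omu; exact: carath_orestr. Qed.

Lemma continuous_carath mu f : opens_carath mu -> continuous f ->
  measurable_fun [set: caratheodory_type mu] f.
Proof.
move=> omu cf; apply: (measurability _ (RGenOpens.measurableE R)).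
move=> _ [_ [a [b ->]] <-]; rewrite setTI.
apply: omu; apply: open_comp => [x _|]; first exact: cf.
exact: interval_open.
Qed.

Definition dominated mu f := exists c (C : set X),
  [/\ (mu C < +oo)%E, mu.-caratheodory C, forall x, `|f x| <= c &
      forall x, ~ C x -> f x = 0].

Lemma dominated_integrable mu f : opens_carath mu -> continuous f ->
  dominated mu f ->
  (mu : measure (caratheodory_type mu) R).-integrable setT (EFin \o f).
Proof.
move=> omu cf [c [C [Coo cC fc fC]]].
have mf := continuous_carath omu cf.
have mC : measurable (C : set (caratheodory_type mu)) by [].
have : (mu : measure (caratheodory_type mu) R).-integrable C (EFin \o f).
  apply: measurable_bounded_integrable => //.
    exact: measurable_funS mf.
  exists c; split; first exact: num_real.
  by move=> y cy x _ /=; apply: le_trans (fc x) (ltW cy).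
move=> /(integrable_mkcond _ mC); congr (integrable _ _ _).
apply/funext => x; rewrite /patch; case: ifPn => // /negP xC /=.
by rewrite fC// => Cx; apply: xC; rewrite inE.
Qed.

Lemma ointegral_lower mu f (A B : set X) (a b : R) : opens_carath mu ->
  continuous f -> dominated mu f -> mu.-caratheodory A -> mu.-caratheodory B ->
  (mu A < +oo)%E -> (mu B < +oo)%E ->
  (forall x, a * \1_A x - b * \1_B x <= f x) ->
  a * fine (mu A) - b * fine (mu B) <= fine (ointegral mu setT (EFin \o f)).
Proof.
move=> omu cf df cA cB Aoo Boo h.
have if_ := dominated_integrable omu cf df.
have ind (D : set (caratheodory_type mu)) : mu.-caratheodory D -> (mu D < +oo)%E ->
    (mu : measure (caratheodory_type mu) R).-integrable setT (EFin \o \1_D).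
  move=> cD Doo; apply/integrableP; split.
    by apply/measurable_EFinP; exact: measurable_indic.
  rewrite (eq_integral (fun x => (\1_D x)%:E)); last first.
    by move=> x _ /=; rewrite ger0_norm.
  by rewrite integral_indic// setIT.
have iA := integrableZl measurableT a (ind A cA Aoo).
have iB := integrableZl measurableT b (ind B cB Boo).
have iAB := integrableB measurableT iA iB.
have ifin : ointegral mu setT (EFin \o f) \is a fin_num.
  exact: integrable_fin_num.
rewrite -lee_fin fineK//.
rewrite (_ : (a * fine (mu A) - b * fine (mu B))%:E =
  \int[(mu : measure (caratheodory_type mu) R)]_x
   (a%:E * (EFin \o \1_A) x - b%:E * (EFin \o \1_B) x))%E; last first.
  rewrite integralB// !integralZl ?ind//.
  rewrite EFinB !EFinM !fineK ?outer_measure_fin//=.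
  by rewrite !integral_indic// !setIT.
apply: le_integral => // x _ /=.
by rewrite -!EFinM -EFinB lee_fin.
Qed.

Local Notation borelT := (g_sigma_algebraType (@open X)).

Let idb mu : caratheodory_type mu -> borelT := fun x => x.

Let measurable_idb mu : opens_carath mu -> measurable_fun setT (@idb mu).
Proof.
move=> omu; apply: (@measurability _ _ (caratheodory_type mu) borelT setT (@idb mu) (@open X)) => //.
by move=> _ [G oG <-]; rewrite setTI; exact: omu.
Qed.

(** Each integral lives over the Caratheodory sigma-algebra of its own measure. Pushing the measures
    forward along the identity to the Borel sigma-algebra puts all three on one measurable space,
    where they can be added. *)
Lemma ointegral_add mu mu1 mu2 f :
  opens_carath mu -> opens_carath mu1 -> opens_carath mu2 ->
  continuous f -> dominated mu f -> dominated mu1 f -> dominated mu2 f ->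
  (forall A, borel A -> mu A = mu1 A + mu2 A)%E ->
  fine (ointegral mu setT (EFin \o f)) =
  fine (ointegral mu1 setT (EFin \o f)) + fine (ointegral mu2 setT (EFin \o f)).
Proof.
move=> omu o1 o2 cf d d1 d2 h.
have mf : measurable_fun [set: borelT] (EFin \o f).
  apply/measurable_EFinP; apply: (measurability _ (RGenOpens.measurableE R)).
  move=> _ [_ [a [b ->]] <-]; rewrite setTI.
  apply: sub_sigma_algebra; apply: open_comp => [x _|]; first exact: cf.
  exact: interval_open.
pose p nu (onu : opens_carath nu) : measure borelT R :=
  measure_function_pushforward__canonical__measure_function_Measure
    (nu : measure (caratheodory_type nu) R) (measurable_idb onu).
have push nu (onu : opens_carath nu) : dominated nu f ->
    ointegral nu setT (EFin \o f) = (\int[p nu onu]_x (f x)%:E)%E /\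
    (p nu onu).-integrable setT (EFin \o f).
  move=> dnu; have i1 : (nu : measure (caratheodory_type nu) R).-integrable
      (@idb nu @^-1` setT) ((EFin \o f) \o @idb nu).
    by rewrite preimage_setT; exact: dominated_integrable.
  split; last exact: (integrable_pushforward (measurable_idb onu) mf i1).
  exact: (esym (integral_pushforward (measurable_idb onu) mf i1 measurableT)).
have [-> _] := push mu omu d; have [-> i1] := push mu1 o1 d1.
have [-> i2] := push mu2 o2 d2.
rewrite (eq_measure_integral (measure_add (p mu1 o1) (p mu2 o2))); last first.
  by move=> A mA _; apply: (etrans (h A mA)); apply/esym; exact: measure_addE.
rewrite integral_measure_add// fineD//; exact: integrable_fin_num.
Qed.

End OuterIntegral.

Lemma radon_opens_carath {R : realType} {X : ptopologicalType} (U : set X)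
    (mu : {outer_measure set X -> \bar R}) :
  open U -> radon U mu -> opens_carath mu.
Proof.
move=> oU [U0 _ ro _] G oG; rewrite -(setUIDK G U).
apply: caratheodory_measurable_setU.
  by have [] := ro (G `&` U) (openI oG oU) (@subIsetr _ _ _).
by apply: carath_null; apply: outer_measure_le0 U0 => x [].
Qed.

(** * Radon measures over open subsets of R^n *)

Section Radon.
Context {R : realType} {n : nat}.
Implicit Types (U A G K : set 'rV[R]_n) (mu nu : {outer_measure set 'rV[R]_n -> \bar R}).

Lemma compact_closed_rV K : compact K -> closed K.
Proof. by apply: compact_closed; exact: norm_hausdorff. Qed.

(** Inner regularity is given for open sets, outer regularity for all sets. If Q is an open set
    slightly larger than G \ A and C is a compact subset of G of nearly full measure, then C \ Q is
    a compact subset of A. The errors of Op, C and Q are e / 3 each. *)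
Lemma radon_approx U mu A G (e : R) : open U -> radon U mu ->
  mu.-caratheodory A -> A `<=` G -> open G -> G `<=` U -> (mu G < +oo)%E -> 0 < e ->
  exists K Op, [/\ compact K /\ open Op, K `<=` A, A `<=` Op, Op `<=` G &
    (mu (Op `\` K) < e%:E)%E].
Proof.
move=> oU rmu cA AG oG GU Goo e0; have omu := radon_opens_carath oU rmu.
have [_ _ ro rA] := rmu.
have outer B : mu.-caratheodory B -> B `<=` G ->
    exists Op, [/\ open Op, B `<=` Op, Op `<=` G & (mu (Op `\` B) < (e / 3)%:E)%E].
  move=> cB BG; have Boo : (mu B < +oo)%E by apply: le_lt_trans Goo; apply: le_outer_measure.
  have e3 : 0 < e / 3 by rewrite divr_gt0.
  have BU : B `<=` U by exact: subset_trans GU.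
  have Bfin := outer_measure_fin Boo.
  move: (Bfin); rewrite (rA B BU) => ifin.
  have [_ [Op [oO BO OU] <-]] := lb_ereal_inf_adherent e3 ifin.
  rewrite -(rA B BU) => h; exists (Op `&` G); split.
  - exact: openI.
  - by move=> x Bx; split; [exact: BO|exact: BG].
  - exact: subIsetr.
  - apply: carath_le_sub => //; first by move=> x Bx; split; [exact: BO|exact: BG].
    by apply: le_lt_trans h; apply: le_outer_measure; exact: subIsetl.
have [Op [oO AO OG OA]] := outer A cA AG.
have cG := omu G oG.
have [Q [oQ AQ QG QA]] := outer (G `\` A) (carathDD cG cA) (@subDsetl _ _ _).
have [C [cC CG GC]] : exists C, [/\ compact C, C `<=` G & (mu (G `\` C) < (e / 3)%:E)%E].
  have e3 : 0 < e / 3 by rewrite divr_gt0.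
  have [_ Gsup] := ro G oG GU.
  have Gfin := outer_measure_fin Goo.
  move: (Gfin); rewrite Gsup => sfin.
  have [_ [C [cC CG] <-]] := ub_ereal_sup_adherent e3 sfin.
  rewrite -Gsup => h; exists C; split => //.
  have Coo : (mu C < +oo)%E by apply: le_lt_trans Goo; apply: le_outer_measure.
  apply: carath_le_sub => //.
    by apply: closed_carath => //; exact: compact_closed_rV.
  by rewrite -lteBlDr.
exists (C `\` Q), Op; split => //.
- split=> //; rewrite setDE; apply: compact_closedI => //.
  exact: open_closedC.
- by move=> x [Cx nQ]; apply: contrapT => nA; apply: nQ; apply: AQ; split => //; exact: CG.
apply: (@le_lt_trans _ _ (mu (Op `\` A) + (mu (G `\` C) + mu (Q `\` (G `\` A))))%E).
  apply: le_trans; last by apply: leeD2l; exact: outer_measureU2.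
  apply: le_trans; last exact: outer_measureU2.
  apply: le_outer_measure => x [Ox nK].
  have [Ax|nA] := pselect (A x); last by left.
  right; have [Cx|nC] := pselect (C x); last by left; split => //; exact: OG.
  right; split; last by move=> [_].
  by apply: contrapT => nQ; apply: nK.
have -> : e%:E = ((e / 3)%:E + ((e / 3)%:E + (e / 3)%:E))%E.
  by rewrite -!EFinD; congr EFin; field.
by rewrite !lteD.
Qed.

Lemma compact_nbhd U K : open U -> compact K -> K `<=` U ->
  exists G L, [/\ open G, compact L, K `<=` G, G `<=` L & L `<=` U].
Proof.
move=> oU cK KU.
by have [_ [G [L [_ [oG KG] [cL GL LU] _]]]] := smooth_urysohn cK oU KU; exists G, L.
Qed.

Lemma radon_nbhd U mu K : open U -> radon U mu -> compact K -> K `<=` U ->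
  exists G, [/\ open G, K `<=` G, G `<=` U & (mu G < +oo)%E].
Proof.
move=> oU [_ fin _ _] cK KU; have [G [L [oG cL KG GL LU]]] := compact_nbhd oU cK KU.
exists G; split => //; first exact: subset_trans LU.
by apply: le_lt_trans (fin _ cL LU); exact: le_outer_measure.
Qed.

Definition exhaust U (k : nat) : set 'rV[R]_n :=
  ecball 0 k%:R `&` \bigcap_(y in ~` U) [set x | k.+1%:R^-1 <= enorm (x - y)].

Lemma exhaust_compact U k : compact (exhaust U k).
Proof.
apply: compact_closedI; first exact: ecball_compact.
apply: closed_bigI => y _.
rewrite (_ : [set _ | _] = (fun x => enorm (x - y)) @^-1` [set r | k.+1%:R^-1 <= r])//.
by apply: closed_comp => [x _|]; [exact: enormB_continuous|exact: closed_ge].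
Qed.

Lemma exhaust_sub U k : exhaust U k `<=` U.
Proof.
move=> x [_ h]; apply: contrapT => nU; have := h x nU.
by rewrite /= subrr enorm0 leNgt invr_gt0 ltr0n.
Qed.

Lemma exhaust_homo U : {homo exhaust U : i j / (i <= j)%N >-> (i <= j)%O}.
Proof.
move=> i j ij; apply/subsetPset => x [xi h]; split.
  by apply: le_trans xi _; rewrite ler_nat.
move=> y Uy /=; apply: le_trans (h y Uy).
by rewrite lef_pV2 ?posrE ?ltr0n// ler_nat.
Qed.

Lemma exhaust_cup U : open U -> \bigcup_k exhaust U k = U.
Proof.
move=> oU; apply/seteqP; split=> [x [k _]|x Ux]; first exact: exhaust_sub.
have [r r0 rU] := open_eoball oU Ux.
exists (Num.truncn (enorm x) + Num.truncn r^-1).+1 => //; split.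
  rewrite /ecball/= subr0; apply: le_trans (ltW (truncnS_gt _)) _.
  by rewrite ler_nat ltnS leq_addr.
move=> y nU /=; rewrite leNgt; apply/negP => h; apply: nU; apply: rU.
rewrite /eoball/= enormB; apply: lt_le_trans h _.
rewrite invf_ple ?posrE ?ltr0n//; apply: le_trans (ltW (truncnS_gt _)) _.
by rewrite ler_nat ltnS (leqW (leq_addl _ _)).
Qed.

Lemma carath_exhaust U mu A : open U -> A `<=` U ->
  (forall k, mu.-caratheodory (A `&` exhaust U k)) -> mu.-caratheodory A.
Proof.
move=> oU AU h; rewrite -(setIidl AU) -[X in _ `&` X](exhaust_cup oU) setI_bigcupr.
exact: caratheodory_measurable_bigcup.
Qed.

Lemma null_exhaust U mu A : open U -> A `<=` U ->
  (forall k, mu (A `&` exhaust U k) = 0%E) -> mu A = 0%E.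
Proof.
move=> oU AU h; rewrite -(setIidl AU) -[X in _ `&` X](exhaust_cup oU) setI_bigcupr.
exact: outer_measure_bigcup0.
Qed.

(** On X [&] C, the Caratheodory equality for mu + nu together with subadditivity of nu forces the
    inequality for mu. Cancelling the values of nu requires them to be finite, whence the set C. *)
Lemma carath_sum_split mu nu A C : (mu \+ nu)%E.-caratheodory A ->
  mu.-caratheodory C -> nu.-caratheodory C -> (mu C < +oo)%E -> (nu C < +oo)%E ->
  mu.-caratheodory (A `&` C).
Proof.
move=> cA cmu cnu muC nuC; apply: carathP => X Xoo.
have eX : mu X = (mu (X `&` C) + mu (X `\` C))%E by rewrite (cmu X) setDE.
have le1 : (mu (X `\` (A `&` C)) <= mu ((X `&` C) `\` A) + mu (X `\` C))%E.
  apply: le_trans; last exact: outer_measureU2.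
  apply: le_outer_measure => x [Xx nAC].
  have [Cx|nC] := pselect (C x); last by right.
  by left; split => // Ax; apply: nAC.
rewrite eX; apply: le_trans; first by apply: leeD2l; exact: le1.
rewrite addeA leeD2r//.
have := cA (X `&` C); rewrite /= -setDE.
have -> : X `&` (A `&` C) = X `&` C `&` A by rewrite setIAC setIA.
have fin (f : {outer_measure set 'rV[R]_n -> \bar R}) B :
    (f C < +oo)%E -> f (X `&` C `&` B) \is a fin_num.
  move=> fC; apply: outer_measure_fin; apply: le_lt_trans fC.
  by apply: le_outer_measure => x [[]].
have := fin mu A muC; have := fin nu A nuC; have := fin mu (~` A) muC.
have := fin nu (~` A) nuC; have := fin mu setT muC; have := fin nu setT nuC.
have := outer_measureU2 nu (X `&` C `&` A) ((X `&` C) `\` A).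
rewrite setUIDK !setIT -!setDE.
move: (nu (X `&` C)) (mu (X `&` C)) (nu (X `&` C `\` A)) (mu (X `&` C `\` A))
  (nu (X `&` C `&` A)) (mu (X `&` C `&` A)).
move=> [a||] [b||] [c||] [d||] [p||] [q||]//= + _ _ _ _ _ _.
rewrite -!EFinD !lee_fin => h [] e.
by lra.
Qed.

End Radon.

(** * The weight of a varifold *)

Section Varifolds.
Context {R : realType} {n m : nat} {mn : (m <= n)%N}.
Notation G := (grassmannian R mn).
Implicit Types (U E D : set 'rV[R]_n)
  (V : {outer_measure set ('rV[R]_n * G) -> \bar R}).
Local Open Scope ereal_scope.

Section Weight.
Variable V : {outer_measure set ('rV[R]_n * G) -> \bar R}.

Let weight0 : weight V set0 = 0.
Proof. by rewrite /weight set0X outer_measure0. Qed.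

Let weight_ge0 A : 0 <= weight V A. Proof. exact: outer_measure_ge0. Qed.

Let weight_le : {homo weight V : A B / A `<=` B >-> A <= B}.
Proof. by move=> A B AB; apply: le_outer_measure => -[x S] [/= /AB]. Qed.

Let weight_ss : sigma_subadditive (weight V).
Proof.
move=> F; rewrite /weight setX_bigcupl.
exact: outer_measure_sigma_subadditive.
Qed.

HB.instance Definition _ := isOuterMeasure.Build R 'rV[R]_n (weight V)
  weight0 weight_ge0 weight_le weight_ss.

End Weight.

Lemma weight_vrestr V D A : weight (vrestr V D) A = weight V (A `&` D).
Proof.
rewrite /weight /vrestr /orestr/=; congr (V _).
by apply/seteqP; split=> -[x S] /=; tauto.
Qed.

Lemma carath_weight V A : V.-caratheodory (A `*` setT) -> (weight V).-caratheodory A.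
Proof.
move=> cA X; rewrite /weight [LHS]cA; congr (V _ + V _);
  by apply/seteqP; split=> -[x S] /=; tauto.
Qed.

Lemma compact_tube (Op : set ('rV[R]_n * G)) : open Op ->
  open [set x | forall S, Op (x, S)].
Proof.
move=> oO; rewrite openE => x xO; rewrite /interior.
have := grassmannian_compact (R := R) (mn := mn).
move=> /compact_near_coveringP/(_ _ (nbhs x) (fun y S => Op (y, S)) _).
move=> H; apply: filterS (H _) => [y yO S|S _].
  exact: yO.
have /= := open_nbhs_nbhs (conj oO (xO S)).
by move=> [[B1 B2] [B1x B2S] B12]; exists (B2, B1) => // -[S' y] [/= ? ?]; exact: B12.
Qed.

Lemma cylinder_open (Op : set 'rV[R]_n) : open Op -> open (Op `*` [set: G]).
Proof.
move=> oO; rewrite (_ : _ `*` _ = fst @^-1` Op); last by apply/seteqP; split=> -[x S] //= [].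
by apply: open_comp => // p _; exact: cvg_fst.
Qed.

Lemma cylinder_closed (K : set 'rV[R]_n) : closed K -> closed (K `*` [set: G]).
Proof.
move=> cK; rewrite (_ : _ `*` _ = fst @^-1` K); last by apply/seteqP; split=> -[x S] //= [].
by apply: closed_comp => // p _; exact: cvg_fst.
Qed.

Lemma varifold_opens_carath U V : open U -> varifold U V -> opens_carath V.
Proof. by move=> oU; apply: radon_opens_carath; exact: cylinder_open. Qed.

(** Both regularities come from compactness of the fiber: a compact set lies in the cylinder over
    its compact projection, and by the tube lemma an open neighborhood of a cylinder contains an
    open cylinder around it. *)
Lemma radon_weight U V : open U -> varifold U V -> radon U (weight V).
Proof.
move=> oU [V0 Vfin Vo VA]; split.
- rewrite -[RHS]V0 /weight; congr (V _).
  by apply/seteqP; split=> -[x S] /=; tauto.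
- move=> K cK KU; apply: Vfin; first exact: compact_setX grassmannian_compact.
  by move=> [x S] [/= /KU].
- move=> Op oO OU; have oOT := cylinder_open oO.
  have OUT : Op `*` [set: G] `<=` U `*` setT by move=> [x S] [/= /OU].
  have [cO VO] := Vo _ oOT OUT; split; first exact: carath_weight.
  apply/eqP; rewrite eq_le; apply/andP; split; last first.
    by apply: ge_ereal_sup => _ [K [cK KO] <-]; exact: le_outer_measure.
  apply: (@le_trans _ _ (V (Op `*` setT))); first exact: lexx.
  rewrite VO.
  apply: ge_ereal_sup => _ [K [cK KO] <-].
  apply: (@le_trans _ _ (weight V (fst @` K))).
    by apply: le_outer_measure => -[x S] Kx; split => //; exists (x, S).
  apply: ereal_sup_ubound; exists (fst @` K) => //; split.
    by apply: continuous_compact => //; apply: continuous_subspaceT => p; exact: cvg_fst.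
  by move=> _ [[x S] /KO[/= ? _] <-].
- move=> A AU; have AUT : A `*` [set: G] `<=` U `*` setT by move=> [x S] [/= /AU].
  apply/eqP; rewrite eq_le; apply/andP; split.
    by apply: le_ereal_inf_tmp => _ [Op [oO AO OU] <-]; exact: le_outer_measure.
  apply: (@le_trans _ _ (V (A `*` setT))); last exact: lexx.
  rewrite (VA _ AUT).
  apply: le_ereal_inf_tmp => _ [Op [oO AO OU] <-].
  apply: (@le_trans _ _ (weight V [set x | forall S, Op (x, S)])).
    apply: ereal_inf_lbound; exists [set x | forall S, Op (x, S)] => //; split.
    - exact: compact_tube.
    - by move=> x Ax S; apply: AO.
    - by move=> x /(_ point)/OU[].
  by apply: le_outer_measure => -[x S] [/= h _]; exact: h.
Qed.

Lemma weight_vrestr_fin U V D K : open U -> varifold U V -> compact K -> K `<=` U ->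
  weight (vrestr V D) K < +oo.
Proof.
move=> oU vV cK KU; rewrite weight_vrestr; have [_ fin _ _] := radon_weight oU vV.
by apply: le_lt_trans (fin _ cK KU); apply: le_outer_measure; exact: subIsetl.
Qed.

End Varifolds.

(** * First variation *)

Section VintTheory.
Context {R : realType} {X : ptopologicalType}.
Implicit Types (mu : {outer_measure set X -> \bar R}) (f : X -> R).

Lemma compact_dominated mu f C : opens_carath mu -> continuous f -> compact C ->
  closed C -> (mu C < +oo)%E -> (forall x, ~ C x -> f x = 0) -> dominated mu f.
Proof.
move=> omu cf cC clC Coo fC.
have [c fc] : exists c, forall x, C x -> `|f x| <= c.
  have /compact_bounded[M [_ Mb]] : compact (f @` C).
    by apply: continuous_compact => //; exact: continuous_subspaceT.
  by exists (M + 1) => x Cx; apply: Mb; [rewrite ltrDl|exists x].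
exists (Num.max c 0), C; split => //; first exact: closed_carath.
move=> x; rewrite le_max; have [Cx|nC] := pselect (C x); first by rewrite fc.
by rewrite fC// normr0 lexx orbT.
Qed.

Lemma continuous_add f1 f2 : continuous f1 -> continuous f2 ->
  continuous (fun x => f1 x + f2 x).
Proof. by move=> c1 c2 x; apply: cvgD; [exact: c1|exact: c2]. Qed.

Lemma continuous_mul f1 f2 : continuous f1 -> continuous f2 ->
  continuous (fun x => f1 x * f2 x).
Proof. by move=> c1 c2 x; apply: cvgM; [exact: c1|exact: c2]. Qed.

Lemma ointegralD mu f1 f2 : opens_carath mu -> continuous f1 -> continuous f2 ->
  dominated mu f1 -> dominated mu f2 ->
  fine (ointegral mu setT (EFin \o (fun x => f1 x + f2 x))) =
  fine (ointegral mu setT (EFin \o f1)) + fine (ointegral mu setT (EFin \o f2)).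
Proof.
move=> omu c1 c2 d1 d2.
have i1 := dominated_integrable omu c1 d1; have i2 := dominated_integrable omu c2 d2.
rewrite -fineD; [|exact: integrable_fin_num|exact: integrable_fin_num].
congr fine; rewrite /ointegral -integralD//.
Qed.

Lemma ointegralZ mu f (a : R) : opens_carath mu -> continuous f ->
  dominated mu f ->
  fine (ointegral mu setT (EFin \o (fun x => a * f x))) =
  a * fine (ointegral mu setT (EFin \o f)).
Proof.
move=> omu c d; have i := dominated_integrable omu c d.
rewrite (_ : a = fine a%:E)// -fineM//; last exact: integrable_fin_num.
by congr fine; rewrite /ointegral -integralZl.
Qed.

End VintTheory.

Section FirstVariation.
Context {R : realType} {n m : nat} {mn : (m <= n)%N}.
Notation G := (grassmannian R mn).
Notation field := ('rV[R]_n -> 'rV[R]_n).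
Implicit Types (U E D : set 'rV[R]_n) (g : field)
  (V : {outer_measure set ('rV[R]_n * G) -> \bar R}).

(** Converse of [carath_weight]. A piece of D in the exhaustion lies between a compact K and an open
    Q' with Q' \ K of weight less than e. The cylinder over K is closed, hence V measurable, and the
    cylinder over Q' \ K contributes less than e. *)
Lemma carath_product U V D : open U -> varifold U V -> D `<=` U ->
  (weight V).-caratheodory D -> V.-caratheodory (D `*` setT).
Proof.
move=> oU vV DU cD; have rV := radon_weight oU vV.
have oV := varifold_opens_carath oU vV; have ow := radon_opens_carath oU rV.
rewrite (_ : D `*` setT = \bigcup_k ((D `&` exhaust U k) `*` setT)); last first.
  rewrite -setX_bigcupl -setI_bigcupr exhaust_cup//.
  by congr (_ `*` _); rewrite setIidl.
apply: caratheodory_measurable_bigcup => k; set A := D `&` _.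
have AU : A `<=` exhaust U k by exact: subIsetr.
have [Q [oQ LQ QU Qoo]] := radon_nbhd oU rV (exhaust_compact (U := U) (k := k))
  (@exhaust_sub _ _ U k).
have cA : (weight V).-caratheodory A.
  apply: carathI => //; apply: closed_carath => //.
  by apply: compact_closed_rV; exact: exhaust_compact.
apply: carathP => Y _; apply/lee_addgt0Pr => e e0.
have [K [Q' [[cK oQ'] KA AQ' Q'Q Ke]]] :=
  radon_approx oU rV cA (subset_trans AU LQ) oQ QU Qoo e0.
have cKT : V.-caratheodory (K `*` setT).
  by apply: closed_carath => //; apply: cylinder_closed; exact: compact_closed_rV.
rewrite (cKT Y) -setDE.
apply: (@le_trans _ _ (V (Y `&` K `*` setT) + V ((Q' `\` K) `*` setT) +
   V (Y `\` K `*` setT))%E).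
  apply: leeD.
    apply: le_trans; last exact: outer_measureU2.
    apply: le_outer_measure => -[x S] [Yx [/= Ax _]].
    have [Kx|nK] := pselect (K x); first by left.
    by right; split => //=; split => //; exact: AQ'.
  by apply: le_outer_measure => -[x S] [Yx nA]; split => // -[/= /KA Kx _]; apply: nA.
by rewrite addeAC leeD2l// ltW.
Qed.

Definition integrand g (p : 'rV[R]_n * G) : R := pdiv (gproj p.2) g p.1.

Definition fvar V g : R := first_variation (vint V) g.

Lemma fvarE V g : fvar V g = fine (ointegral V setT (EFin \o integrand g)).
Proof. by []. Qed.

Lemma fsupport_derive g x v : differentiable g x -> ~ fsupport g x -> 'D_v g x = 0.
Proof.
move=> dg ns; have oS : open (~` fsupport g).
  by apply: closed_openC; exact: closed_closure.
have h : \forall y \near x, (cst 0 : field) y = g y.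
  have : nbhs x (~` fsupport g) by exact: open_nbhs_nbhs.
  by apply: (@filterS _ (nbhs x) (nbhs_filter x)) => y /fsupport0.
by rewrite -(near_eq_derive v h) derive_cst.
Qed.

Lemma integrand_eq0 U g p : test_field U g -> ~ fsupport g p.1 -> integrand g p = 0.
Proof.
move=> tg ns; have dg := test_field_diff p.1 tg.
rewrite /integrand pdivE// big1// => i _.
by rewrite fsupport_derive// mul0mx mxE.
Qed.

Lemma sum_continuous (X : ptopologicalType) (I : Type) (s : seq I) (f : I -> X -> R) :
  (forall i, continuous (f i)) -> continuous (fun x => \sum_(i <- s) f i x).
Proof.
move=> cf; elim: s => [|i s IH].
  by under eq_fun do rewrite big_nil; move=> x; exact: cvg_cst.
by under eq_fun do rewrite big_cons; exact: continuous_add.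
Qed.

Lemma integrand_continuous U g : test_field U g -> continuous (integrand g).
Proof.
move=> tg; rewrite (_ : integrand g = fun p => \sum_i \sum_j
    'D_(delta_mx 0 i) (fun y => g y 0 j) p.1 * gproj p.2 j i); last first.
  apply/funext => p; rewrite /integrand pdivE; last exact: test_field_diff tg.
  apply: eq_bigr => i _; rewrite mxE; apply: eq_bigr => j _; congr (_ * _).
  by apply: derive_coord; exact: test_field_diff tg.
apply: sum_continuous => i; apply: sum_continuous => j; apply: continuous_mul.
  move=> p; apply: (@cvg_comp _ _ _ fst ('D_(delta_mx 0 i) (fun y => g y 0 j))).
    exact: cvg_fst.
  have [_ /(_ (delta_mx 0 i)) h] := test_field_smooth j tg 1%N.
  exact: h.
move=> p; apply: (@cvg_comp _ _ _ snd (fun S : G => gproj S j i)); first exact: cvg_snd.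
apply: (@cvg_comp _ _ _ (@gproj R n m mn) (fun P : 'M[R]_n => P j i)).
  exact: gproj_continuous.
exact: coord_continuous.
Qed.

Lemma integrand_dominated U V g : test_field U g -> opens_carath V ->
  (weight V (fsupport g) < +oo)%E -> dominated V (integrand g).
Proof.
move=> tg oV Voo; have [_ cg gU] := tg.
apply: (@compact_dominated _ _ _ _ (fsupport g `*` setT)) => //.
- exact: integrand_continuous tg.
- exact: compact_setX grassmannian_compact.
- by apply: cylinder_closed; exact: closed_closure.
- move=> p ns; apply: integrand_eq0 tg _ => h; apply: ns.
  by split.
Qed.

Lemma integrandD U g h p : test_field U g -> test_field U h ->
  integrand (fun x => g x + h x) p = integrand g p + integrand h p.
Proof. by move=> tg th; apply: pdivD; [exact: test_field_diff tg|exact: test_field_diff th]. Qed.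

Lemma integrand_scale U (chi : 'rV[R]_n -> R) g p : test_field U g -> smooth chi ->
  integrand (fun x => chi x *: g x) p =
  chi p.1 * integrand g p + 'D_(g p.1 *m gproj p.2) chi p.1.
Proof. by move=> tg cs; apply: pdiv_scale; [exact: smooth_diff|exact: test_field_diff tg]. Qed.

Section WithVarifold.
Variables (U : set 'rV[R]_n) (V : {outer_measure set ('rV[R]_n * G) -> \bar R}).
Hypotheses (oV : opens_carath V)
  (finV : forall K, compact K -> K `<=` U -> (weight V K < +oo)%E).

Lemma fvarD g h : test_field U g -> test_field U h ->
  fvar V (fun x => g x + h x) = fvar V g + fvar V h.
Proof.
move=> tg th; have [_ cg gU] := tg; have [_ ch hU] := th.
rewrite !fvarE -ointegralD//.
- by congr (fine (ointegral _ _ _)); apply/funext => p /=; rewrite (integrandD p tg th).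
- exact: integrand_continuous tg.
- exact: integrand_continuous th.
- by apply: integrand_dominated tg _ _ => //; exact: finV.
- by apply: integrand_dominated th _ _ => //; exact: finV.
Qed.

Lemma fvarZ g (c : R) : test_field U g -> fvar V (fun x => c *: g x) = c * fvar V g.
Proof.
move=> tg; have [_ cg gU] := tg; rewrite !fvarE -ointegralZ//.
- congr (fine (ointegral _ _ _)); apply/funext => p /=; congr EFin.
  by rewrite (integrand_scale p tg (smooth_cst c)) derive_cst addr0.
- exact: integrand_continuous tg.
- by apply: integrand_dominated tg _ _ => //; exact: finV.
Qed.

Lemma fvar_lower g (A B : set 'rV[R]_n) (a b : R) : test_field U g ->
  closed A -> closed B -> (weight V A < +oo)%E -> (weight V B < +oo)%E ->
  (forall p, a * \1_A p.1 - b * \1_B p.1 <= integrand g p) ->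
  a * fine (weight V A) - b * fine (weight V B) <= fvar V g.
Proof.
move=> tg cA cB Aoo Boo h; have [_ cg gU] := tg; rewrite fvarE.
apply: (@ointegral_lower _ _ V (integrand g) (A `*` setT) (B `*` setT)) => //.
- exact: integrand_continuous tg.
- by apply: integrand_dominated tg _ _ => //; exact: finV.
- by apply: closed_carath => //; exact: cylinder_closed.
- by apply: closed_carath => //; exact: cylinder_closed.
- move=> p; apply: le_trans (h p).
  rewrite !indicE; rewrite (_ : (p \in A `*` setT) = (p.1 \in A)); last first.
    by apply/idP/idP; rewrite !inE => //= -[].
  rewrite (_ : (p \in B `*` setT) = (p.1 \in B))//.
  by apply/idP/idP; rewrite !inE => //= -[].
Qed.

Lemma fvar_bound g (A : set 'rV[R]_n) (a : R) : test_field U g ->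
  closed A -> (weight V A < +oo)%E ->
  (forall p, `|integrand g p| <= a * \1_A p.1) ->
  `|fvar V g| <= a * fine (weight V A).
Proof.
move=> tg cA Aoo h; rewrite ler_norml; apply/andP; split.
  have /= := @fvar_lower g set0 A 0 a tg closed0 cA.
  rewrite mul0r sub0r; apply => //; first by rewrite outer_measure0.
  move=> p; rewrite mul0r sub0r; have := h p; rewrite ler_norml => /andP[]//.
have tn : test_field U (fun x => -1 *: g x).
  by apply: test_fieldZ => //; exact: smooth_cst.
have := @fvar_lower _ set0 A 0 a tn closed0 cA.
rewrite fvarZ// mulN1r mul0r sub0r lerN2; apply => //.
  by rewrite outer_measure0.
move=> p; rewrite mul0r sub0r (integrand_scale p tg (smooth_cst _)) derive_cst.
rewrite addr0 mulN1r lerN2; have := h p; rewrite ler_norml => /andP[]//.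
Qed.

End WithVarifold.

Lemma fvar_split U V D g : open U -> varifold U V -> D `<=` U ->
  (weight V).-caratheodory D -> test_field U g ->
  fvar V g = fvar (vrestr V D) g + fvar (vrestr V (U `\` D)) g.
Proof.
move=> oU vV DU cD tg; have [_ cg gU] := tg.
have oV := varifold_opens_carath oU vV.
have [_ fin _ _] := radon_weight oU vV.
have finr D' := weight_vrestr_fin D' oU vV cg gU.
apply: ointegral_add => //.
- exact: opens_carath_orestr.
- exact: opens_carath_orestr.
- exact: integrand_continuous tg.
- by apply: integrand_dominated tg _ _ => //; exact: fin.
- by apply: integrand_dominated tg _ _ => //; exact: opens_carath_orestr.
- by apply: integrand_dominated tg _ _ => //; exact: opens_carath_orestr.
move=> A _; have cDT := carath_product oU vV DU cD.
rewrite (cDT A) /vrestr /orestr /=; congr (_ + _)%E.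
apply/eqP; rewrite eq_le; apply/andP; split; last first.
  by apply: le_outer_measure => -[x S] [Ax [/= [Ux nD] _]]; split => // -[].
have [V0 _ _ _] := vV.
rewrite -[leRHS]adde0 -[X in (_ <= _ + X)%E]V0; apply: le_trans; last exact: outer_measureU2.
apply: le_outer_measure => -[x S] [Ax nD].
have [Ux|nU] := pselect (U x); last by right => -[].
by left; split => //; split => //; split => //= Dx; apply: nD.
Qed.

End FirstVariation.

(** * Variation of a distribution *)

Section OpenVariation.
Context {R : realType} {n : nat}.
Notation field := ('rV[R]_n -> 'rV[R]_n).
Variables (U : set 'rV[R]_n) (T : field -> R).
Implicit Types (G : set 'rV[R]_n) (g h u : field).

Definition unit_fields G : set field :=
  [set g | [/\ test_field U g, fsupport g `<=` G & forall x, enorm (g x) <= 1]].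

Definition ovar G : \bar R := ereal_sup [set (T g)%:E | g in unit_fields G].

(** Outer extension of [ovar] from open sets. Intersecting A with U makes the complement of U null,
    as a measure over U requires. *)
Definition vmeas (A : set 'rV[R]_n) : \bar R :=
  ereal_inf [set ovar G | G in [set G | [/\ open G, A `&` U `<=` G & G `<=` U]]].

Definition additive_on_tests := forall g h, test_field U g -> test_field U h ->
  T (fun x => g x + h x) = T g + T h.

Definition homogeneous_on_tests := forall c g, test_field U g ->
  T (fun x => c *: g x) = c * T g.

Hypotheses (oU : open U) (TD : additive_on_tests) (TZ : homogeneous_on_tests).

Lemma T0 : T (fun=> 0) = 0.
Proof.
have := TZ 0 (test_field0 U); rewrite mul0r => <-; congr T.
by apply/funext => x; rewrite scaler0.
Qed.

Lemma unit_fields0 G : unit_fields G (fun=> 0).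
Proof.
split; first exact: test_field0.
  by apply: (@subset_trans _ set0) => //; apply: fsupport_sub => //; exact: closed0.
by move=> x; rewrite enorm0.
Qed.

Lemma ovar_ge0 G : (0 <= ovar G)%E.
Proof.
apply: ereal_sup_ubound; exists (fun=> 0); first exact: unit_fields0.
by rewrite T0.
Qed.

Lemma le_ovar G1 G2 : G1 `<=` G2 -> (ovar G1 <= ovar G2)%E.
Proof.
move=> G12; apply: ereal_sup_le; apply: image_subset => g [tg gG g1].
by split => //; exact: subset_trans G12.
Qed.

Lemma ovar_ub G g : unit_fields G g -> ((T g)%:E <= ovar G)%E.
Proof. by move=> gG; apply: ereal_sup_ubound; exists g. Qed.

Lemma fsupportZ g (f : 'rV[R]_n -> R) : fsupport (fun x => f x *: g x) `<=` fsupport g.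
Proof.
apply: fsupport_sub; first exact: closed_closure.
by move=> x /fsupport0 ->; rewrite scaler0.
Qed.

Lemma ovar_bound G g (c : R) : test_field U g -> fsupport g `<=` G -> 0 <= c ->
  (forall x, enorm (g x) <= c) -> ((T g)%:E <= c%:E * ovar G)%E.
Proof.
move=> tg gG; rewrite le_eqVlt => /orP[/eqP <- g0|c0 gc].
  rewrite mul0e (_ : g = fun=> 0) ?T0//; apply/funext => x.
  by apply: enorm_eq0; apply/eqP; rewrite eq_le g0 enorm_ge0.
have tcg : test_field U (fun x => c^-1 *: g x).
  by apply: test_fieldZ => //; exact: smooth_cst.
have -> : T g = c * T (fun x => c^-1 *: g x) by rewrite TZ// mulVKf ?gt_eqF.
rewrite EFinM lee_pmul2l// ?lte_fin//; apply: ovar_ub; split => //.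
  exact: subset_trans (@fsupportZ g (fun=> c^-1)) gG.
move=> x; rewrite enormZ gtr0_norm ?invr_gt0// mulrC ler_pdivrMr// mul1r.
exact: gc.
Qed.

(** The part of the support of g outside G2 is a compact subset of G1. With chi equal to 1 near it
    and supported in G1, the field chi g is admissible for G1 and (1 - chi) g for G2. *)
Lemma ovarU G1 G2 : open G1 -> open G2 -> (ovar (G1 `|` G2) <= ovar G1 + ovar G2)%E.
Proof.
move=> o1 o2; apply: ge_ereal_sup => _ [g [tg gG g1] <-].
have [_ cg _] := tg.
have cK : compact (fsupport g `\` G2).
  by rewrite setDE; apply: compact_closedI => //; exact: open_closedC.
have KG : fsupport g `\` G2 `<=` G1 by move=> x [/gG[]].
have [chi [Op [L [[cs c01 c1] [oO KO] [cL OL LG] c0]]]] := smooth_urysohn cK o1 KG.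
have clL := compact_closed_rV cL.
have t1 : test_field U (fun x => chi x *: g x) by exact: test_fieldZ.
have cs' : smooth (fun x => 1 - chi x) by apply: smoothB => //; exact: smooth_cst.
have t2 : test_field U (fun x => (1 - chi x) *: g x) by exact: test_fieldZ.
have -> : T g = T (fun x => chi x *: g x) + T (fun x => (1 - chi x) *: g x).
  rewrite -TD//; congr T; apply/funext => x.
  by rewrite -scalerDl addrC subrK scale1r.
rewrite EFinD; apply: leeD; apply: ovar_ub; split => //.
- apply: subset_trans LG; apply: fsupport_sub => // x /c0 ->.
  by rewrite scale0r.
- move=> x; have /andP[h0 h1] := c01 x.
  by rewrite enormZ ger0_norm//; have := g1 x; have := enorm_ge0 (g x); nra.
- apply: (@subset_trans _ (fsupport g `&` ~` Op)).
    apply: fsupport_sub.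
      by apply: closedI; [exact: closed_closure|exact: open_closedC].
    move=> x /not_andP[/fsupport0 ->|/contrapT /c1 ->]; first by rewrite scaler0.
    by rewrite subrr scale0r.
  by move=> x [gx nO]; apply: contrapT => nG2; apply: nO; exact: KO.
- move=> x; have /andP[h0 h1] := c01 x.
  by rewrite enormZ ger0_norm ?subr_ge0//; have := g1 x; have := enorm_ge0 (g x); nra.
Qed.

(** Unit fields supported in disjoint sets add up to a unit field. The two suprema are taken one
    after the other, so that only real numbers are subtracted. *)
Lemma ovar_disj G1 G2 : G1 `&` G2 = set0 -> (ovar G1 + ovar G2 <= ovar (G1 `|` G2))%E.
Proof.
move=> G12.
have key g h : unit_fields G1 g -> unit_fields G2 h ->
    ((T g)%:E + (T h)%:E <= ovar (G1 `|` G2))%E.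
  move=> [tg gG g1] [th hG h1]; rewrite -EFinD -TD//; apply: ovar_ub; split.
  - exact: test_fieldD.
  - apply: (@subset_trans _ (fsupport g `|` fsupport h)); last exact: setUSS.
    apply: fsupport_sub; first by apply: closedU; exact: closed_closure.
    by move=> x /not_orP[/fsupport0 -> /fsupport0 ->]; rewrite addr0.
  - move=> x; have [/gG G1x|/fsupport0 ->] := pselect (fsupport g x); last by rewrite add0r.
    rewrite (@fsupport0 _ _ _ h x) ?addr0// => /hG G2x.
    by have : (G1 `&` G2) x by []; rewrite G12.
have := ovar_ge0 (G1 `|` G2); move: key; case: (ovar _) => [M||//] key M0; last first.
  exact: leey.
have h2 h : unit_fields G2 h -> (ovar G1 <= (M - T h)%:E)%E.
  move=> hG; apply: ge_ereal_sup => _ [g gG <-].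
  by have := key g h gG hG; rewrite -EFinD !lee_fin; lra.
have := h2 _ (unit_fields0 G2); have := ovar_ge0 G1; move: h2.
case: (ovar G1) => [a||] // h2 _ _.
have h3 : (ovar G2 <= (M - a)%:E)%E.
  apply: ge_ereal_sup => _ [h hG <-].
  by have := h2 h hG; rewrite !lee_fin; lra.
by apply: (le_trans (leeD2l a%:E h3)); rewrite -EFinD lee_fin; lra.
Qed.

Lemma ovar_set0 : ovar set0 = 0%E.
Proof.
apply/eqP; rewrite eq_le ovar_ge0 andbT; apply: ge_ereal_sup => _ [g [tg g0 _] <-].
rewrite (_ : g = fun=> 0) ?T0//; apply/funext => x.
by apply: fsupport0 => /g0.
Qed.

(** The compact support of a test field is covered by finitely many of the F k, which reduces the
    claim to [ovarU]. *)
Lemma ovar_bigcup (F : nat -> set 'rV[R]_n) : (forall k, open (F k)) ->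
  (ovar (\bigcup_k F k) <= \sum_(0 <= k <oo) ovar (F k))%E.
Proof.
move=> oF; apply: ge_ereal_sup => _ [g [tg gF g1] <-].
have fin N : (ovar (\big[setU/set0]_(k < N) F k) <= \sum_(k < N) ovar (F k))%E.
  elim: N => [|N IH]; first by rewrite !big_ord0 ovar_set0.
  rewrite !big_ord_recr/=; apply: le_trans (ovarU _ (oF N)) _.
    by elim/big_ind: _; [exact: open0|move=> A B; exact: openU|move=> i _; exact: oF].
  exact: leeD2r.
have [N gN] : exists N, fsupport g `<=` \big[setU/set0]_(k < N) F k.
  have [_ cg _] := tg; move: cg; rewrite compact_cover => cg.
  have [D _ gD] := cg nat setT F (fun k _ => oF k) gF.
  exists (\max_(k <- finmap.enum_fset D) k).+1 => x /gD[k /= kD Fkx].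
  rewrite -bigcup_mkord; exists k => //=; rewrite ltnS.
  by rewrite (big_rem k kD)/= leq_maxl.
apply: (@le_trans _ _ (ovar (\big[setU/set0]_(k < N) F k))).
  by apply: ovar_ub; split.
apply: le_trans (fin N) _; rewrite -(big_mkord xpredT (fun k => ovar (F k))).
by apply: nneseries_lim_ge => k _ _; exact: ovar_ge0.
Qed.

Lemma vmeasE G : open G -> G `<=` U -> vmeas G = ovar G.
Proof.
move=> oG GU; apply/eqP; rewrite eq_le; apply/andP; split.
  by apply: ereal_inf_lbound; exists G => //; split => // x [].
apply: le_ereal_inf_tmp => _ [H [oH GH HU] <-]; apply: le_ovar => x Gx.
by apply: GH; split => //; exact: GU.
Qed.

Let vmeas_ge0 A : (0 <= vmeas A)%E.
Proof. by apply: le_ereal_inf_tmp => _ [G _ <-]; exact: ovar_ge0. Qed.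

Let vmeas0 : vmeas set0 = 0%E.
Proof. by rewrite vmeasE ?ovar_set0//; exact: open0. Qed.

Let vmeas_le : {homo vmeas : A B / A `<=` B >-> (A <= B)%E}.
Proof.
move=> A B AB; apply: ereal_inf_le_tmp => _ [G [oG BG GU] <-].
by exists G => //; split => //; apply: subset_trans BG; exact: setSI.
Qed.

Let vmeas_ss : sigma_subadditive vmeas.
Proof.
move=> F; have [[i ioo]|] := pselect (exists i, vmeas (F i) = +oo%E).
  rewrite (eseries_pinfty _ _ ioo) ?leey// => k _.
  by rewrite -ltNye (lt_le_trans _ (vmeas_ge0 _)).
rewrite -forallNE => Foo; apply/lee_addgt0Pr => _/posnumP[e].
rewrite (le_trans _ (epsilon_trick _ _ _))//.
pose P i G := [/\ open G, F i `&` U `<=` G, G `<=` U &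
  (ovar G <= vmeas (F i) + (e%:num / (2 ^ i.+1)%:R)%:E)%E].
have [G PG] : {G : (set 'rV[R]_n)^nat & forall i, P i (G i)}.
  apply: (@choice _ _ P) => i.
  have Ffin : vmeas (F i) \is a fin_num.
    by rewrite ge0_fin_numE// ltey; apply/eqP; exact: Foo.
  have en1 : (0 < e%:num / (2 ^ i.+1)%:R)%R by [].
  have [_ [G [oG FG GU] <-] /ltW h] := lb_ereal_inf_adherent en1 Ffin.
  by exists G.
apply: (@le_trans _ _ (\sum_(0 <= k <oo) ovar (G k))%E); last first.
  apply: lee_nneseries => [i _ _|i _]; first exact: ovar_ge0.
  by have [] := PG i.
apply: le_trans (ovar_bigcup _); last by move=> k; have [] := PG k.
apply: ereal_inf_lbound; exists (\bigcup_k G k) => //; split.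
- by apply: bigcup_open => k _; have [] := PG k.
- by rewrite setI_bigcupl => x [k _ Fkx]; exists k => //; have [_ h _ _] := PG k; exact: h.
- by move=> x [k _ Gkx]; have [_ _ h _] := PG k; exact: h.
Qed.

HB.instance Definition _ := isOuterMeasure.Build R 'rV[R]_n vmeas
  vmeas0 vmeas_ge0 vmeas_le vmeas_ss.

Lemma vmeas_setC : vmeas (~` U) = 0%E.
Proof.
apply/eqP; rewrite eq_le outer_measure_ge0 andbT -ovar_set0.
apply: ereal_inf_lbound; exists set0 => //; split; [exact: open0| |by []].
by move=> x [].
Qed.

(** Let H be open around X and g a unit field supported in H [&] G. Then H \ [fsupport g] is open,
    contains the part of X \ G in U and is disjoint from the support of g, so that T g plus the
    measure of X \ G is at most [ovar H]. The supremum over g gives the Caratheodory inequality. *)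
Lemma vmeas_open_carath G : open G -> G `<=` U ->
  (vmeas : {outer_measure set 'rV[R]_n -> \bar R}).-caratheodory G.
Proof.
move=> oG GU; apply: carathP => X _.
apply: le_ereal_inf_tmp => _ [H [oH XH HU] <-].
have h1 : (vmeas (X `&` G) <= ovar (H `&` G))%E.
  apply: ereal_inf_lbound; exists (H `&` G) => //; split.
  - exact: openI.
  - by move=> x [[Xx Gx] Ux]; split => //; exact: XH.
  - by move=> x [/HU].
apply: le_trans; first exact: leeD2r h1.
have key g : unit_fields (H `&` G) g -> ((T g)%:E + vmeas (X `\` G) <= ovar H)%E.
  move=> [tg gHG g1]; have oC : open (H `\` fsupport g).
    by apply: openI => //; apply: closed_openC; exact: closed_closure.
  apply: (@le_trans _ _ (ovar (fsupport g) + ovar (H `\` fsupport g))%E).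
    apply: leeD; first by apply: ovar_ub; split.
    apply: ereal_inf_lbound; exists (H `\` fsupport g) => //; split => //.
      by move=> x [[Xx nG] Ux]; split; [exact: XH|move=> /gHG[]].
    by move=> x [/HU].
  apply: le_trans (ovar_disj _) _; first by rewrite setIDA setDE setIAC setICr set0I.
  by apply: le_ovar => x [/gHG[]|[]].
suff: (ovar (H `&` G) + vmeas (X `\` G) <= ovar H)%E by [].
have := vmeas_ge0 (X `\` G); move: key; case: (vmeas _) => [b||] // key _.
  have : (ovar (H `&` G) <= ovar H - b%:E)%E.
    apply: ge_ereal_sup => _ [g gHG <-].
    by rewrite leeBrDr//; exact: key.
  by rewrite leeBrDr//.
have := key _ (unit_fields0 _); rewrite T0 add0e leye_eq => /eqP ->.
exact: leey.
Qed.

(** A competitor agrees with [ovar] on open subsets of U and vanishes off U, so monotonicity bounds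
    it by the infimum defining [vmeas]. The Borel hull of A is U if A has infinite measure, and
    otherwise an intersection of open sets with measures tending to that of A. *)
Lemma vmeas_largest : largest_variation U T vmeas.
Proof.
split; last first.
  move=> nu [[nu0 _ _] nuG] A; apply: le_ereal_inf_tmp => _ [G [oG AG GU] <-].
  have <- : nu G = ovar G := nuG G oG GU.
  apply: (@le_trans _ _ (nu (A `&` U) + nu (A `\` U))%E).
    by rewrite -{1}(setUIDK A U); exact: outer_measureU2.
  rewrite (_ : nu (A `\` U) = 0%E) ?adde0; first exact: le_outer_measure.
  by apply: outer_measure_le0 nu0 => x [].
split; last by move=> G oG GU; exact: vmeasE.
split; [exact: vmeas_setC|by move=> G oG GU; exact: vmeas_open_carath|move=> A AU].
have [Aoo|Afin] := eqVneq (vmeas A) +oo%E.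
  exists U; split => //; first exact: sub_sigma_algebra.
  suff : vmeas U = vmeas A by [].
  by apply/eqP; rewrite Aoo eq_le leey/= -Aoo; exact: vmeas_le.
have Afin' : vmeas A \is a fin_num by rewrite ge0_fin_numE ?ltey.
have [G PG] : {G : nat -> set 'rV[R]_n & forall k, [/\ open (G k), A `<=` G k,
    G k `<=` U & (ovar (G k) <= vmeas A + (k.+1%:R^-1)%:E)%E]}.
  apply: (@choice _ _ (fun k G => [/\ open G, A `<=` G, G `<=` U &
    (ovar G <= vmeas A + (k.+1%:R^-1)%:E)%E])) => k.
  have k0 : 0 < k.+1%:R^-1 :> R by rewrite invr_gt0.
  have [_ [G [oG AG GU] <-] /ltW h] := lb_ereal_inf_adherent k0 Afin'.
  exists G; split => // x Ax; apply: AG; split => //; exact: AU.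
exists (\bigcap_k G k); split.
- rewrite -[\bigcap_k _]setCK setC_bigcap; apply: sigma_algebraC.
  apply: sigma_algebra_bigcup => k; apply: sigma_algebraC.
  by apply: sub_sigma_algebra; have [] := PG k.
- by move=> x Ax k _; have [_ + _ _] := PG k; exact.
- by move=> x /(_ 0%N I); have [_ _ + _] := PG 0%N; exact.
suff : vmeas (\bigcap_k G k) = vmeas A by [].
apply/eqP; rewrite eq_le; apply/andP; split; last first.
  by apply: vmeas_le => x Ax k _; have [_ + _ _] := PG k; exact.
apply/lee_addgt0Pr => e e0.
pose k := Num.truncn e^-1.
have [oG AG GU h] := PG k.
apply: (@le_trans _ _ (vmeas (G k))); first by apply: vmeas_le => x; exact.
rewrite vmeasE//; apply: le_trans h _; rewrite leeD2l// lee_fin.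
rewrite invf_ple ?posrE ?ltr0n//; exact: ltW (truncnS_gt _).
Qed.

(** The existence of [vmeas] excludes the default branch of [dist_variation]. *)
Lemma dist_variationP : largest_variation U T (dist_variation U T).
Proof.
rewrite /dist_variation; case: pselect => [h|h]; first by case: cid.
by exfalso; apply: h; exists vmeas; exact: vmeas_largest.
Qed.

(** The field eta_0 u is the sum of the slices (eta_k - eta_(k+1)) u for k < J and of the remainder
    eta_J u; each is bounded by its supremum times the variation of a set containing its support.
    The slices are dyadic annuli in the monotonicity formula and dyadic level sets of |u| in the L1
    bound. *)
Lemma T_telescope (u : field) (eta : nat -> 'rV[R]_n -> R) (c : nat -> R)
    (G : nat -> set 'rV[R]_n) (J : nat) : test_field U u ->
  (forall k, smooth (eta k)) -> (forall k, 0 <= c k) ->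
  (forall k x, `|eta k x - eta k.+1 x| * enorm (u x) <= c k) ->
  (forall k, fsupport (fun x => (eta k x - eta k.+1 x) *: u x) `<=` G k) ->
  (forall x, `|eta J x| * enorm (u x) <= c J) ->
  fsupport (fun x => eta J x *: u x) `<=` G J ->
  ((T (fun x => eta 0%N x *: u x))%:E <= \sum_(k < J.+1) (c k)%:E * ovar (G k))%E.
Proof.
move=> tu es c0 ec eG.
elim: J => [|J IH] eJ GJ.
  rewrite big_ord_recl big_ord0 adde0; apply: ovar_bound => //.
    exact: test_fieldZ.
  by move=> x; rewrite enormZ; exact: eJ.
have key j : ((T (fun x => eta 0%N x *: u x))%:E <=
    \sum_(k < j) (c k)%:E * ovar (G k) + (T (fun x => eta j x *: u x))%:E)%E.
  elim: j => [|j IHj]; first by rewrite big_ord0 add0e.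
  apply: le_trans IHj _; rewrite big_ord_recr/= -addeA leeD2l//.
  have sd : smooth (fun x => eta j x - eta j.+1 x) by exact: smoothB.
  have -> : T (fun x => eta j x *: u x) =
      T (fun x => (eta j x - eta j.+1 x) *: u x) + T (fun x => eta j.+1 x *: u x).
    rewrite -TD; [|exact: test_fieldZ|exact: test_fieldZ]; congr T.
    by apply/funext => x; rewrite -scalerDl subrK.
  rewrite EFinD leeD2r//; apply: ovar_bound => //; first exact: test_fieldZ.
  by move=> x; rewrite enormZ; exact: ec.
apply: le_trans (key J.+1) _; rewrite [leRHS]big_ord_recr/= leeD2l//.
apply: ovar_bound => //; first exact: test_fieldZ.
by move=> x; rewrite enormZ; exact: eJ.
Qed.

End OpenVariation.

(** * Hausdorff measure and densities *)

Lemma ereal_supD_le {R : realType} (S1 S2 : set \bar R) (M : \bar R) :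
  S1 !=set0 -> S2 !=set0 -> (forall x, S1 x -> 0 <= x)%E ->
  (forall y, S2 y -> 0 <= y)%E ->
  (forall x y, S1 x -> S2 y -> x + y <= M)%E ->
  (ereal_sup S1 + ereal_sup S2 <= M)%E.
Proof.
move=> [x0 Sx0] [y0 Sy0] S10 S20 h; case: M h => [M||] h; last 2 first.
- exact: leey.
- have := h _ _ Sx0 Sy0; have := S10 _ Sx0; have := S20 _ Sy0.
  by case: x0 {Sx0} => [x||] //; case: y0 {Sy0} => [y||].
have fin2 y : S2 y -> y \is a fin_num.
  move=> Sy; rewrite ge0_fin_numE ?S20//; apply: le_lt_trans (ltry M).
  by apply: le_trans (h _ _ Sx0 Sy); rewrite leeDr// S10.
have h2 y : S2 y -> (ereal_sup S1 <= M%:E - y)%E.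
  move=> Sy; apply: ge_ereal_sup => x Sx.
  by rewrite leeBrDr ?fin2//; exact: h.
have s1 : ereal_sup S1 \is a fin_num.
  have s10 : (0 <= ereal_sup S1)%E.
    by apply: (le_trans (S10 _ Sx0)); exact: ereal_sup_ubound.
  rewrite ge0_fin_numE//; apply: (le_lt_trans (h2 _ Sy0)).
  by move: (fin2 _ Sy0); case: y0 {Sy0} => [y||] // _; rewrite -EFinB ltry.
rewrite addeC -leeBrDr//; apply: ge_ereal_sup => y Sy.
by rewrite leeBrDr// addeC -leeBrDr ?fin2//; exact: h2.
Qed.

Section HausdorffTheory.
Context {R : realType} {n : nat}.
Variable m : nat.
Implicit Types (A B C X S : set 'rV[R]_n) (d e : R).
Local Notation H := (hausdorff m : set 'rV[R]_n -> \bar R).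

Lemma alpha_gt0 k : 0 < alpha k :> R.
Proof.
suff: 0 < alpha k :> R /\ 0 < alpha k.+1 :> R by case.
elim: k => [|k [h1 h2]]; split=> //=.
by rewrite mulr_gt0// divr_gt0// mulr_gt0// pi_gt0.
Qed.

Lemma ediam_ub S x y : S x -> S y -> ((enorm (x - y))%:E <= ediam S)%E.
Proof. by move=> Sx Sy; apply: ereal_sup_ubound; exists (x, y). Qed.

Lemma ediam_ge0 S x : S x -> (0 <= ediam S)%E.
Proof. by move=> Sx; apply: le_trans (ediam_ub Sx Sx); rewrite lee_fin enorm_ge0. Qed.

Lemma ediam_set0 : ediam (set0 : set 'rV[R]_n) = -oo%E.
Proof. by rewrite /ediam setX0 image_set0 ereal_sup0. Qed.

Lemma gauge_ge0 S : (0 <= hausdorff_gauge m S)%E.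
Proof.
rewrite /hausdorff_gauge; case: ifPn => // /set0P[x Sx].
by rewrite mule_ge0 ?expe_ge0 ?(ediam_ge0 Sx)// lee_fin divr_ge0// ltW// alpha_gt0.
Qed.

Lemma gauge_set0 : hausdorff_gauge m (set0 : set 'rV[R]_n) = 0%E.
Proof. by rewrite /hausdorff_gauge eqxx. Qed.

Lemma size_ge0 d A : (0 <= hausdorff_size m d A)%E.
Proof.
apply: le_ereal_inf_tmp => _ [F _ <-].
by apply: nneseries_ge0 => k _ _; exact: gauge_ge0.
Qed.

Lemma size_antitone d e A : d <= e -> (hausdorff_size m e A <= hausdorff_size m d A)%E.
Proof.
move=> de; apply: ereal_inf_le_tmp => _ [F [AF Fd] <-]; exists F => //.
by split => // k; apply: le_trans (Fd k) _; rewrite lee_fin.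
Qed.

Lemma size_le_hausdorff d A : 0 < d -> (hausdorff_size m d A <= H A)%E.
Proof. by move=> d0; apply: ereal_sup_ubound; exists d. Qed.

Definition separated A B := exists2 d, 0 < d &
  forall x y, A x -> B y -> d <= enorm (x - y).

Lemma hausdorff_separated A B : separated A B -> (H A + H B <= H (A `|` B))%E.
Proof.
move=> [d d0 dAB]; apply: ereal_supD_le.
- by exists (hausdorff_size m 1 A); exists 1 => /=.
- by exists (hausdorff_size m 1 B); exists 1 => /=.
- by move=> _ [e _ <-]; exact: size_ge0.
- by move=> _ [e _ <-]; exact: size_ge0.
move=> _ _ [a /= a0 <-] [b /= b0 <-].
(* As c < d, no set of a cover of mesh c meets both A and B, and the cover splits into covers of A
   and of B. *)
pose c := Num.min (Num.min a b) (d / 2).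
have c0 : 0 < c by rewrite !lt_min a0 b0 divr_gt0.
have ca : c <= a by rewrite /c !ge_min lexx.
have cb : c <= b by rewrite /c !ge_min lexx orbT.
have cd : c < d.
  apply: (@le_lt_trans _ _ (d / 2)); first by rewrite /c ge_min lexx orbT.
  by rewrite ltr_pdivrMr// ltr_pMr// ltr1n.
apply: (@le_trans _ _ (hausdorff_size m c A + hausdorff_size m c B)%E).
  by apply: leeD; exact: size_antitone.
apply: le_trans (size_le_hausdorff _ c0).
apply: le_ereal_inf_tmp => _ [F [ABF Fc] <-].
pose FA k := if pselect (F k `&` A !=set0) then F k else set0.
pose FB k := if pselect (F k `&` B !=set0) then F k else set0.
have cvA : (hausdorff_size m c A <= \sum_(k <oo) hausdorff_gauge m (FA k))%E.
  apply: ereal_inf_lbound; exists FA => //; split.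
    move=> x Ax; have [k _ Fkx] := ABF x (or_introl Ax); exists k => //.
    by rewrite /FA; case: pselect => // h; exfalso; apply: h; exists x.
  by move=> k; rewrite /FA; case: pselect => h; [exact: Fc|rewrite ediam_set0 leNye].
have cvB : (hausdorff_size m c B <= \sum_(k <oo) hausdorff_gauge m (FB k))%E.
  apply: ereal_inf_lbound; exists FB => //; split.
    move=> x Bx; have [k _ Fkx] := ABF x (or_intror Bx); exists k => //.
    by rewrite /FB; case: pselect => // h; exfalso; apply: h; exists x.
  by move=> k; rewrite /FB; case: pselect => h; [exact: Fc|rewrite ediam_set0 leNye].
apply: le_trans (leeD cvA cvB) _; rewrite -nneseriesD; last 2 first.
- by move=> k _ _; exact: gauge_ge0.
- by move=> k _ _; exact: gauge_ge0.
apply: lee_nneseries => [k _ _|k _]; first by rewrite adde_ge0 ?gauge_ge0.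
rewrite /FA /FB; case: pselect => [[x [Fx Ax]]|hA]; case: pselect => [[y [Fy By]]|hB].
- exfalso; have := le_trans (ediam_ub Fx Fy) (Fc k); rewrite lee_fin => h.
  by have := dAB _ _ Ax By; move/(lt_le_trans (le_lt_trans h cd)); rewrite ltxx.
- by rewrite gauge_set0 adde0.
- by rewrite gauge_set0 add0e.
- by rewrite gauge_set0 adde0 gauge_ge0.
Qed.

(* Caratheodory's criterion: the layers of X between distance 1/(k+1) and 1/k
   from C are separated in pairs of the same parity, so that their measures
   are summable. *)
Lemma hausdorff_closed_carath C : closed C ->
  (hausdorff m : {outer_measure set 'rV[R]_n -> \bar R}).-caratheodory C.
Proof.
move=> cC; apply: carathP => X Xoo.
pose L k := X `&` [set x | forall y, C y -> k.+1%:R^-1 <= enorm (x - y)].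
pose Q k := if k is j.+1 then L j.+1 `\` L j else L 0%N.
have Lmono j k : (j <= k)%N -> L j `<=` L k.
  move=> jk x [Xx h]; split => // y Cy; apply: le_trans (h y Cy).
  by rewrite lef_pV2 ?posrE ?ltr0n// ler_nat.
have QL k : Q k `<=` L k by case: k => // k x [].
have LX k : L k `<=` X by move=> x [].
(* A point of [L k] is at distance at least 1/(k+1) from every point of C, a point of X outside
   [L k.+1] at distance less than 1/(k+2) from some point of C. *)
have sep k A B : A `<=` L k -> B `<=` X `\` L k.+1 -> separated A B.
  move=> AL BL; exists (k.+1%:R^-1 - k.+2%:R^-1).
    by rewrite subr_gt0 ltf_pV2 ?posrE ?ltr0n// ltr_nat.
  move=> x z /AL[_ xL] /BL[Xz nz].
  have [y [Cy yz]] : exists y, C y /\ enorm (z - y) < k.+2%:R^-1.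
    apply: contrapT => /forallNP h; apply: nz; split => // y Cy.
    by rewrite leNgt; apply/negP => yz; exact: h y (conj Cy yz).
  rewrite lerBlDr; apply: (le_trans (xL y Cy)).
  by apply: (le_trans (enorm_triangleB x z y)); rewrite lerD2l ltW.
have parity p N : (p < 2)%N -> (\sum_(j < N) H (Q (2 * j + p)%N) <=
    H (\big[setU/set0]_(j < N) Q (2 * j + p)%N))%E.
  move=> p2; elim: N => [|N IH]; first by rewrite !big_ord0 outer_measure0.
  rewrite !big_ord_recr/=; apply: (le_trans (leeD2r _ IH)).
  case: N {IH} => [|N].
    by rewrite !big_ord0 outer_measure0 add0e set0U.
  apply: hausdorff_separated; apply: (sep (2 * N + p)%N).
    rewrite -(bigcup_mkord N.+1 (fun j => Q (2 * j + p)%N)) => x [j /= jN] /QL.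
    apply: Lmono.
    by rewrite leq_add2r leq_mul2l/= -ltnS.
  rewrite (_ : 2 * N.+1 + p = (2 * N + p).+2)%N; last by rewrite mulnS !addSn.
  by move=> x [[Xx _] nL].
have sumH N : (\sum_(0 <= j < N) H (Q j) <= H X + H X)%E.
  apply: (@le_trans _ _ (\sum_(0 <= j < 2 * N) H (Q j))%E).
    rewrite [leRHS](big_cat_nat (n := N))//= ?leq_pmull//.
    by rewrite leeDl// sume_ge0// => j _; exact: outer_measure_ge0.
  have -> : (\sum_(0 <= j < 2 * N) H (Q j) =
      \sum_(j < N) H (Q (2 * j + 0)%N) + \sum_(j < N) H (Q (2 * j + 1)%N))%E.
    rewrite -big_split/= -(big_mkord xpredT
      (fun j => (H (Q (2 * j + 0)%N) + H (Q (2 * j + 1)%N))%E)).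
    elim: (N) => [|M IH]; first by rewrite muln0 !big_geq.
    rewrite mulnS !addSn add0n big_nat_recr//= big_nat_recr//= big_nat_recr//= IH.
    by rewrite -addeA addn0 addn1.
  have half p : (p < 2)%N -> (\sum_(j < N) H (Q (2 * j + p)%N) <= H X)%E.
    move=> p2; apply: le_trans (parity _ _ p2) _; apply: le_outer_measure.
    by rewrite -(bigcup_mkord N (fun j => Q (2 * j + p)%N)) => x [j _] /QL /LX.
  by apply: leeD; exact: half.
have Q0 k : xpredT k -> (0 <= H (Q k))%E by move=> _; exact: outer_measure_ge0.
have sumfin : (\sum_(0 <= k <oo) H (Q k) < +oo)%E.
  apply: (@le_lt_trans _ _ (H X + H X)%E); last by rewrite lte_add_pinfty.
  apply: lime_le; first by apply: is_cvg_nneseries => k _; exact: Q0.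
  by apply: nearW => N; exact: sumH.
have tail := nneseries_tail_cvg sumfin Q0.
apply/lee_addgt0Pr => e e0.
have [N _ hN] := tail _ (nbhs_open_ereal_lt (f := fun=> e) e0).
have {}hN := ltW (hN N.+1 (leqnSn N)).
have cover : X `\` C `<=` L N `|` \bigcup_k Q (N.+1 + k)%N.
  move=> x [Xx nC].
  have oC : open (~` C) by exact: closed_openC.
  have [r r0 rC] := open_eoball oC nC.
  have [k Lk] : exists k, L k x.
    exists (Num.truncn r^-1); split => // y Cy; rewrite leNgt; apply/negP => h.
    apply: (rC y) => //; rewrite /eoball/= enormB; apply: lt_le_trans h _.
    by rewrite invf_ple ?posrE ?ltr0n//; exact: ltW (truncnS_gt _).
  elim: k Lk => [|k IH] Lk; first by left; exact: Lmono Lk.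
  have [Lk'|nLk] := pselect (L k x); first exact: IH.
  have [kN|Nk] := leqP k.+1 N; first by left; exact: Lmono Lk.
  by right; exists (k.+1 - N.+1)%N => //; rewrite subnKC.
have h1 : (H (X `&` C) + H (L N) <= H X)%E.
  apply: (@le_trans _ _ (H ((X `&` C) `|` L N))).
    apply: hausdorff_separated; exists N.+1%:R^-1; first by rewrite invr_gt0.
    by move=> x y [_ Cx] [_ /(_ x Cx)]; rewrite enormB.
  by apply: le_outer_measure => x [[]|/LX].
have h2 : (H (X `\` C) <= H (L N) + e%:E)%E.
  apply: le_trans (le_outer_measure _ _ _ cover) _.
  apply: le_trans (outer_measureU2 _ _ _) _; rewrite leeD2l//.
  apply: le_trans (outer_measure_sigma_subadditive _ _) _.
  apply: le_trans hN; rewrite -nneseries_addn; last by move=> i; exact: outer_measure_ge0.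
  by rewrite le_eqVlt; apply/orP; left; apply/eqP; apply: eq_eseriesr => i _; rewrite addnC.
by apply: le_trans (leeD2l _ h2) _; rewrite addeA leeD2r.
Qed.

Lemma hausdorff_opens_carath :
  opens_carath (hausdorff m : {outer_measure set 'rV[R]_n -> \bar R}).
Proof.
move=> G oG; rewrite -(setCK G); apply: carathC.
by apply: hausdorff_closed_carath; exact: open_closedC.
Qed.

End HausdorffTheory.

Section IndicatorBounds.
Context {R : realType} {X : ptopologicalType}.
Implicit Types (mu : {outer_measure set X -> \bar R}) (f : X -> R).
Local Open Scope ereal_scope.

Lemma ointegral_ge_indic mu f (C D : set X) : opens_carath mu -> continuous f ->
  mu.-caratheodory C -> mu.-caratheodory D ->
  (forall x, 0 <= f x)%R -> (forall x, C x -> 1 <= f x)%R ->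
  mu (C `&` D) <= ointegral mu D (EFin \o f).
Proof.
move=> omu cf cC cD f0 fC; have mf := continuous_carath omu cf.
have mC : measurable (C : set (caratheodory_type mu)) by [].
have mD : measurable (D : set (caratheodory_type mu)) by [].
rewrite -(@integral_indic _ (caratheodory_type mu) R mu D mD C mC).
apply: (ge0_le_integral _ mD) => [x _|||x _].
- by rewrite lee_fin.
- by apply/measurable_EFinP; exact: measurable_indic.
- by apply/measurable_EFinP; exact: measurable_funS mf.
rewrite lee_fin indicE; case: (boolP (x \in C)) => // /set_mem.
exact: fC.
Qed.

Lemma ointegral_le_indic mu f (C D : set X) : opens_carath mu -> continuous f ->
  mu.-caratheodory C -> mu.-caratheodory D ->
  (forall x, 0 <= f x <= 1)%R -> (forall x, ~ C x -> f x = 0)%R ->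
  ointegral mu D (EFin \o f) <= mu (C `&` D).
Proof.
move=> omu cf cC cD f01 fC; have mf := continuous_carath omu cf.
have mC : measurable (C : set (caratheodory_type mu)) by [].
have mD : measurable (D : set (caratheodory_type mu)) by [].
rewrite -(@integral_indic _ (caratheodory_type mu) R mu D mD C mC).
apply: (ge0_le_integral _ mD) => [x _|||x _].
- by rewrite lee_fin; have /andP[] := f01 x.
- by apply/measurable_EFinP; exact: measurable_funS mf.
- by apply/measurable_EFinP; exact: measurable_indic.
rewrite lee_fin indicE; case: (boolP (x \in C)) => [_|xC].
  by have /andP[] := f01 x.
by rewrite fC// => Cx; move: xC; rewrite mem_set.
Qed.

Lemma ointegral_nneg mu f (D : set X) : (forall x, 0 <= f x)%R ->
  0 <= ointegral mu D (EFin \o f).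
Proof. by move=> f0; apply: integral_ge0 => x _; rewrite lee_fin. Qed.

End IndicatorBounds.

(** * Finite Vitali covering *)

Section Vitali.
Context {R : realType} {n : nat}.
Implicit Types (s : seq 'rV[R]_n) (rho : 'rV[R]_n -> R).

(** Greedy selection, by induction on the number of centers: keep a center b of largest radius and
    drop those at distance at most rho a + rho b, whose balls lie in the threefold enlargement of
    the ball of b. Disjointness is recorded as separation of the centers. *)
Lemma finite_vitali s rho : exists D : seq 'rV[R]_n,
  [/\ uniq D, {subset D <= s},
      {in D &, forall a b, a != b -> rho a + rho b < enorm (a - b)} &
      forall a, a \in s -> exists2 b, b \in D &
        ecball a (rho a) `<=` ecball b (3 * rho b)].
Proof.
elim: {s}(size s).+1 {-2}s (ltnSn (size s)) => // k IH s sk.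
have [->|s0] := eqVneq s [::]; first by exists [::]; split.
have [b bs bmax] : exists2 b, b \in s & forall a, a \in s -> rho a <= rho b.
  elim: s s0 {sk} => // a s IHs _; have [->|s0] := eqVneq s [::].
    by exists a; rewrite ?mem_head// => c; rewrite inE => /eqP ->.
  have [b bs bmax] := IHs s0; have [ab|ba] := leP (rho a) (rho b).
    by exists b; [rewrite inE bs orbT|move=> c; rewrite inE => /orP[/eqP ->|/bmax]].
  exists a; first exact: mem_head.
  move=> c; rewrite inE => /orP[/eqP ->//|/bmax cb]; exact: le_trans (ltW ba).
pose s' := [seq a <- s | rho a + rho b < enorm (a - b)].
(* If even the largest radius is negative, all the balls are empty and a single center suffices. *)
have [r0|r0] := ltP (rho b) 0.
  exists [:: b]; split => //.
  - by move=> a; rewrite inE => /eqP ->.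
  - by move=> a c; rewrite !inE => /eqP -> /eqP ->; rewrite eqxx.
  - move=> a /bmax ab; exists b; first exact: mem_head.
    move=> x; rewrite /ecball/= => h; exfalso.
    by have := enorm_ge0 (x - a); rewrite leNgt (le_lt_trans h)// (le_lt_trans ab).
have s's : (size s' < k)%N.
  rewrite -ltnS; apply: leq_trans sk; rewrite ltnS /s' size_filter.
  set p := (X in count X s).
  rewrite -(count_predC p s) -[ltnLHS]addn0 ltn_add2l -has_count.
  by apply/hasP; exists b => //=; rewrite /p /= subrr enorm0 -leNgt addr_ge0.
have [D [uD Ds Ddisj Dcov]] := IH s' s's.
have Db a : a \in D -> rho a + rho b < enorm (a - b).
  by move=> /Ds; rewrite mem_filter => /andP[].
exists (b :: D); split.
- rewrite /= uD andbT; apply/negP => /Db.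
  by rewrite subrr enorm0 ltNge addr_ge0.
- by move=> a; rewrite inE => /orP[/eqP ->//|/Ds]; rewrite mem_filter => /andP[].
- move=> a c; rewrite !inE => /orP[/eqP ->|aD] /orP[/eqP ->|cD].
  + by rewrite eqxx.
  + by move=> _; rewrite enormB addrC; exact: Db.
  + by move=> _; exact: Db.
  + exact: Ddisj.
- move=> a sa; have [h|h] := ltP (rho a + rho b) (enorm (a - b)).
    have [|c cD ac] := Dcov a; first by rewrite mem_filter h.
    by exists c => //; rewrite inE cD orbT.
  exists b; first exact: mem_head.
  by apply: ecball_sub; have := bmax a sa; lra.
Qed.

End Vitali.

Section DisjointSums.
Context {R : realType} {T : pointedType} {I : eqType}.
Local Open Scope ereal_scope.

Lemma sum_disjoint_le (mu : {outer_measure set T -> \bar R}) (s : seq I)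
    (F : I -> set T) (A : set T) : uniq s ->
  (forall i, i \in s -> mu.-caratheodory (F i)) ->
  {in s &, forall i j, i != j -> F i `&` F j = set0} ->
  (forall i, i \in s -> F i `<=` A) ->
  \sum_(i <- s) mu (F i) <= mu A.
Proof.
elim: s A => [|i s IH] A /=; first by rewrite big_nil outer_measure_ge0.
move=> /andP[si us] cF dF FA; rewrite big_cons.
have ci : mu.-caratheodory (F i) by apply: cF; rewrite mem_head.
rewrite (carathD ci (FA i (mem_head _ _))) leeD2l//; apply: IH => //.
- by move=> j js; apply: cF; rewrite inE js orbT.
- by move=> j k js ks; apply: (dF j k); rewrite inE ?js ?ks orbT.
- move=> j js x Fjx; split; first by apply: (FA j) => //; rewrite inE js orbT.
  move=> Fix; have ij : i != j by apply: contraNneq si => ->.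
  have : (F i `&` F j) x by [].
  by rewrite (dF i j)// ?mem_head// inE js orbT.
Qed.

End DisjointSums.

(** * Sets of points with low density ratios *)

Section LowDensity.
Context {R : realType} {n : nat}.
Implicit Types (mu : {outer_measure set 'rV[R]_n -> \bar R}) (x a : 'rV[R]_n).

(** By continuity of the power, a strict excess at radius r persists at slightly larger radii. This
    leaves room for moving the center of a ball and for starting from radius 0. *)
Lemma pow_right (t r e : R) (m : nat) (M : \bar R) : r < e ->
  ((t * r ^+ m)%:E < M)%E -> exists s, [/\ r < s, s < e & ((t * s ^+ m)%:E < M)%E].
Proof.
move=> re; case: M => [M||] //; last first.
  by move=> _; exists ((r + e) / 2); split; rewrite ?ltry//; lra.
rewrite lte_fin => h.
have c : {for r, continuous (fun s : R => t * s ^+ m)}.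
  by apply: cvgMr; exact: exprn_continuous.
have /nbhs_ballP[d /= d0 hd] : nbhs r [set s | t * s ^+ m < M].
  exact: (c _ (lt_nbhsl h)).
exists (Num.min ((r + e) / 2) (r + d / 2)); split.
- by rewrite lt_min; apply/andP; split; lra.
- by rewrite gt_min; apply/orP; left; lra.
- rewrite lte_fin; apply: hd; rewrite -ball_normE /= distrC ger0_norm.
    by rewrite ltrBlDl gt_min; apply/orP; right; lra.
  by rewrite subr_ge0 le_min; apply/andP; split; lra.
Qed.

Definition lowdens mu (m : nat) (t e : R) : set 'rV[R]_n :=
  [set x | forall r, 0 < r < e -> (mu (ecball x r) <= (t * r ^+ m)%:E)%E].

(** If a ball around x has too much mass, so does a slightly larger radius, and the balls of that
    radius around points near x contain the first ball. Closedness makes these sets measurable. *)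
Lemma lowdens_closed mu m t e : closed (lowdens mu m t e).
Proof.
rewrite -[lowdens _ _ _ _]setCK; apply: open_closedC; rewrite openE => x.
move=> /existsNP[r /not_implyP[/andP[r0 re] /negP]]; rewrite -ltNge => h.
have [s [rs se hs]] := pow_right re h.
have sr : 0 < s - r by rewrite subr_gt0.
apply: (@filterS _ (nbhs x) (nbhs_filter x) (eoball x (s - r))).
  move=> y yx; apply/existsNP; exists s; apply/not_implyP; split.
    by rewrite se (lt_trans r0).
  apply/negP; rewrite -ltNge; apply: (lt_le_trans hs); apply: le_outer_measure.
  apply: ecball_sub; move: yx; rewrite /eoball/= enormB => yx.
  by rewrite -lerBrDr ltW.
by apply: open_nbhs_nbhs; split; [exact: eoball_open|exact: eoball_center].
Qed.

(** Radius 0 is included for the sake of covering sets of diameter 0. *)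
Lemma lowdens0 mu m t e x r : lowdens mu m t e x -> 0 <= r < e ->
  (mu (ecball x r) <= (t * r ^+ m)%:E)%E.
Proof.
move=> lx /andP[]; rewrite le_eqVlt => /orP[/eqP <-|r0] re; last first.
  by apply: lx; rewrite r0.
rewrite leNgt; apply/negP => h; have [s [s0 se hs]] := pow_right re h.
have : (mu (ecball x 0) <= (t * s ^+ m)%:E)%E.
  apply: (le_trans _ (lx s _)); last by rewrite s0.
  apply: le_outer_measure; apply: ecball_sub.
  by rewrite subrr enorm0 add0r ltW.
by rewrite leNgt hs.
Qed.

Lemma lowdens_antitone mu m t e d : d <= e -> lowdens mu m t e `<=` lowdens mu m t d.
Proof. by move=> de x h r /andP[r0 rd]; apply: h; rewrite r0 (lt_le_trans rd). Qed.

Lemma ediam_ecball x r : (ediam (ecball x r) <= (2 * r)%:E)%E.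
Proof.
apply: ge_ereal_sup => _ [[a b] [/= ha hb] <-]; rewrite lee_fin.
apply: (le_trans (enorm_triangleB a x b)); rewrite (enormB x b).
by move: ha hb; rewrite /ecball/=; lra.
Qed.

Lemma gauge_ecball m x r : 0 <= r ->
  (hausdorff_gauge m (ecball x r) <= (alpha m * r ^+ m)%:E)%E.
Proof.
move=> r0; have xr : ecball x r x by rewrite /ecball/= subrr enorm0.
rewrite /hausdorff_gauge; case: ifPn => [/eqP h|_]; first by move: xr; rewrite h.
have := ediam_ecball x r; have := ediam_ge0 xr.
case: (ediam _) => [d||] //; rewrite !lee_fin => d0 d2.
rewrite -EFin_expe -EFinM lee_fin -mulrA ler_wpM2l ?(ltW (alpha_gt0 m))//.
rewrite ler_pdivrMl ?exprn_gt0// -exprMn.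
by rewrite lerXn2r ?nnegrE// mulr_ge0.
Qed.

End LowDensity.

(** * The weight of an integral varifold against Hausdorff measure *)

Section IntegralVarifold.
Context {R : realType} {n m : nat} {mn : (m <= n)%N}.
Notation G := (grassmannian R mn).
Local Notation H := (hausdorff m : {outer_measure set 'rV[R]_n -> \bar R}).
Variables (U : set 'rV[R]_n) (V : {outer_measure set ('rV[R]_n * G) -> \bar R}).
Variables (c : nat -> nat) (E : nat -> set 'rV[R]_n) (tau : nat -> 'rV[R]_n -> G).
Hypotheses (oU : open U) (vV : varifold U V) (c0 : forall i, (0 < c i)%N)
  (cE : forall i, H.-caratheodory (E i))
  (VE : forall f, Cc (U `*` setT) f -> ointegral V setT (EFin \o f) =
      (\sum_(i <oo) (c i)%:R%:E *
        ointegral (hausdorff m) (E i) (fun x => (f (x, tau i x))%:E))%E).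
Implicit Types (A C D K L X : set 'rV[R]_n).
Local Notation mu := (weight V).

Let oH : opens_carath H := @hausdorff_opens_carath R n m.
Let rmu : radon U mu := radon_weight oU vV.
Let omu : opens_carath (mu : {outer_measure set 'rV[R]_n -> \bar R}) :=
  radon_opens_carath oU rmu.

Let oV : opens_carath V := varifold_opens_carath oU vV.

Lemma fst_continuous (phi : 'rV[R]_n -> R) : continuous phi ->
  continuous (fun p : 'rV[R]_n * G => phi p.1).
Proof.
move=> cphi p; apply: (@cvg_comp _ _ _ fst phi); first exact: cvg_fst.
exact: cphi.
Qed.

Lemma varifold_formula (phi : 'rV[R]_n -> R) L : continuous phi -> compact L ->
  L `<=` U -> (forall x, ~ L x -> phi x = 0) ->
  ointegral V setT (EFin \o (fun p => phi p.1)) =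
  (\sum_(i <oo) (c i)%:R%:E * ointegral H (E i) (EFin \o phi))%E.
Proof.
move=> cphi cL LU phiL.
rewrite (VE (f := fun p => phi p.1))//.
have clLT : closed (L `*` [set: G]) by apply: cylinder_closed; exact: compact_closed_rV.
have sub : fsupport (fun p : 'rV[R]_n * G => phi p.1) `<=` L `*` setT.
  rewrite [X in _ `<=` X](closure_id _).1//; apply: closure_subset => p /= /eqP h.
  by split => //; apply: contrapT => /phiL.
split; first exact: fst_continuous.
  apply: subclosed_compact sub; first exact: closed_closure.
  exact: compact_setX grassmannian_compact.
by move=> p /sub[/= /LU].
Qed.

Let product_carath L : compact L -> V.-caratheodory (L `*` setT).
Proof.
by move=> cL; apply: closed_carath => //; apply: cylinder_closed; exact: compact_closed_rV.
Qed.

(** A test function between the indicators of C and Op, inserted in the integrality formula, carries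
    inequalities between the weight and the weighted Hausdorff measures in both directions. *)
Lemma varifold_test C Op : compact C -> open Op -> C `<=` Op -> Op `<=` U ->
  exists phi : 'rV[R]_n -> R, [/\ forall x, 0 <= phi x,
    (mu C <= \sum_(i <oo) (c i)%:R%:E * ointegral H (E i) (EFin \o phi))%E,
    (\sum_(i <oo) (c i)%:R%:E * ointegral H (E i) (EFin \o phi) <= mu Op)%E,
    forall i, (H (C `&` E i) <= ointegral H (E i) (EFin \o phi))%E &
    forall i, (ointegral H (E i) (EFin \o phi) <= H (Op `&` E i))%E].
Proof.
move=> cC oO CO OU.
have [phi [Q [L [[ps p01 p1] [oQ CQ] [cL QL LO] pL]]]] := smooth_urysohn cC oO CO.
have cphi := smooth_continuous ps.
have cC' := compact_closed_rV cC; have cL' := compact_closed_rV cL.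
have pC x : C x -> phi x = 1 by move=> /CQ /p1.
have p0 x : 0 <= phi x by have /andP[] := p01 x.
exists phi; split => //.
- rewrite -(varifold_formula cphi cL (subset_trans LO OU) pL).
  apply: (@le_trans _ _ (V ((C `*` setT) `&` setT))); first by rewrite setIT.
  apply: ointegral_ge_indic => //; [exact: fst_continuous|exact: product_carath| |].
    by rewrite -setC0; apply: carathC; apply: carath_null; exact: outer_measure0.
  by move=> p [/= /pC ->].
- rewrite -(varifold_formula cphi cL (subset_trans LO OU) pL).
  apply: (@le_trans _ _ (V ((L `*` setT) `&` setT))).
    apply: ointegral_le_indic => //; [exact: fst_continuous|exact: product_carath| |].
      by rewrite -setC0; apply: carathC; apply: carath_null; exact: outer_measure0.
    by move=> p nL; apply: pL => Lp; apply: nL.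
  by rewrite setIT; apply: le_outer_measure => p [/= /LO].
- move=> i; apply: ointegral_ge_indic => //; first exact: closed_carath.
  by move=> x /pC ->.
- move=> i; apply: (@le_trans _ _ (H (L `&` E i))).
    by apply: ointegral_le_indic => //; exact: closed_carath.
  by apply: le_outer_measure; exact: setSI.
Qed.

Lemma varifold_open_ge Op : open Op -> Op `<=` U ->
  (mu Op <= \sum_(i <oo) (c i)%:R%:E * H (Op `&` E i))%E.
Proof.
move=> oO OU; have [_ _ /(_ Op oO OU)[_ ->] _] := rmu.
apply: ge_ereal_sup => _ [C [cC CO] <-].
have [phi [p0 h1 _ _ h2]] := varifold_test cC oO CO OU.
apply: (le_trans h1); apply: lee_nneseries => [i _ _|i _].
  by rewrite mule_ge0 ?lee_fin// ointegral_nneg.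
by rewrite lee_wpmul2l// lee_fin.
Qed.

(** For finitely many i at a time, the Hausdorff measures are approximated from below along the
    compact exhaustion of Op, to which [varifold_test] applies. *)
Lemma varifold_open_le Op : open Op -> Op `<=` U ->
  (\sum_(i <oo) (c i)%:R%:E * H (Op `&` E i) <= mu Op)%E.
Proof.
move=> oO OU.
have H0 i : (0 <= (c i)%:R%:E * H (Op `&` E i))%E.
  by rewrite mule_ge0 ?lee_fin// outer_measure_ge0.
apply: lime_le; first by apply: is_cvg_nneseries => i _ _; exact: H0.
apply: nearW => N; rewrite big_mkord.
have cvgi (i : nat) : ((c i)%:R%:E * H (exhaust Op k `&` E i))%E @[k --> \oo] -->
    ((c i)%:R%:E * H (Op `&` E i))%E.
  apply: cvgeZl => //; rewrite -{2}(exhaust_cup oO) setI_bigcupl.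
  apply: outer_measure_cup_cvg => [k|j k jk].
    apply: carathI => //; apply: closed_carath => //.
    by apply: compact_closed_rV; exact: exhaust_compact.
  by apply/subsetPset; apply: setSI; apply/subsetPset; exact: exhaust_homo.
have cvgs : (\sum_(i < N) (c i)%:R%:E * H (exhaust Op k `&` E i))%E @[k --> \oo] -->
    (\sum_(i < N) (c i)%:R%:E * H (Op `&` E i))%E.
  apply: cvg_nnesum => i _; last exact: cvgi.
  by apply: nearW => k; rewrite mule_ge0 ?lee_fin// outer_measure_ge0.
rewrite -(cvg_lim _ cvgs)//; apply: lime_le; first by apply/cvg_ex; eexists; exact: cvgs.
apply: nearW => k.
have [phi [p0 _ h1 h2 _]] := varifold_test (exhaust_compact (k := k)) oO
  (@exhaust_sub _ _ Op k) OU.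
apply: le_trans h1; rewrite -(big_mkord xpredT
  (fun i => (c i)%:R%:E * H (exhaust Op k `&` E i))%E).
apply: (@le_trans _ _ (\sum_(0 <= i < N) (c i)%:R%:E *
    ointegral H (E i) (EFin \o phi))%E).
  by apply: lee_sum => i _; rewrite lee_wpmul2l ?lee_fin.
apply: nneseries_lim_ge => i _ _.
by rewrite mule_ge0 ?lee_fin// ointegral_nneg.
Qed.

(** The multiplicities are at least 1, which gives the inequality on open sets; outer regularity of
    the weight extends it to X. *)
Lemma hausdorff_le_weight X i : X `<=` U -> (H (X `&` E i) <= mu X)%E.
Proof.
move=> XU; have [_ _ _ /(_ X XU) ->] := rmu.
apply: le_ereal_inf_tmp => _ [Op [oO XO OU] <-].
apply: (@le_trans _ _ (H (Op `&` E i))); first by apply: le_outer_measure; exact: setSI.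
apply: le_trans (varifold_open_le oO OU).
apply: (@le_trans _ _ ((c i)%:R%:E * H (Op `&` E i))%E).
  by rewrite lee_pemull ?outer_measure_ge0// lee_fin ler1n.
apply: le_trans; last first.
  apply: (nneseries_lim_ge i.+1) => j _ _.
  by rewrite mule_ge0 ?lee_fin// outer_measure_ge0.
rewrite big_nat_recr//= leeDr// sume_ge0// => j _.
by rewrite mule_ge0 ?lee_fin// outer_measure_ge0.
Qed.

(** Removing K from an open neighborhood Op changes none of the Hausdorff terms, so Op and Op \ K
    have the same weight, which is finite if Op is small. *)
Lemma weight_compact_null K : compact K -> K `<=` U ->
  (forall i, H (K `&` E i) = 0%E) -> mu K = 0%E.
Proof.
move=> cK KU HK; have [Op [oO KO OU Ooo]] := radon_nbhd oU rmu cK KU.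
have cK' := compact_closed_rV cK.
have oOK : open (Op `\` K) by apply: openI => //; exact: closed_openC.
have OKU : Op `\` K `<=` U by move=> x [/OU].
have h : (mu Op <= mu (Op `\` K))%E.
  apply: (le_trans (varifold_open_ge oO OU)).
  apply: le_trans (varifold_open_le oOK OKU).
  apply: lee_nneseries => [i _ _|i _].
    by rewrite mule_ge0 ?lee_fin// outer_measure_ge0.
  rewrite lee_wpmul2l ?lee_fin//.
  apply: (@le_trans _ _ (H (K `&` E i) + H ((Op `\` K) `&` E i))%E); last first.
    by rewrite HK add0e.
  apply: le_trans; last exact: outer_measureU2.
  apply: le_outer_measure => x [Ox Ex].
  by have [Kx|nK] := pselect (K x); [left|right].
have cmK : (mu : {outer_measure set 'rV[R]_n -> \bar R}).-caratheodory K.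
  exact: closed_carath.
have := carathD cmK KO => e.
move: h; rewrite e -[leRHS]add0e leeD2rE; last first.
  apply: outer_measure_fin; apply: le_lt_trans Ooo; apply: le_outer_measure.
  exact: subDsetl.
by move=> h; apply/eqP; rewrite eq_le h outer_measure_ge0.
Qed.

End IntegralVarifold.

Lemma radon_null_inner {R : realType} {n : nat} (U A : set 'rV[R]_n)
    (mu : {outer_measure set 'rV[R]_n -> \bar R}) : open U -> radon U mu ->
  A `<=` U -> mu.-caratheodory A ->
  (forall K, compact K -> K `<=` A -> mu K = 0%E) -> mu A = 0%E.
Proof.
move=> oU rmu AU cA h; have omu := radon_opens_carath oU rmu.
apply: (null_exhaust oU AU) => k; set B := A `&` _.
have [Q [oQ LQ QU Qoo]] := radon_nbhd oU rmu (exhaust_compact (U := U) (k := k))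
  (@exhaust_sub _ _ U k).
have cB : mu.-caratheodory B.
  apply: carathI => //; apply: closed_carath => //.
  by apply: compact_closed_rV; exact: exhaust_compact.
have BQ : B `<=` Q by move=> x [_ /LQ].
apply/eqP; rewrite eq_le outer_measure_ge0 andbT; apply/lee_addgt0Pr => e e0.
have [K [Q' [[cK _] KB BQ' _ Ke]]] := radon_approx oU rmu cB BQ oQ QU Qoo e0.
apply: (@le_trans _ _ (mu K + mu (Q' `\` K))%E).
  apply: le_trans; last exact: outer_measureU2.
  apply: le_outer_measure => x Bx.
  by have [Kx|nK] := pselect (K x); [left|right; split => //; exact: BQ'].
rewrite h ?add0e//; last by move=> x /KB[].
exact: ltW.
Qed.

Lemma size_le_seq {R : realType} {n : nat} (m : nat) (d : R) (K : set 'rV[R]_n)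
    (I : Type) (s : seq I) (F : I -> set 'rV[R]_n) :
  (forall x, K x -> exists k, (k < size s)%N /\
     forall i0, F (nth i0 s k) x) ->
  (forall i, (ediam (F i) <= d%:E)%E) ->
  (hausdorff_size m d K <= \sum_(i <- s) hausdorff_gauge m (F i))%E.
Proof.
move=> KF Fd; pose Q k := nth set0 [seq F i | i <- s] k.
apply: (@le_trans _ _ (\sum_(k <oo) hausdorff_gauge m (Q k))%E).
  apply: ereal_inf_lbound; exists Q => //; split.
    move=> x /KF[k [ks h]]; exists k => //; rewrite /Q.
    by case: s ks h {KF Q} => // i0 s ks h; rewrite (nth_map i0)//; exact: h.
  move=> k; rewrite /Q; have [ks|ks] := ltnP k (size s).
    by case: s ks {KF Q} => // i0 s ks; rewrite (nth_map i0).
  by rewrite nth_default ?size_map// ediam_set0 leNye.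
rewrite (nneseries_split 0 (size s)); last by move=> k _; exact: gauge_ge0.
rewrite eseries0 ?adde0; last first.
  by move=> k sk _; rewrite /Q nth_default ?gauge_set0// size_map.
rewrite add0n (_ : \sum_(i <- s) _ = \sum_(A <- [seq F i | i <- s]) hausdorff_gauge m A)%E.
  by rewrite (big_nth set0) size_map.
by rewrite big_map.
Qed.

Lemma ecball_disjoint {R : realType} {n : nat} (a b : 'rV[R]_n) (r s : R) :
  r + s < enorm (a - b) -> ecball a r `&` ecball b s = set0.
Proof.
move=> h; apply/seteqP; split=> // x [] /=; rewrite /ecball/= => xa xb.
have := enorm_triangleB a x b; rewrite (enormB a x) => h2.
have : enorm (a - b) <= r + s by lra.
by rewrite leNgt h.
Qed.

(** * Upper density on a set, zero density off it *)

Section Densities.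
Context {R : realType} {n m : nat}.
Local Notation H := (hausdorff m : {outer_measure set 'rV[R]_n -> \bar R}).
Variables (U : set 'rV[R]_n) (mu : {outer_measure set 'rV[R]_n -> \bar R})
  (E : nat -> set 'rV[R]_n).
Hypotheses (oU : open U) (rmu : radon U mu)
  (Hmu : forall X i, X `<=` U -> (H (X `&` E i) <= mu X)%E)
  (muH : forall K, compact K -> K `<=` U -> (forall i, H (K `&` E i) = 0%E) ->
     mu K = 0%E).
Implicit Types (A C D K L X : set 'rV[R]_n).

Let omu : opens_carath mu := radon_opens_carath oU rmu.

(** Half of the coefficient alpha m / 2^m of [hausdorff_gauge]. *)
Definition upper_const : R := alpha m / 2 ^+ m.+1.

Lemma upper_const_gt0 : 0 < upper_const.
Proof. by rewrite divr_gt0 ?exprn_gt0// alpha_gt0. Qed.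

(* Where the balls have density at most upper_const, the measure of a set is at
   most half its Hausdorff gauge, so that coverings give H K <= H K / 2. *)
Lemma lowdens_compact_null D K (d : R) : D `<=` U -> 0 < d -> compact K ->
  K `<=` D -> K `<=` lowdens (orestr mu D) m upper_const d -> mu K = 0%E.
Proof.
move=> DU d0 cK KD Kl; have KU : K `<=` U by exact: subset_trans DU.
apply: muH => // i.
have Koo : (mu K < +oo)%E by have [_ fin _ _] := rmu; exact: fin.
have KEU : K `&` E i `<=` U by move=> x [/KU].
have hfin : H (K `&` E i) \is a fin_num.
  by apply: outer_measure_fin; apply: le_lt_trans Koo; exact: Hmu.
have d2 : 0 < d / 2 by rewrite divr_gt0.
suff : forall e : R, 0 < e -> (H (K `&` E i) <= e%:E)%E.
  move=> h; apply/eqP; rewrite eq_le outer_measure_ge0 andbT.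
  by apply/lee_addgt0Pr => e e0; rewrite add0e; exact: h.
move=> e e0.
have : (hausdorff_size m (d / 2) (K `&` E i) < H (K `&` E i) + e%:E)%E.
  by apply: (le_lt_trans (size_le_hausdorff _ _ d2)); rewrite lteDl// lte_fin.
move=> /ereal_inf_lt[_ [F [cF Fd] <-] sF].
have : (H (K `&` E i) <= \sum_(k <oo) (2^-1)%:E * hausdorff_gauge m (F k))%E.
  apply: (@le_trans _ _ (mu (K `&` E i))).
    have := @Hmu (K `&` E i) i KEU.
    by rewrite -setIA setIid.
  apply: (@le_trans _ _ (mu (\bigcup_k (K `&` E i `&` F k)))).
    by apply: le_outer_measure => x KEx; have [k _ Fx] := cF x KEx; exists k.
  apply: le_trans (outer_measure_sigma_subadditive _ _) _.
  apply: lee_nneseries => [k _ _|k _]; first exact: outer_measure_ge0.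
  have [->|/set0P[x [[Kx Ex] Fx]]] := eqVneq (K `&` E i `&` F k) set0.
    by rewrite outer_measure0 mule_ge0// gauge_ge0.
  have := ediam_ge0 Fx; have := Fd k.
  have ub y : F k y -> ((enorm (y - x))%:E <= ediam (F k))%E by move=> Fy; exact: ediam_ub.
  rewrite /hausdorff_gauge; case: ifPn => [/eqP Fk|_]; first by move: Fx; rewrite Fk.
  case: (ediam _) ub => [r||] // ub; rewrite !lee_fin => rd r0.
  (* [F k] lies in the ball around one of its points x in K whose radius is the diameter of [F k];
     there the low density applies. *)
  apply: (@le_trans _ _ (orestr mu D (ecball x r))).
    apply: le_outer_measure => y [[Ky _] /ub]; rewrite lee_fin => yx.
    by split => //; exact: KD.
  have rr : 0 <= r < d.
    rewrite r0; apply: (le_lt_trans rd).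
    by rewrite ltr_pdivrMr// ltr_pMr// ltr1n.
  apply: (le_trans (lowdens0 (Kl x Kx) rr)).
  rewrite -EFin_expe -!EFinM lee_fin /upper_const exprS le_eqVlt.
  by apply/orP; left; apply/eqP; field; rewrite expf_neq0.
(* If s is the gauge sum of the cover, then H <= s / 2 and s < H + e, whence H < e. *)
rewrite nneseriesZl; last by move=> k _; exact: gauge_ge0.
move: sF hfin; case: (H (K `&` E i)) => [h||] //.
have s0 : (0 <= \sum_(k <oo) hausdorff_gauge m (F k))%E.
  by apply: nneseries_ge0 => k _ _; exact: gauge_ge0.
case: (\sum_(k <oo) _)%E s0 => [s||] //.
by rewrite -EFinD -EFinM !lee_fin !lte_fin => s0 h1 _ h2; lra.
Qed.

Lemma upper_density D : D `<=` U -> mu.-caratheodory D ->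
  mu (D `&` \bigcup_k lowdens (orestr mu D) m upper_const k.+1%:R^-1) = 0%E.
Proof.
move=> DU cD; rewrite setI_bigcupr; apply: outer_measure_bigcup0 => k.
have cl := lowdens_closed (mu := orestr mu D) (m := m) (t := upper_const)
  (e := k.+1%:R^-1).
apply: (radon_null_inner oU rmu).
- by move=> x [/DU].
- by apply: carathI => //; exact: closed_carath.
- move=> K cK Kl; have k0 : 0 < k.+1%:R^-1 :> R by rewrite invr_gt0.
  by apply: (lowdens_compact_null DU k0 cK) => x /Kl[].
Qed.

(** Every point of K has arbitrarily small balls in which D has mass at least e rho^m. For disjoint
    such balls whose threefold enlargements cover K, the gauge sum is at most alpha m 3^m / e times
    the mass of D near K. This mass is as small as desired, because K misses D. So K is Hausdorff
    null. *)
Lemma highdens_compact_null D K (e : R) : D `<=` U -> compact K ->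
  K `<=` U `\` D -> 0 < e ->
  (forall a k, K a -> ~ lowdens (orestr mu D) m e k.+1%:R^-1 a) -> mu K = 0%E.
Proof.
move=> DU cK KUD e0 Kh; have KU : K `<=` U by move=> x /KUD[].
apply: muH => // i; apply/eqP; rewrite eq_le outer_measure_ge0 andbT.
apply: (@le_trans _ _ (H K)); first by apply: le_outer_measure; exact: subIsetl.
apply: ge_ereal_sup => _ [d /= d0 <-].
apply/lee_addgt0Pr => eta eta0; rewrite add0e.
have alp := alpha_gt0 m : 0 < alpha m :> R.
(* The bound q on the mass of D in Op is chosen so that the final estimate is exactly eta. *)
pose q : R := eta * e / (alpha m * 3 ^+ m).
have q0 : 0 < q by rewrite divr_gt0 ?mulr_gt0// exprn_gt0.
have [Q [oQ KQ QU Qoo]] := radon_nbhd oU rmu cK KU.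
have cK' := closed_carath omu (compact_closed_rV cK).
have [K' [Op [[_ oO] K'K KO OQ Oq]]] := radon_approx oU rmu cK' KQ oQ QU Qoo q0.
have [r r0 rO] := thick_margin cK oO KO.
have nuO : (orestr mu D Op <= q%:E)%E.
  apply/ltW; apply: le_lt_trans Oq; apply: le_outer_measure => x [Ox Dx]; split => //.
  by move=> /K'K /KUD[].
(* Enlarged threefold, a ball of radius d / 6 has diameter at most d. *)
pose b := Num.min (d / 6) r.
have b0 : 0 < b by rewrite lt_min r0 divr_gt0.
have [k kb] : exists k : nat, k.+1%:R^-1 <= b.
  exists (Num.truncn b^-1); rewrite invf_ple ?posrE ?ltr0n//.
  exact: ltW (truncnS_gt _).
have [rho rhoP] : exists rho : 'rV[R]_n -> R, forall a, K a ->
    [/\ 0 < rho a, rho a <= b & ((e * rho a ^+ m)%:E <= orestr mu D (ecball a (rho a)))%E].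
  have h a : exists s, K a ->
      [/\ 0 < s, s <= b & ((e * s ^+ m)%:E <= orestr mu D (ecball a s))%E].
    have [Ka|nK] := pselect (K a); last by exists 0.
    have /existsNP[s /not_implyP[/andP[s0 sk] /negP]] := Kh a k Ka.
    rewrite -ltNge => /ltW hs; exists s => _; split => //.
    by apply: le_trans kb; exact: ltW.
  by have [f fP] := choice h; exists f.
have [s [sK Ks]] := compact_ecover cK (rho := rho) (fun a Ka => let: And3 h _ _ := rhoP a Ka in h).
have [s' [us' s's s'disj s'cov]] := finite_vitali s rho.
have s'K a : a \in s' -> K a by move=> /s's /sK.
(* [size_le_seq] asks for the diameter bound at every index, hence the truncation at b; at the
   selected centers the minimum is rho a. *)
apply: (@le_trans _ _ (\sum_(a <- s') hausdorff_gauge m (ecball a (3 * Num.min (rho a) b)))%E).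
  apply: size_le_seq.
    move=> x /Ks[a /s'cov[c cs' ac] xa]; exists (index c s').
    split; first by rewrite index_mem.
    move=> i0; rewrite nth_index// min_l; last by have [] := rhoP _ (s'K c cs').
    by apply: ac; exact: ltW.
  move=> a; apply: (le_trans (ediam_ecball _ _)); rewrite lee_fin.
  have : Num.min (rho a) b <= d / 6 by rewrite !ge_min lexx orbT.
  by lra.
apply: (@le_trans _ _ (\sum_(a <- s') (alpha m * 3 ^+ m / e)%:E *
   orestr mu D (ecball a (rho a)))%E).
  rewrite !big_seq; apply: lee_sum => a /s'K /rhoP[ra0 rab ra].
  rewrite min_l//; apply: (le_trans (gauge_ecball _ _ _)); first by rewrite mulr_ge0// ltW.
  apply: le_trans; last first.
    apply: lee_wpmul2l ra; rewrite lee_fin divr_ge0 ?(ltW e0)// mulr_ge0 ?(ltW alp)//.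
  rewrite -EFinM lee_fin exprMn le_eqVlt; apply/orP; left; apply/eqP.
  by field; rewrite gt_eqF.
rewrite -ge0_sume_distrr; last by move=> a _; exact: outer_measure_ge0.
apply: (@le_trans _ _ ((alpha m * 3 ^+ m / e)%:E * q%:E)%E); last first.
  rewrite -EFinM lee_fin /q le_eqVlt; apply/orP; left; apply/eqP; field.
  by rewrite !gt_eqF// exprn_gt0.
apply: lee_wpmul2l; first by rewrite lee_fin divr_ge0 ?(ltW e0)// mulr_ge0 ?(ltW alp).
apply: le_trans nuO; apply: (sum_disjoint_le us').
- move=> a _; apply: carath_orestr; apply: closed_carath => //; exact: ecball_closed.
- by move=> a c aD cD ac; apply: ecball_disjoint; exact: s'disj.
- move=> a /s'K Ka x xa; apply: rO; exists a => //; apply: (le_trans xa).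
  have [_ h _] := rhoP a Ka; apply: (le_trans h).
  by rewrite /b ge_min lexx orbT.
Qed.

Lemma zero_density D (e : R) : D `<=` U -> mu.-caratheodory D -> 0 < e ->
  mu ((U `\` D) `\` \bigcup_k lowdens (orestr mu D) m e k.+1%:R^-1) = 0%E.
Proof.
move=> DU cD e0; apply: (radon_null_inner oU rmu).
- by move=> x [[]].
- apply: carathDD; first by apply: carathDD => //; exact: omu.
  apply: caratheodory_measurable_bigcup => k; apply: closed_carath => //.
  exact: lowdens_closed.
- move=> K cK Kl; apply: (@highdens_compact_null D K e) => //.
    by move=> x /Kl[].
  by move=> a k /Kl[_ nl] la; apply: nl; exists k.
Qed.

End Densities.
Arguments upper_const {R} m.

(** * Monotonicity and isoperimetric inequality *)

Section HalfPower.
Context {R : realType}.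
Variable m : nat.
Implicit Types y t : R.

(* y ^ (- m / 2) *)
Definition hpow y : R := expR (- (m%:R / 2) * ln y).

Lemma hpow_gt0 y : 0 < hpow y. Proof. exact: expR_gt0. Qed.

Lemma hpow_sqr t : 0 < t -> hpow (t ^+ 2) = (t ^+ m)^-1.
Proof.
move=> t0; rewrite /hpow lnXn// -[ln t *+ 2]mulr_natl mulrA.
rewrite mulNr divfK// mulNr expRN expRM_natl lnK//.
Qed.

Lemma hpow_le y z : 0 < z -> z <= y -> hpow y <= hpow z.
Proof.
move=> z0 zy; rewrite /hpow ler_expR !mulNr lerN2 ler_wpM2l// ler_ln// posrE//.
exact: lt_le_trans zy.
Qed.

End HalfPower.

(** * Monotonicity inequality for the density ratio *)

Section Monotonicity.
Context {R : realType} {n m : nat} {mn : (m <= n)%N}.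
Notation G := (grassmannian R mn).
Variables (U : set 'rV[R]_n) (V : {outer_measure set ('rV[R]_n * G) -> \bar R}).
Hypotheses (m_gt0 : (0 < m)%N) (oU : open U) (oV : opens_carath V)
  (finV : forall K, compact K -> K `<=` U -> (weight V K < +oo)%E).
Local Notation T := (fvar V).
Local Notation lam := (ovar U T).
Implicit Types (a x : 'rV[R]_n).

Lemma fvar_additive : additive_on_tests U T.
Proof. by move=> g h tg th; exact: (fvarD oV finV tg th). Qed.

Lemma fvar_homogeneous : homogeneous_on_tests U T.
Proof. by move=> c g tg; exact: (fvarZ oV finV c tg). Qed.

Section MonotonicityField.
Variables (a : 'rV[R]_n) (r0 : R) (J : nat).
Hypotheses (r0_gt0 : 0 < r0) (aU : ecball a r0 `<=` U) (J_gt0 : (0 < J)%N).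

Let rk k : R := r0 / 2 ^+ k.
Let sg : R := rk J.

Let rk_gt0 k : 0 < rk k.
Proof. by rewrite divr_gt0// exprn_gt0. Qed.

Let rkS k : rk k.+1 = rk k / 2.
Proof. by rewrite /rk exprS invfM mulrA mulrAC. Qed.

Let rk_le k : rk k <= r0.
Proof. by rewrite /rk ler_pdivrMr ?exprn_gt0// ler_peMr ?(ltW r0_gt0)// exprn_ege1// ler1n. Qed.

(** Since J > 0, the inner ball lies where the cutoff at r0 is 1. *)
Let sg_half : sg <= r0 / 2.
Proof.
by case: J J_gt0 @sg => // j _ /=; rewrite rkS ler_pM2r ?invr_gt0//.
Qed.

Let q x : R := hpow m (sg ^+ 2 + sqdist a x).
Let f x : R := q x * bump a r0 x.
Let w x : 'rV[R]_n := f x *: (x - a).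

Let y_gt0 x : 0 < sg ^+ 2 + sqdist a x.
Proof. by rewrite ltr_wpDr ?sqdist_ge0// exprn_gt0// rk_gt0. Qed.

Let smooth_q : smooth q.
Proof.
move=> k; apply: Ckr_expR; apply: CkrM; first exact: Ckr_cst.
apply: Ckr_ln => //; apply: CkrD; [exact: Ckr_cst|exact: smooth_sqdist].
Qed.

Let smooth_f : smooth f.
Proof. by apply: smoothM => //; exact: smooth_bump. Qed.

Let q_le x t : 0 < t -> t ^+ 2 <= sg ^+ 2 + sqdist a x -> q x <= (t ^+ m)^-1.
Proof. by move=> t0 h; rewrite -hpow_sqr//; apply: hpow_le => //; rewrite exprn_gt0. Qed.

Let q_ge x t : 0 < t -> sg ^+ 2 + sqdist a x <= t ^+ 2 -> (t ^+ m)^-1 <= q x.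
Proof. by move=> t0 h; rewrite -hpow_sqr//; exact: hpow_le. Qed.

Let bump_ge0 r x : 0 <= bump a r x. Proof. exact: step_ge0. Qed.
Let bump_le1 r x : bump a r x <= 1. Proof. exact: step_le1. Qed.

Let test_w : test_field U w.
Proof.
apply: (@test_fieldP _ _ _ _ (ecball a r0)) => //; first exact: ecball_compact.
  move=> i k; apply: eq_Ckr (CkrM (smooth_f k) (CkrD (Ckr_coord k i)
    (Ckr_cst k (- a 0 i)))) => x.
  by rewrite !mxE.
move=> x nx; rewrite /w /f bump0 ?mulr0 ?scale0r//.
have {nx} : r0 < enorm (x - a) by rewrite ltNge; apply/negP.
by have := r0_gt0; lra.
Qed.

Let derive_q x v : 'D_v q x = - m%:R * q x / (sg ^+ 2 + sqdist a x) * edot v (x - a).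
Proof.
have dy : differentiable (fun z => sg ^+ 2 + sqdist a z) x.
  by apply: smooth_diff; apply: smoothD; [exact: smooth_cst|exact: smooth_sqdist].
have Dy : 'D_v (fun z => sg ^+ 2 + sqdist a z) x = 2 * edot v (x - a).
  rewrite (_ : (fun _ => _) = cst (sg ^+ 2) + sqdist a)//.
  rewrite deriveD ?derive_cst ?add0r ?derive_sqdist//.
  by apply: diff_derivable; apply: smooth_diff; exact: smooth_sqdist.
have [dl Dl] := derive_comp1 v dy (is_derive1_ln (y_gt0 x)).
have dl2 : differentiable ((- (m%:R / 2)) \*: (@ln R \o (fun z => sg ^+ 2 + sqdist a z))) x.
  exact: differentiableZ.
have [_] := derive_comp1 v dl2 (is_derive_expR (- (m%:R / 2) *
  ln (sg ^+ 2 + sqdist a x))).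
rewrite deriveZ; last exact: diff_derivable.
rewrite Dl Dy => /= ->; rewrite -/(hpow m (sg ^+ 2 + sqdist a x)) -/(q x) /(_ *: _)/=.
by field; rewrite gt_eqF// y_gt0.
Qed.

(** The divergence of x - a along S is the trace m of the projection; the derivatives of [q] and
    [bump] are taken along the projection of x - a, whose product with x - a is its squared norm. *)
Let integrand_w (p : 'rV[R]_n * G) : integrand w p =
  m%:R * f p.1 - m%:R * f p.1 / (sg ^+ 2 + sqdist a p.1) *
     enorm ((p.1 - a) *m gproj p.2) ^+ 2 +
  q p.1 * dstep (sqdist a p.1 / r0 ^+ 2) *
     (2 * enorm ((p.1 - a) *m gproj p.2) ^+ 2 / r0 ^+ 2).
Proof.
case: p => x S /=; rewrite /integrand /w /=.
have dxa : differentiable (fun y : 'rV[R]_n => y - a) x.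
  by apply: differentiableB => //; exact: differentiable_id.
rewrite pdiv_scale//; last exact: smooth_diff.
rewrite pdiv_id gproj_trace mulrC -addrA; congr (_ + _).
set v := (x - a) *m gproj S.
have vv : edot v (x - a) = enorm v ^+ 2 by rewrite edot_gproj.
have -> : 'D_v f x = q x * 'D_v (bump a r0) x + bump a r0 x * 'D_v q x.
  rewrite (_ : f = q * bump a r0)// deriveM//.
    by apply: diff_derivable; exact: smooth_diff.
  by apply: diff_derivable; apply: smooth_diff; exact: smooth_bump.
rewrite derive_q derive_bump vv /f.
by field; rewrite !gt_eqF ?y_gt0.
Qed.

(** On the ball of radius sg, [q] is at least (2 sg)^-m and sg^2 / (sg^2 + |x - a|^2) at least 1/2,
    which gives [mono_lo]. For [mono_hi], where the cutoff varies [q] is at most (r0 / 2)^-m, and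
    the derivative of the cutoff contributes at most 2 [Cstep]. *)
Definition mono_lo : R := m%:R / 2 ^+ m.+1.
Definition mono_hi : R := 2 * Cstep * 2 ^+ m.

Let integrand_w_ge (p : 'rV[R]_n * G) : mono_lo / sg ^+ m * \1_(ecball a sg) p.1 -
  mono_hi / r0 ^+ m * \1_(ecball a r0) p.1 <= integrand w p.
Proof.
rewrite integrand_w; case: p => x S /=; set v := (x - a) *m gproj S.
have C0 : 0 <= Cstep :> R := Cstep_ge0.
have vs : enorm v ^+ 2 <= sqdist a x.
  by rewrite sqdistE lerXn2r ?nnegrE ?enorm_ge0// enorm_gproj.
have v0 : 0 <= enorm v ^+ 2 by exact: sqr_ge0.
have y0 := y_gt0 x; have q0 : 0 < q x := hpow_gt0 _ _.
have s0 := sqdist_ge0 a x.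
have f0 : 0 <= f x by rewrite mulr_ge0// ltW.
have sg0 : 0 < sg := rk_gt0 J.
have m0 : 0 <= m%:R :> R by [].
have hi0 : 0 <= mono_hi / r0 ^+ m.
  by rewrite divr_ge0 ?exprn_ge0 ?(ltW r0_gt0)// mulr_ge0 ?exprn_ge0// mulr_ge0.
(* The tangential part of x - a is no longer than x - a. So these terms are nonnegative, and the
   cutoff alone can contribute negatively. *)
have first_ge : m%:R * f x * (sg ^+ 2 / (sg ^+ 2 + sqdist a x)) <=
    m%:R * f x - m%:R * f x / (sg ^+ 2 + sqdist a x) * enorm v ^+ 2.
  have -> : m%:R * f x * (sg ^+ 2 / (sg ^+ 2 + sqdist a x)) =
      m%:R * f x - m%:R * f x / (sg ^+ 2 + sqdist a x) * sqdist a x.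
    by field; rewrite gt_eqF.
  by rewrite lerD2l lerN2 ler_wpM2l// divr_ge0 ?(ltW y0)// mulr_ge0.
rewrite !indicE; have [xs|xs] := leP (enorm (x - a)) sg.
  have xr : enorm (x - a) <= r0 / 2 := le_trans xs sg_half.
  rewrite (_ : x \in ecball a sg) ?mulr1; last by rewrite inE.
  rewrite (_ : x \in ecball a r0) ?mulr1; last first.
    by rewrite inE /ecball/=; apply: (le_trans xr); have := r0_gt0; lra.
  have sq : sqdist a x <= sg ^+ 2.
    by rewrite sqdistE lerXn2r ?nnegrE ?enorm_ge0// ltW.
  rewrite dstep_eq0; last first.
    left; rewrite ler_pdivrMr ?exprn_gt0// sqdistE.
    by have := enorm_ge0 (x - a); nra.
  rewrite mulr0 mul0r addr0.
  apply: (@le_trans _ _ (mono_lo / sg ^+ m)); first by rewrite gerBl.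
  apply: (le_trans _ first_ge).
  have fq : f x = q x by rewrite /f bump1 ?mulr1.
  have q1 : ((2 * sg) ^+ m)^-1 <= q x by apply: q_ge; [rewrite mulr_gt0|nra].
  have h2 : 1 / 2 <= sg ^+ 2 / (sg ^+ 2 + sqdist a x).
    by rewrite ler_pdivlMr//; lra.
  have -> : mono_lo / sg ^+ m = m%:R * ((2 * sg) ^+ m)^-1 * (1 / 2).
    rewrite /mono_lo exprS [(2 * sg) ^+ m]exprMn; field.
    by rewrite !expf_neq0// gt_eqF.
  rewrite fq; apply: ler_pM => //; last by rewrite ler_wpM2l.
  by rewrite mulr_ge0// invr_ge0 exprn_ge0// mulr_ge0// ltW.
rewrite (_ : (x \in ecball a sg) = false) ?mulr0 ?sub0r; last first.
  by apply/negbTE; rewrite notin_setE /ecball/=; apply/negP; rewrite -ltNge.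
have fst0 : 0 <= m%:R * f x * (sg ^+ 2 / (sg ^+ 2 + sqdist a x)).
  by apply: mulr_ge0; [exact: mulr_ge0|rewrite divr_ge0 ?sqr_ge0 ?(ltW y0)].
have fst1 := le_trans fst0 first_ge.
rewrite -[leLHS]add0r; apply: lerD => //.
have [h|h] := leP (sqdist a x / r0 ^+ 2) (1 / 4).
  by rewrite dstep_eq0; [rewrite mulr0 mul0r oppr_le0 mulr_ge0|left].
have [h'|h'] := leP (1 / 2) (sqdist a x / r0 ^+ 2).
  by rewrite dstep_eq0; [rewrite mulr0 mul0r oppr_le0 mulr_ge0|right].
have sr : sqdist a x <= r0 ^+ 2.
  by move: h'; rewrite ltr_pdivrMr ?exprn_gt0//; have := sqr_ge0 r0; lra.
have xr : enorm (x - a) <= r0.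
  by move: sr; rewrite sqdistE ler_sqr ?nnegrE ?enorm_ge0// ltW.
rewrite (_ : x \in ecball a r0) ?mulr1; last by rewrite inE.
have q1 : q x <= ((r0 / 2) ^+ m)^-1.
  apply: q_le; first by rewrite divr_gt0.
  by move: h; rewrite ltr_pdivlMr ?exprn_gt0//; have := sqr_ge0 sg; nra.
have d1 : - Cstep <= dstep (sqdist a x / r0 ^+ 2) by exact: dstep_ge.
have d2 : dstep (sqdist a x / r0 ^+ 2) <= 0 by exact: dstep_le0.
have e1 : enorm v ^+ 2 / r0 ^+ 2 <= 1.
  by rewrite ler_pdivrMr ?exprn_gt0// mul1r (le_trans vs).
have e0 : 0 <= enorm v ^+ 2 / r0 ^+ 2 by rewrite divr_ge0// sqr_ge0.
have -> : mono_hi / r0 ^+ m = ((r0 / 2) ^+ m)^-1 * Cstep * 2.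
  rewrite /mono_hi expr_div_n; field.
  by rewrite ?expf_neq0// gt_eqF// ?exprn_gt0.
have key : q x * - dstep (sqdist a x / r0 ^+ 2) * (2 * (enorm v ^+ 2 / r0 ^+ 2)) <=
    ((r0 / 2) ^+ m)^-1 * Cstep * 2.
  have nd0 : 0 <= - dstep (sqdist a x / r0 ^+ 2) by rewrite oppr_ge0.
  apply: ler_pM; [exact: mulr_ge0 (ltW q0) nd0|exact: mulr_ge0| |].
    by apply: ler_pM; [exact: ltW|by []|by []|rewrite lerNl].
  by rewrite -[leRHS]mulr1 ler_wpM2l.
by rewrite lerNl; apply: le_trans key; rewrite mulrN mulNr !mulrA.
Qed.

Let eta k x : R := if k is 0 then 1 else bump a (rk k) x.

Let piece_bound k x (e : R) : 0 <= e <= 1 -> rk k / 4 <= enorm (x - a) <= rk k ->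
  e * enorm (w x) <= 4 ^+ m * rk k / rk k ^+ m.
Proof.
move=> /andP[e0 e1] /andP[h1 h2]; rewrite /w enormZ /f.
have r4 : 0 < rk k / 4 by rewrite divr_gt0.
have q1 : q x <= ((rk k / 4) ^+ m)^-1.
  apply: q_le => //; rewrite sqdistE -[leLHS]add0r lerD ?sqr_ge0//.
  by rewrite lerXn2r ?nnegrE ?enorm_ge0// ltW.
have q0 : 0 <= q x by exact: ltW (hpow_gt0 _ _).
have b0 := bump_ge0 r0 x; have b1 := bump_le1 r0 x.
rewrite (ger0_norm (mulr_ge0 q0 b0)).
have -> : 4 ^+ m * rk k / rk k ^+ m = 1 * (((rk k / 4) ^+ m)^-1 * 1 * rk k).
  rewrite [(rk k / 4) ^+ m]expr_div_n; have := rk_gt0 k.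
  move: (rk k) => r rr; field.
  by rewrite !expf_neq0// gt_eqF.
have rm0 : 0 <= ((rk k / 4) ^+ m)^-1 by rewrite invr_ge0 exprn_ge0// ltW.
have qb0 : 0 <= q x * bump a r0 x by exact: mulr_ge0.
have x0 := enorm_ge0 (x - a).
apply: ler_pM; [by []|exact: mulr_ge0|by []|].
by apply: ler_pM; [by []|by []|exact: ler_pM|by []].
Qed.

(* The first variation is tested on the field
   (sg ^ 2 + |x - a| ^ 2) ^ (- m / 2) (x - a), cut off at distance r0 and sliced
   into the dyadic annuli around a. *)
Lemma monotonicity :
  ((mono_lo / sg ^+ m * fine (weight V (ecball a sg)) -
    mono_hi / r0 ^+ m * fine (weight V (ecball a r0)))%:E <=
   \sum_(k < J.+1) (4 ^+ m * rk k / rk k ^+ m)%:E * lam (eoball a (rk k)))%E.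
Proof.
have wfin r : r <= r0 -> (weight V (ecball a r) < +oo)%E.
  move=> rr; apply: finV; first exact: ecball_compact.
  by apply: subset_trans aU; apply: ecball_sub; rewrite subrr enorm0 add0r.
have lo := fvar_lower oV finV test_w (ecball_closed (a := a) (r := sg))
  (ecball_closed (a := a) (r := r0)) (wfin _ (rk_le J)) (wfin _ (lexx _)) integrand_w_ge.
apply: (@le_trans _ _ (T w)%:E); first by rewrite lee_fin.
have w1 : w = (fun x => eta 0 x *: w x) by apply/funext => x; rewrite scale1r.
rewrite {1}w1.
have far k x : 3 / 4 * rk k <= enorm (x - a) -> eta k x *: w x = 0.
  case: k => [|k] h; last by rewrite /eta bump0// ?scale0r.
  rewrite /eta /w /f bump0 ?mulr0 ?scale0r ?scaler0//.
  by move: h; rewrite /rk expr0 divr1.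
have close k x : enorm (x - a) <= rk k / 2 -> eta k x = 1.
  by case: k => [//|k] h; rewrite /eta bump1.
have eta01 k x : 0 <= eta k x <= 1.
  by case: k => [|k] /=; rewrite ?ler01 ?lexx// bump_ge0 bump_le1.
have suppk k (e : 'rV[R]_n -> R) :
    (forall x, 3 / 4 * rk k <= enorm (x - a) -> e x *: w x = 0) ->
    fsupport (fun x => e x *: w x) `<=` eoball a (rk k).
  move=> he; apply: (@subset_trans _ (ecball a (3 / 4 * rk k))).
    apply: fsupport_sub; first exact: ecball_closed.
    move=> x nx; apply: he; apply/ltW; rewrite ltNge; apply/negP; exact: nx.
  by apply: ecball_sub_eoball; have := rk_gt0 k; lra.
apply: (T_telescope fvar_additive fvar_homogeneous (eta := eta)
   (u := w) (c := fun k => 4 ^+ m * rk k / rk k ^+ m)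
   (G := fun k => eoball a (rk k)) (J := J)) => //.
- by case=> [|k]; [exact: smooth_cst|exact: smooth_bump].
- by move=> k; rewrite divr_ge0 ?exprn_ge0 ?(ltW (rk_gt0 _))// mulr_ge0 ?exprn_ge0// ltW.
- move=> k x; have c0 : 0 <= 4 ^+ m * rk k / rk k ^+ m.
    by rewrite divr_ge0 ?exprn_ge0 ?(ltW (rk_gt0 _))// mulr_ge0 ?exprn_ge0// ltW.
  have [h|h] := leP (3 / 4 * rk k) (enorm (x - a)).
    have h' : 3 / 4 * rk k.+1 <= enorm (x - a).
      by apply: le_trans h; rewrite rkS; have := rk_gt0 k; lra.
    by rewrite -enormZ scalerBl (far k x h) (far k.+1 x h') subrr enorm0.
  have [h2|h2] := leP (enorm (x - a)) (rk k / 4).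
    rewrite !close ?subrr ?normr0 ?mul0r//; first by rewrite rkS; lra.
    by have := rk_gt0 k; lra.
  apply: piece_bound; last by have := rk_gt0 k; lra.
  have /andP[? ?] := eta01 k x; have /andP[? ?] := eta01 k.+1 x.
  by rewrite normr_ge0 ler_norml; lra.
- move=> k; apply: suppk => x h.
  rewrite scalerBl far// far ?subrr//; apply: le_trans h.
  by rewrite rkS; have := rk_gt0 k; lra.
- move=> x; have /andP[e0 e1] := eta01 J x; rewrite ger0_norm//.
  have [h|h] := leP (3 / 4 * rk J) (enorm (x - a)).
    have := far J x h; rewrite -[eta J x * _](_ : enorm (eta J x *: w x) = _).
      by move=> ->; rewrite enorm0 divr_ge0 ?exprn_ge0 ?(ltW (rk_gt0 _))// mulr_ge0 ?exprn_ge0// ltW.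
    by rewrite enormZ ger0_norm.
  rewrite /w enormZ /f.
  have q0 : 0 <= q x by exact: ltW (hpow_gt0 _ _).
  have q1 : q x <= (sg ^+ m)^-1 by apply: q_le; [exact: rk_gt0|rewrite lerDl sqdist_ge0].
  have b0 := bump_ge0 r0 x; have b1 := bump_le1 r0 x.
  rewrite (ger0_norm (mulr_ge0 q0 b0)).
  apply: (@le_trans _ _ (1 * ((sg ^+ m)^-1 * 1 * rk J))).
    have qb0 : 0 <= q x * bump a r0 x by exact: mulr_ge0.
    have x0 := enorm_ge0 (x - a).
    apply: ler_pM; [by []|exact: mulr_ge0|by []|].
    apply: ler_pM; [by []|by []|exact: ler_pM|].
    by have := rk_gt0 J; lra.
  have := rk_gt0 J; rewrite mul1r mulr1 /sg; move: (rk J) => r rr.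
  rewrite [leLHS]mulrC -[leRHS]mulrA ler_peMl//.
    by rewrite divr_ge0 ?exprn_ge0 ?(ltW rr).
  by rewrite exprn_ege1// ler1n.
- by apply: suppk; exact: far.
Qed.

End MonotonicityField.
End Monotonicity.
Arguments mono_lo {R} m.
Arguments mono_hi {R} m.

Lemma sum_half_pow {R : realType} (N : nat) : \sum_(k < N) (2 ^+ k)^-1 <= 2 :> R.
Proof.
suff -> : \sum_(k < N) (2 ^+ k)^-1 = 2 - 2 / 2 ^+ N :> R.
  by rewrite gerBl divr_ge0// exprn_ge0.
elim: N => [|N IH]; first by rewrite big_ord0 expr0 divr1 subrr.
rewrite big_ord_recr/= IH exprS; field.
by rewrite expf_neq0.
Qed.

(** * Local isoperimetric estimate *)

Section Isoperimetric.
Context {R : realType} {n m : nat} {mn : (m <= n)%N}.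
Notation G := (grassmannian R mn).
Variables (U : set 'rV[R]_n) (V : {outer_measure set ('rV[R]_n * G) -> \bar R}).
Hypotheses (m_gt0 : (0 < m)%N) (oU : open U) (oV : opens_carath V)
  (finV : forall K, compact K -> K `<=` U -> (weight V K < +oo)%E).
Local Notation lam := (ovar U (fvar V)).
Local Notation nu := (weight V).
Local Notation lo := (mono_lo m : R).
Local Notation hi := (mono_hi m : R).

(** Chosen so that A = [iso_small] (1 + 2 hi / lo), the bound propagated over all dyadic scales,
    equals [upper_const] / 2^(m+1), which contradicts the upper density. *)
Definition iso_small : R :=
  upper_const m / 2 ^+ m / (2 * (1 + 2 * mono_hi m / mono_lo m)).

(** The base 32 is 4 * 8, with 4 from the slices of the monotonicity field and 8 from the ratio of
    the radii of the two balls compared; the factor 4 / lo makes the variation terms add up to at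
    most lo A / 2. *)
Definition iso_const : R := 4 * 32 ^+ m / mono_lo m.

Let lo_gt0 : 0 < lo.
Proof. by rewrite divr_gt0 ?ltr0n// exprn_gt0. Qed.

Let hi_ge0 : 0 <= hi.
Proof. by rewrite mulr_ge0 ?exprn_ge0// mulr_ge0// Cstep_ge0. Qed.

Let den_gt0 : 0 < 1 + 2 * hi / lo.
Proof. by rewrite ltr_wpDr// divr_ge0 ?(ltW lo_gt0)// mulr_ge0. Qed.

Lemma iso_small_gt0 : 0 < iso_small.
Proof.
rewrite divr_gt0 ?(mulr_gt0 _ den_gt0)// divr_gt0 ?exprn_gt0//.
exact: upper_const_gt0.
Qed.

Lemma iso_const_gt0 : 0 < iso_const.
Proof. by rewrite divr_gt0// mulr_gt0// exprn_gt0. Qed.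

(* If mass is small at scale rho0 and the upper density is large, then the
   density ratio must drop somewhere below rho0, which the monotonicity formula
   only allows if the first variation is large at some scale. *)
Lemma isoperimetric_ball (a : 'rV[R]_n) (rho0 : R) : 0 < rho0 ->
  ecball a (8 * rho0) `<=` U ->
  (forall r, rho0 <= r <= 8 * rho0 -> (nu (ecball a r) <= (iso_small * r ^+ m)%:E)%E) ->
  (forall d, 0 < d -> exists r, 0 < r < d /\
     ((upper_const m * r ^+ m)%:E < nu (ecball a r))%E) ->
  exists rho, 0 < rho <= rho0 /\
    (nu (ecball a (8 * rho)) <= (iso_const * rho0)%:E * lam (eoball a rho))%E.
Proof.
move=> r0 aU small dens; apply: contrapT => /forallNP neg.
(* The ball of radius r k has 8 times the radius rho0 / 2^k = r (k + 3) at which the variation is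
   measured. *)
pose r k : R := 8 * rho0 / 2 ^+ k.
pose b k := fine (nu (ecball a (r k))).
have rk0 k : 0 < r k by rewrite divr_gt0 ?exprn_gt0// mulr_gt0.
have rkS k : r k.+1 = r k / 2 by rewrite /r exprS invfM mulrA mulrAC.
have rk3 k : r k.+3 = rho0 / 2 ^+ k.
  by rewrite /r !exprS; field; rewrite expf_neq0.
have rk_le k : r k <= 8 * rho0.
  by rewrite /r ler_pdivrMr ?exprn_gt0// ler_peMr ?mulr_ge0 ?(ltW r0)// exprn_ege1// ler1n.
have nufin k : nu (ecball a (r k)) \is a fin_num.
  apply: outer_measure_fin; apply: finV; first exact: ecball_compact.
  by apply: subset_trans aU; apply: ecball_sub; rewrite subrr enorm0 add0r.
have b0 k : 0 <= b k by rewrite fine_ge0// outer_measure_ge0.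
have cL := iso_const_gt0.
(* The negated conclusion at rho = rho0 / 2^k bounds the variation by the mass; it also excludes
   infinite variation, for which the conclusion would hold. *)
have lamfin k : lam (eoball a (rho0 / 2 ^+ k)) \is a fin_num /\
    fine (lam (eoball a (rho0 / 2 ^+ k))) <= b k / (iso_const * rho0).
  have := neg (rho0 / 2 ^+ k); move=> /not_andP[[]|].
    rewrite divr_gt0 ?exprn_gt0// ler_pdivrMr ?exprn_gt0//.
    by rewrite ler_peMr ?(ltW r0)// exprn_ege1// ler1n.
  have -> : 8 * (rho0 / 2 ^+ k) = r k by rewrite /r mulrA.
  move=> /negP; rewrite -ltNge -(fineK (nufin k)) -/(b k).
  have := ovar_ge0 (fvar_homogeneous oV finV) (eoball a (rho0 / 2 ^+ k)).
  have Lr : 0 < iso_const * rho0 by rewrite mulr_gt0.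
  case: (lam _) => [l||] //= _; last by rewrite gt0_muley ?lte_fin// ltNge leey.
  rewrite -EFinM lte_fin => h; split => //.
  by rewrite ler_pdivlMr// mulrC ltW.
pose phi k := b k / r k ^+ m.
have phi0 k : 0 <= phi k by rewrite divr_ge0// exprn_ge0// ltW.
pose A : R := iso_small * (1 + 2 * hi / lo).
have A0 : 0 < A by rewrite mulr_gt0// iso_small_gt0.
have smallA : iso_small <= A.
  rewrite /A ler_peMr ?(ltW iso_small_gt0)// lerDl.
  by rewrite divr_ge0 ?(ltW lo_gt0)// mulr_ge0.
have base k : (k <= 3)%N -> phi k <= iso_small.
  move=> k3; rewrite /phi ler_pdivrMr ?exprn_gt0//.
  rewrite -lee_fin /b fineK//; apply: small; rewrite rk_le andbT.
  rewrite -(divr1 rho0) -[X in _ / X](expr0 2) -rk3 /r ler_pM2l ?mulr_gt0//.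
  by rewrite lef_pV2 ?posrE ?exprn_gt0// ler_eXn2l// ltr1n.
(* Strong induction on the scale. In the monotonicity inequality between rho0 / 2^J and rho0, the
   variation at scale k <= J is bounded by the mass at radius r k, whose ratio is at most A by
   induction. With lo A / 2 from these terms and hi [iso_small] from the outer ball, the ratio at
   index J + 3 stays at most A. *)
have phiA k : phi k <= A.
  elim/ltn_ind: k => k IH; have [k3|] := leqP k 3.
    exact: le_trans (base k k3) smallA.
  case: k IH => [//|[//|[//|J]]] IH; rewrite !ltnS => J0.
  have aU' : ecball a rho0 `<=` U.
    by apply: subset_trans aU; apply: ecball_sub; rewrite subrr enorm0 add0r; lra.
  have := monotonicity oV finV r0 aU' J0.
  have sum_le : \sum_(k < J.+1) 4 ^+ m * (rho0 / 2 ^+ k) / (rho0 / 2 ^+ k) ^+ m *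
      fine (lam (eoball a (rho0 / 2 ^+ k))) <= 32 ^+ m / iso_const * A * 2.
    apply: (@le_trans _ _ (\sum_(k < J.+1) 32 ^+ m / iso_const * A * (2 ^+ k)^-1)).
      apply: ler_sum => k _; have [_ lk] := lamfin k.
      have IHk : phi k <= A by apply: IH; apply: (leq_trans (ltn_ord k)); rewrite -addn2 leq_addr.
      have rr : 0 < rho0 / 2 ^+ k by rewrite divr_gt0// exprn_gt0.
      apply: (@le_trans _ _ (4 ^+ m * (rho0 / 2 ^+ k) / (rho0 / 2 ^+ k) ^+ m *
          (b k / (iso_const * rho0)))).
        have c4 : 0 <= 4 ^+ m :> R by exact: exprn_ge0.
        rewrite ler_wpM2l//; apply: divr_ge0; last by apply: exprn_ge0; exact: ltW.
        by apply: mulr_ge0 => //; exact: ltW.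
      have -> : 4 ^+ m * (rho0 / 2 ^+ k) / (rho0 / 2 ^+ k) ^+ m *
          (b k / (iso_const * rho0)) = 32 ^+ m / iso_const * (2 ^+ k)^-1 * phi k.
        have e32 : 32 = 4 * 8 :> R by rewrite -natrM.
        rewrite /phi (_ : r k = 8 * (rho0 / 2 ^+ k)); last by rewrite /r mulrA.
        have : (2 ^+ k)^-1 = rho0 / 2 ^+ k / rho0.
          by field; rewrite expf_neq0 ?gt_eqF.
        move: rr; set s := rho0 / 2 ^+ k => s0 ->; move: s s0 => s s0.
        rewrite e32 !exprMn; field.
        by rewrite !expf_neq0 ?gt_eqF.
      rewrite [leRHS]mulrAC ler_wpM2l// mulr_ge0 ?invr_ge0 ?exprn_ge0//.
      by rewrite divr_ge0 ?exprn_ge0// ltW.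
    rewrite -mulr_sumr ler_wpM2l ?sum_half_pow// mulr_ge0 ?(ltW A0)//.
    by rewrite divr_ge0 ?exprn_ge0// ltW.
  rewrite (eq_bigr (fun k : 'I_J.+1 => (4 ^+ m * (rho0 / 2 ^+ k) / (rho0 / 2 ^+ k) ^+ m *
      fine (lam (eoball a (rho0 / 2 ^+ k))))%:E)); last first.
    by move=> k _; have [lf _] := lamfin k; rewrite [RHS]EFinM fineK.
  rewrite sumEFin lee_fin => /le_trans/(_ sum_le).
  have bJ : fine (nu (ecball a (rho0 / 2 ^+ J))) = b J.+3 by rewrite /b rk3.
  have b3 : fine (nu (ecball a rho0)) = b 3%N by rewrite /b rk3 expr0 divr1.
  rewrite bJ b3 => ineq.
  have e1 : lo * phi J.+3 = lo / (rho0 / 2 ^+ J) ^+ m * b J.+3.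
    by rewrite /phi rk3 mulrA mulrAC.
  have e2 : hi * phi 3%N = hi / rho0 ^+ m * b 3%N.
    by rewrite /phi rk3 expr0 divr1 mulrA mulrAC.
  have e3 : 32 ^+ m / iso_const * A * 2 = lo * A / 2.
    rewrite /iso_const; field.
    by rewrite !gt_eqF// expf_neq0.
  have p3 : hi * phi 3%N <= hi * iso_small by rewrite ler_wpM2l// base.
  have e4 : lo * A / 2 = lo * iso_small / 2 + hi * iso_small.
    by rewrite /A; field; rewrite gt_eqF.
  have : lo * phi J.+3 <= lo * A.
    have : 0 < lo * iso_small by rewrite mulr_gt0// iso_small_gt0.
    by move: ineq; rewrite -e1 -e2 e3; lra.
  by rewrite ler_pM2l.
(* A radius s of large density lies between consecutive dyadic radii; rounding it up to r k costs a
   factor 2^m, and the ratio there still exceeds A. *)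
have [s [/andP[s0 sr] hs]] := dens _ (rk0 0%N).
have exk : exists k, r k.+1 < s.
  have [k hk] : exists k : nat, 8 * rho0 / s < k%:R.
    by exists (Num.truncn (8 * rho0 / s)).+1; exact: truncnS_gt.
  exists k; rewrite /r ltr_pdivrMr ?exprn_gt0// [ltRHS]mulrC -ltr_pdivrMr//.
  apply: (lt_le_trans hk); rewrite -natrX ler_nat.
  by rewrite (leq_trans _ (ltn_expl _ _))// ltnW.
case: (ex_minnP exk) => k ks kmin.
have sk : s <= r k.
  case: k ks kmin => [|k] ks kmin; first exact: ltW.
  rewrite leNgt; apply/negP => /kmin; by rewrite ltnn.
have : upper_const m * s ^+ m < b k.
  rewrite -lte_fin /b fineK//; apply: (lt_le_trans hs); apply: le_outer_measure.
  by apply: ecball_sub; rewrite subrr enorm0 add0r.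
have : upper_const m * (r k / 2) ^+ m <= upper_const m * s ^+ m.
  apply: ler_wpM2l; first exact: (ltW upper_const_gt0).
  apply: lerXn2r; rewrite ?nnegrE ?(ltW s0)//; first by rewrite divr_ge0// ltW.
  by rewrite -rkS ltW.
have := phiA k; rewrite /phi ler_pdivrMr ?exprn_gt0// => h1 h2 h3.
have : upper_const m * (r k / 2) ^+ m <= A * r k ^+ m by lra.
have -> : A = upper_const m / 2 ^+ m / 2.
  rewrite /A /iso_small; field.
  by rewrite expf_neq0// !gt_eqF// ltr_wpDr// mulr_ge0.
rewrite expr_div_n.
have : 0 < upper_const m * (r k ^+ m / 2 ^+ m).
  by rewrite mulr_gt0 ?upper_const_gt0// divr_gt0// exprn_gt0.
have -> : upper_const m / 2 ^+ m / 2 * r k ^+ m =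
  upper_const m * (r k ^+ m / 2 ^+ m) / 2.
  by field; rewrite expf_neq0.
by lra.
Qed.

End Isoperimetric.
Arguments iso_small {R} m.
Arguments iso_const {R} m.

(** * The variation of a restricted varifold *)

Section VariationNull.
Context {R : realType} {n m : nat} {mn : (m <= n)%N}.
Notation G := (grassmannian R mn).
Local Notation H := (hausdorff m : {outer_measure set 'rV[R]_n -> \bar R}).
Variables (U : set 'rV[R]_n) (V : {outer_measure set ('rV[R]_n * G) -> \bar R})
  (E : nat -> set 'rV[R]_n) (M : {outer_measure set 'rV[R]_n -> \bar R})
  (D : set 'rV[R]_n).
Hypotheses (m_gt0 : (0 < m)%N) (oU : open U) (vV : varifold U V)
  (Hmu : forall X i, X `<=` U -> (H (X `&` E i) <= weight V X)%E)
  (muH : forall K, compact K -> K `<=` U -> (forall i, H (K `&` E i) = 0%E) ->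
     weight V K = 0%E)
  (rM : radon U M) (acM : forall A, A `<=` U -> weight V A = 0%E -> M A = 0%E)
  (DU : D `<=` U) (cD : (weight V).-caratheodory D) (cMD : M.-caratheodory D).
Local Notation W := (vrestr V D).
Local Notation T := (fvar W).
Local Notation lam := (ovar U T).
Variable N : {outer_measure set 'rV[R]_n -> \bar R}.
Hypotheses (NM : forall A, A `<=` U -> (N A <= M A)%E)
  (hN : has_variation U T N).

Let rmu : radon U (weight V) := radon_weight oU vV.
Let omu : opens_carath (weight V : {outer_measure set 'rV[R]_n -> \bar R}) :=
  radon_opens_carath oU rmu.
Let oM : opens_carath M := radon_opens_carath oU rM.

Let oW : opens_carath W.
Proof. exact: opens_carath_orestr (varifold_opens_carath oU vV). Qed.

Let finW K : compact K -> K `<=` U -> (weight W K < +oo)%E.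
Proof. exact: weight_vrestr_fin. Qed.

Let TD := fvar_additive oW finW.
Let TZ := fvar_homogeneous oW finW.

Let NE Q : open Q -> Q `<=` U -> N Q = lam Q.
Proof. by have [_ h] := hN; exact: h. Qed.

Let oN : opens_carath N.
Proof.
have [[N0 No _] _] := hN; move=> Q oQ; rewrite -(setUIDK Q U).
apply: caratheodory_measurable_setU.
  by apply: No; [exact: openI|exact: subIsetr].
by apply: carath_null; apply: outer_measure_le0 N0 => x [].
Qed.

(** Almost all of D by [upper_density]. These are the points at which the density hypothesis of
    [isoperimetric_ball] holds. *)
Let good : set 'rV[R]_n :=
  D `\` \bigcup_k lowdens (orestr (weight V) D) m (upper_const m) k.+1%:R^-1.

Let good_dens x : good x -> forall d, 0 < d -> exists r, 0 < r < d /\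
  ((upper_const m * r ^+ m)%:E < weight W (ecball x r))%E.
Proof.
move=> [Dx nx] d d0.
have [k kd] : exists k : nat, k.+1%:R^-1 <= d.
  exists (Num.truncn d^-1); rewrite invf_ple ?posrE ?ltr0n//.
  exact: ltW (truncnS_gt _).
have : ~ lowdens (orestr (weight V) D) m (upper_const m) k.+1%:R^-1 x.
  by move=> lx; apply: nx; exists k.
move=> /existsNP[r /not_implyP[/andP[r0 rk] /negP]]; rewrite -ltNge => h.
by exists r; rewrite r0 (lt_le_trans rk)// weight_vrestr.
Qed.

(* The isoperimetric estimate summed over a Vitali cover. *)
Let weight_thick K Q (theta r r1 : R) : compact K -> open Q -> Q `<=` U ->
  0 < theta <= 1 / 8 -> 0 < r -> 4 * r < r1 -> thick K (4 * r) `<=` Q ->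
  K `<=` lowdens (orestr (weight V) D) m (iso_small m * (theta / 4) ^+ m) r1 ->
  (weight W (thick K (3 * r)) <= (iso_const m * (theta * r))%:E * N Q)%E.
Proof.
move=> cK oQ QU /andP[th0 th8] r0 rr1 KQ Kl.
have rho0 : 0 < theta * r by rewrite mulr_gt0.
have ballQ x s : thick K (3 * r) x -> s <= r -> ecball x s `<=` Q.
  move=> [a Ka xa] sr; apply: subset_trans KQ => y yx; exists a => //.
  by apply: (le_trans (enorm_triangleB y x a)); move: yx; rewrite /ecball/=; lra.
have th8r : 8 * (theta * r) <= r by nra.
pose P x s := 0 < s <= theta * r /\ (weight W (ecball x (8 * s)) <=
  (iso_const m * (theta * r))%:E * lam (eoball x s))%E.
pose B := thick K (3 * r) `&` good.
have [rho rhoP] : exists rho : 'rV[R]_n -> R, forall x, B x -> P x (rho x).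
  have h x : exists s, B x -> P x s.
    have [[xK gx]|nB] := pselect (B x); last by exists 0.
    have [||s sP] := isoperimetric_ball m_gt0 oW finW rho0 _ _ (good_dens gx).
    - by apply: subset_trans QU; exact: ballQ.
    (* For s at most 8 theta r <= r, the ball around x lies in the ball of radius 4 r around a point
       of K. The factor (theta / 4)^m in the low density hypothesis turns (4 r)^m into (theta r)^m,
       which is at most s^m. *)
    - move=> s /andP[s1 s2]; have [a Ka xa] := xK.
      have := Kl a Ka (4 * r); rewrite mulr_gt0// rr1 => /(_ isT) hl.
      apply: (@le_trans _ _ (weight W (ecball a (4 * r)))).
        by apply: le_outer_measure; apply: ecball_sub; lra.
      rewrite weight_vrestr; apply: (le_trans hl); rewrite lee_fin.
      have -> : iso_small m * (theta / 4) ^+ m * (4 * r) ^+ m =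
          iso_small m * (theta * r) ^+ m.
        by rewrite -mulrA -exprMn; congr (_ * _ ^+ _); field.
      apply: ler_wpM2l; first exact: (ltW (iso_small_gt0 m_gt0)).
      by apply: lerXn2r; rewrite ?nnegrE ?(ltW rho0)// (le_trans (ltW rho0)).
    by exists s.
  by have [f fP] := choice h; exists f.
have cthick : compact (thick K (3 * r)) by exact: thick_compact.
have thU : thick K (3 * r) `<=` U.
  apply: subset_trans QU; apply: subset_trans KQ => x [a Ka xa].
  by exists a => //; apply: (le_trans xa); lra.
have cgood : (weight V).-caratheodory good.
  apply: carathDD => //; apply: caratheodory_measurable_bigcup => k.
  by apply: closed_carath => //; exact: lowdens_closed.
have cB : (weight V).-caratheodory B.
  by apply: carathI => //; apply: closed_carath => //; exact: compact_closed_rV.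
have nullB : (weight W (thick K (3 * r)) <= weight V B)%E.
  rewrite weight_vrestr; apply: (@le_trans _ _ (weight V B + weight V (D `&` \bigcup_k
      lowdens (orestr (weight V) D) m (upper_const m) k.+1%:R^-1))%E).
    apply: le_trans; last exact: outer_measureU2.
    apply: le_outer_measure => x [xK Dx].
    have [h|h] := pselect ((\bigcup_k lowdens (orestr (weight V) D) m
      (upper_const m) k.+1%:R^-1) x); first by right.
    by left; split => //; split.
  by rewrite (upper_density oU rmu Hmu muH DU cD) adde0.
(* The covering lemma is for finitely many balls, so B is replaced by a compact subset up to mass
   e. *)
apply: (le_trans nullB); apply/lee_addgt0Pr => e e0.
have [Q1 [oQ1 LQ1 Q1U Q1oo]] := radon_nbhd oU rmu cthick thU.
have BQ1 : B `<=` Q1 by move=> x [/LQ1].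
have [K' [Op [[cK' _] K'B BO _ Oe]]] := radon_approx oU rmu cB BQ1 oQ1 Q1U Q1oo e0.
apply: (@le_trans _ _ (weight V K' + weight V (Op `\` K'))%E).
  apply: le_trans; last exact: outer_measureU2.
  apply: le_outer_measure => x Bx.
  by have [Kx|nK] := pselect (K' x); [left|right; split => //; exact: BO].
apply: leeD; last exact: ltW.
have rho_gt0 x : K' x -> 0 < rho x by move=> /K'B /rhoP[/andP[]].
have [s [sK' K's]] := compact_ecover cK' rho_gt0.
have [s' [us' s's s'disj s'cov]] := finite_vitali s rho.
have s'B x : x \in s' -> B x by move=> /s's /sK' /K'B.
have Lr0 : 0 <= iso_const m * (theta * r).
  by rewrite mulr_ge0// ltW// iso_const_gt0.
(* The threefold enlargements needed to cover are contained in the balls of eightfold radius that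
   the isoperimetric estimate controls. *)
apply: (@le_trans _ _ (\sum_(b <- s') weight W (ecball b (8 * rho b)))%E).
  apply: (@le_trans _ _ (weight W (\big[setU/set0]_(b <- s') ecball b (8 * rho b)))).
    rewrite weight_vrestr; apply: le_outer_measure => x Kx; split; last first.
      by have [_ []] := K'B _ Kx.
    have [a sa xa] := K's x Kx; have [b bs' ab] := s'cov a sa.
    rewrite -bigcup_seq; exists b => //.
    have /ab : ecball a (rho a) x by exact: ltW.
    rewrite /ecball/= => h; apply: (le_trans h).
    by have [/andP[]] := rhoP _ (s'B b bs'); lra.
  elim: (s') => [|b t IHt]; first by rewrite !big_nil outer_measure0.
  rewrite !big_cons; apply: (le_trans (outer_measureU2 _ _ _)).
  exact: leeD2l.
apply: (@le_trans _ _ (\sum_(b <- s') (iso_const m * (theta * r))%:E *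
    N (eoball b (rho b)))%E).
  rewrite !big_seq; apply: lee_sum => b /s'B Bb.
  have [/andP[b0 b1] hb] := rhoP b Bb.
  rewrite NE//; first exact: eoball_open.
  apply: subset_trans QU; apply: (@subset_trans _ (ecball b (rho b))).
    exact: eoball_sub_ecball.
  by apply: ballQ; [have [] := Bb|nra].
rewrite -ge0_sume_distrr; last by move=> b _; exact: outer_measure_ge0.
apply: lee_wpmul2l; first by rewrite lee_fin.
apply: (sum_disjoint_le us').
- by move=> b _; apply: oN; exact: eoball_open.
- move=> b c bs cs bc; apply/seteqP; split=> // x [xb xc].
  have : (ecball b (rho b) `&` ecball c (rho c)) x by split; exact: ltW.
  by rewrite (ecball_disjoint (s'disj b c bs cs bc)).
- move=> b /s'B Bb; apply: (@subset_trans _ (ecball b (rho b))).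
    exact: eoball_sub_ecball.
  apply: ballQ; first by have [] := Bb.
  by have [/andP[]] := rhoP b Bb; nra.
Qed.

(** The 1 accounts for the derivative of the field, [Ccut] for that of the cutoff. *)
Let Cnull : R := iso_const m * (1 + Ccut).

Let Cnull_ge0 : 0 <= Cnull.
Proof.
by rewrite mulr_ge0 ?(ltW (iso_const_gt0 m_gt0))// addr_ge0// sqr_ge0.
Qed.

(* The derivative of a cutoff at distance r from K is of order 1 / r, which the
   factor r in weight_thick compensates. *)
Let compact_small K Q (theta r1 : R) : compact K -> open Q -> Q `<=` U ->
  K `<=` Q -> (N Q < +oo)%E -> 0 < theta <= 1 / 8 -> 0 < r1 ->
  K `<=` lowdens (orestr (weight V) D) m (iso_small m * (theta / 4) ^+ m) r1 ->
  (N K <= (Cnull * theta)%:E * N Q)%E.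
Proof.
move=> cK oQ QU KQ Noo th r10 Kl.
have KU : K `<=` U by exact: subset_trans QU.
have clK := compact_closed_rV cK.
have oQK : open (Q `\` K) by apply: openI => //; exact: closed_openC.
have QKU : Q `\` K `<=` U by move=> x [/QU].
have Nfin := outer_measure_fin Noo.
have N0 := outer_measure_ge0 N Q.
have [th0 th8] := andP th.
(* N Q is N K plus N (Q \ K), and the latter is finite and can be cancelled. *)
suff h : (N Q <= (Cnull * theta)%:E * N Q + N (Q `\` K))%E.
  move: h; rewrite {1}(carathD (closed_carath oN clK) KQ) leeD2rE//.
  apply: outer_measure_fin; apply: le_lt_trans Noo; apply: le_outer_measure.
  exact: subDsetl.
rewrite {1}NE//; apply: ge_ereal_sup => _ [g gQ <-].
have [tg gsQ g1] := gQ.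
have [c [C [_ _ gc _]]] : dominated W (integrand g).
  have [_ cg gU] := tg.
  by apply: integrand_dominated tg oW _; exact: finW.
have c0 : 0 <= c by apply: le_trans (gc (0, point)).
have [r2 r20 r2Q] := thick_margin cK oQ KQ.
(* Three constraints: 4 r < r1 for the density bound, [thick K (4 * r)] inside Q, and c r <= 1, so
   that the bound c on the integrand of g, which depends on g, disappears from the estimate. *)
pose r := Num.min (Num.min (r1 / 8) (r2 / 4)) (c + 1)^-1.
have c10 : 0 < c + 1 by rewrite ltr_wpDl.
have r0 : 0 < r by rewrite !lt_min invr_gt0 c10 !divr_gt0.
have rr1 : 4 * r < r1.
  have : r <= r1 / 8 by rewrite /r !ge_min lexx.
  by lra.
have rQ : thick K (4 * r) `<=` Q.
  apply: subset_trans r2Q => x [a Ka xa]; exists a => //; apply: (le_trans xa).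
  have : r <= r2 / 4 by rewrite /r !ge_min lexx orbT.
  by lra.
have cr1 : c * r <= 1.
  apply: (@le_trans _ _ ((c + 1) * r)); first by rewrite ler_wpM2r ?(ltW r0)// lerDl.
  by rewrite -ler_pdivlMl// mulr1 /r !ge_min lexx orbT.
have [chi [cs c01 chi1 chi0 dchi]] := smooth_cutoff r0 cK.
have clth := compact_closed_rV (thick_compact (r := 3 * r) cK).
have t1 : test_field U (fun x => chi x *: g x) by exact: test_fieldZ.
have cs' : smooth (fun x => 1 - chi x) by apply: smoothB => //; exact: smooth_cst.
have t2 : test_field U (fun x => (1 - chi x) *: g x) by exact: test_fieldZ.
have thU : thick K (3 * r) `<=` U.
  apply: subset_trans QU; apply: subset_trans rQ => x [a Ka xa].
  by exists a => //; apply: (le_trans xa); lra.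
have wfin := finW (thick_compact (r := 3 * r) cK) thU.
have -> : T g = T (fun x => chi x *: g x) + T (fun x => (1 - chi x) *: g x).
  rewrite -(TD t1 t2); congr (T _); apply/funext => x.
  by rewrite /= -scalerDl addrC subrK scale1r.
rewrite EFinD; apply: leeD; last first.
  rewrite NE//; apply: ovar_ub; split => //.
    apply: (@subset_trans _ (fsupport g `&` ~` (\bigcup_(a in K) eoball a r))).
      apply: fsupport_sub.
        apply: closedI; first exact: closed_closure.
        by apply: open_closedC; apply: bigcup_open => a _; exact: eoball_open.
      move=> x /not_andP[/fsupport0 ->|/contrapT[a Ka xa]]; first by rewrite scaler0.
      by rewrite chi1 ?subrr ?scale0r//; exists a => //; exact: ltW.
    move=> x [/gsQ Qx nx]; split => // Kx; apply: nx; exists x => //.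
    exact: eoball_center.
  move=> x; have /andP[h0 h1] := c01 x.
  by rewrite enormZ ger0_norm ?subr_ge0//; have := g1 x; have := enorm_ge0 (g x); nra.
have sub3 : fsupport (fun x => chi x *: g x) `<=` thick K (3 * r).
  by apply: fsupport_sub => // x /chi0 ->; rewrite scale0r.
have bnd : `|T (fun x => chi x *: g x)| <=
    (c + Ccut / r) * fine (weight W (thick K (3 * r))).
  apply: (fvar_bound oW finW t1 clth wfin) => p; rewrite indicE.
  have [xK|nK] := pselect (thick K (3 * r) p.1); last first.
    rewrite (integrand_eq0 t1) ?normr0 ?mulr_ge0//; last by move=> /sub3.
    by rewrite addr_ge0// divr_ge0 ?sqr_ge0// ltW.
  rewrite mem_set// mulr1 (integrand_scale p tg cs).
  apply: (le_trans (ler_normD _ _)); apply: lerD.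
    have /andP[h0 h1] := c01 p.1; rewrite normrM ger0_norm//.
    by rewrite -[leRHS]mul1r; apply: ler_pM.
  apply: (le_trans (dchi _ _)); rewrite -[leRHS]mulr1.
  apply: ler_wpM2l; first by rewrite divr_ge0 ?sqr_ge0// ltW.
  by apply: (le_trans (enorm_gproj _ _)).
apply: (@le_trans _ _ ((c + Ccut / r) * fine (weight W (thick K (3 * r))))%:E).
  by rewrite lee_fin; apply: (le_trans (ler_norm _)).
have cC0 : 0 <= c + Ccut / r by rewrite addr_ge0// divr_ge0 ?sqr_ge0// ltW.
rewrite EFinM fineK ?outer_measure_fin//.
have wt := weight_thick cK oQ QU th r0 rr1 rQ Kl.
apply: (le_trans (lee_wpmul2l _ wt)); first by rewrite lee_fin.
rewrite muleA -EFinM; apply: lee_wpmul2r => //; rewrite lee_fin.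
have -> : (c + Ccut / r) * (iso_const m * (theta * r)) =
    iso_const m * (c * r + Ccut) * theta by field; rewrite gt_eqF.
rewrite /Cnull ler_wpM2r ?(ltW th0)// ler_wpM2l ?(ltW (iso_const_gt0 m_gt0))//.
by rewrite lerD2r.
Qed.

(** In a compact piece of U \ D, the sets on which W has low density below radius 1/(i+1) increase
    to all but a set of weight zero, which is M null by absolute continuity. Hence some compact K in
    one of them misses M measure at most 2 e, and the rest is controlled by N <= M. The set Q, and
    so the finite number N Q in [compact_small], is fixed before theta and e, which can then tend to
    0. *)
Theorem variation_null : N (U `\` D) = 0%E.
Proof.
apply: (null_exhaust oU); first by move=> x [].
move=> k; set S := _ `&` _.
have [Q [L [oQ cL EQ QL LU]]] := compact_nbhd oU (exhaust_compact (U := U) (k := k))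
  (@exhaust_sub _ _ U k).
have QU : Q `<=` U by exact: subset_trans LU.
have SU : S `<=` U by move=> x [[]].
have SQ : S `<=` Q by move=> x [_ /EQ].
have Moo : (M Q < +oo)%E.
  by have [_ fin _ _] := rM; apply: le_lt_trans (fin _ cL LU); exact: le_outer_measure.
have Noo : (N Q < +oo)%E by apply: le_lt_trans Moo; exact: NM.
have cS : M.-caratheodory S.
  apply: carathI; first by apply: carathDD => //; exact: oM.
  by apply: closed_carath => //; apply: compact_closed_rV; exact: exhaust_compact.
have Sfin : (M S < +oo)%E by apply: le_lt_trans Moo; exact: le_outer_measure.
have key (theta e : R) : 0 < theta <= 1 / 8 -> 0 < e ->
    (N S <= (Cnull * theta)%:E * N Q + (e + e)%:E)%E.
  move=> th e0; have [th0 _] := andP th.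
  pose t : R := iso_small m * (theta / 4) ^+ m.
  have t0 : 0 < t.
    by rewrite mulr_gt0 ?(iso_small_gt0 m_gt0)// exprn_gt0// divr_gt0.
  pose A i := S `&` lowdens (orestr (weight V) D) m t i.+1%:R^-1.
  have cA i : M.-caratheodory (A i).
    by apply: carathI => //; apply: closed_carath => //; exact: lowdens_closed.
  have hA : {homo A : i j / (i <= j)%N >-> (i <= j)%O}.
    move=> i j ij; apply/subsetPset; apply: setIS; apply: lowdens_antitone.
    by rewrite lef_pV2 ?posrE ?ltr0n// ler_nat.
  have cvA := outer_measure_cup_cvg cA hA.
  have MS : (M S <= M (\bigcup_i A i))%E.
    apply: (@le_trans _ _ (M (\bigcup_i A i) + M ((U `\` D) `\` \bigcup_i
       lowdens (orestr (weight V) D) m t i.+1%:R^-1))%E).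
      apply: le_trans; last exact: outer_measureU2.
      apply: le_outer_measure => x Sx; rewrite -setI_bigcupr.
      have [h|h] := pselect ((\bigcup_i lowdens (orestr (weight V) D) m t i.+1%:R^-1) x).
        by left.
      by right; split => //; have [] := Sx.
    rewrite (acM (A := (U `\` D) `\` _)) ?adde0//; first by move=> x [[]].
    exact: (zero_density oU rmu muH DU cD t0).
  have [i hi] : exists i, (M S < M (A i) + e%:E)%E.
    apply: contrapT => /forallNP h.
    have : (M (\bigcup_i A i) <= M S - e%:E)%E.
      apply: outer_measure_cup_le cA hA _ => i.
      by rewrite leeBrDr// leNgt; apply/negP; exact: h.
    move=> /(le_trans MS); move: Sfin (outer_measure_ge0 M S).
    case: (M S) => [s||] // _ _.
    by rewrite -EFinB lee_fin lerBrDr gerDl leNgt e0.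
  have AQ : A i `<=` Q by move=> x [/SQ].
  have [K [Op [[cK _] KA AO _ Oe]]] := radon_approx oU rM (cA i) AQ oQ QU Moo e0.
  have Afin : (M (A i) < +oo)%E by apply: le_lt_trans Moo; exact: le_outer_measure.
  have SA : (M (S `\` A i) < e%:E)%E.
    by apply: carath_le_sub => //; move=> x [].
  apply: (@le_trans _ _ (N K + (N (S `\` A i) + N (A i `\` K)))%E).
    apply: le_trans; last by apply: leeD2l; exact: outer_measureU2.
    apply: le_trans; last exact: outer_measureU2.
    apply: le_outer_measure => x Sx.
    have [Kx|nK] := pselect (K x); first by left.
    by right; have [Ax|nA] := pselect (A i x); [right|left].
  apply: leeD.
    apply: (compact_small cK oQ QU _ Noo th (r1 := i.+1%:R^-1)).
    - by move=> x /KA /AQ.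
    - by rewrite invr_gt0.
    - by move=> x /KA[].
  rewrite EFinD; apply: leeD.
    by apply: le_trans (ltW SA); apply: NM => x [/SU].
  apply: le_trans (ltW Oe); apply: (@le_trans _ _ (M (A i `\` K))).
    by apply: NM => x [/AQ/QU].
  by apply: le_outer_measure => x [/AO].
have Nfin := outer_measure_fin Noo.
apply/eqP; rewrite eq_le outer_measure_ge0 andbT; apply/lee_addgt0Pr => e e0.
rewrite add0e.
have NQ0 : 0 <= fine (N Q) by rewrite fine_ge0// outer_measure_ge0.
pose B : R := Cnull * fine (N Q) + 1.
have B0 : 0 < B by rewrite ltr_wpDl// mulr_ge0.
(* This makes the main term at most e / 2, and the approximation errors are twice e / 4. *)
pose theta : R := Num.min (1 / 8) (e / (2 * B)).
have th : 0 < theta <= 1 / 8.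
  by rewrite /theta lt_min ge_min lexx andbT !divr_gt0 ?mulr_gt0.
have e4 : 0 < e / 4 by rewrite divr_gt0.
apply: (le_trans (key theta (e / 4) th e4)).
rewrite -(fineK Nfin) -EFinM -EFinD lee_fin.
have : theta * B <= e / 2.
  have : theta <= e / (2 * B) by rewrite /theta ge_min lexx orbT.
  by rewrite ler_pdivlMr ?mulr_gt0//; lra.
have [th0 _] := andP th.
by rewrite /B; nra.
Qed.

End VariationNull.

(** * Extension by continuity *)

(** The terms below s form a geometric series of ratio 1/2 whose largest term is at most r and at
    most s. *)
Lemma dyadic_sum {R : realType} (r s : R) (J : nat) : 0 <= r -> 0 <= s ->
  \sum_(k < J) (r / 2 ^+ k) * (r / 2 ^+ k < s)%R%:R <= 2 * Num.min r s.
Proof.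
elim: J r => [|J IH] r r0 s0; first by rewrite big_ord0 mulr_ge0// le_min r0.
rewrite big_ord_recl expr0 divr1.
have -> : \sum_(i < J) r / 2 ^+ lift ord0 i * (r / 2 ^+ lift ord0 i < s)%R%:R =
    \sum_(i < J) (r / 2) / 2 ^+ i * ((r / 2) / 2 ^+ i < s)%R%:R.
  by apply: eq_bigr => i _; rewrite lift0 exprS invfM mulrA.
have := IH (r / 2) (divr_ge0 r0 (ler0n _ 2)) s0.
have [rs|sr] := ltP r s; first last.
  by rewrite mulr0 add0r => /le_trans; apply; rewrite ler_wpM2l// ge_min lexx orbT.
have : Num.min (r / 2) s <= r / 2 by rewrite ge_min lexx.
by rewrite mulr1; lra.
Qed.

(** Discrete layer cake inequality: at each x the dyadic numbers r / 2^k below 8 h(x) add up to at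
    most 2 * 8 h(x). *)
Lemma dyadic_layers {d} {T : measurableType d} {R : realType}
    (mu : {measure set T -> \bar R}) (D : set T) (h : T -> R) (r : R) (J : nat) :
  measurable D -> measurable_fun D h -> (forall x, 0 <= h x) -> 0 <= r ->
  (\sum_(k < J) (r / 2 ^+ k)%:E * mu (D `&` [set x | (r / 2 ^+ k / 8 < h x)%R]) <=
    16%:E * \int[mu]_(x in D) (h x)%:E)%E.
Proof.
move=> mD mh h0 r0; pose A k := D `&` [set x | r / 2 ^+ k / 8 < h x].
have mA k : measurable (A k).
  have := mh mD _ (measurable_itv `](r / 2 ^+ k / 8), +oo[).
  by congr measurable; apply/seteqP; split=> x [Dx]; rewrite /= in_itv/= andbT.
have rk k : 0 <= r / 2 ^+ k by rewrite divr_ge0// exprn_ge0.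
have mi k : measurable_fun D (fun x => (\1_(A k) x)%:E : \bar R).
  by apply/measurable_EFinP; exact: measurable_indic.
have -> : (\sum_(k < J) (r / 2 ^+ k)%:E * mu (D `&` [set x | (r / 2 ^+ k / 8 < h x)%R]) =
    \int[mu]_(x in D) \sum_(k < J) (r / 2 ^+ k)%:E * (\1_(A k) x)%:E)%E.
  rewrite ge0_integral_sum//.
  - apply: eq_bigr => k _; rewrite ge0_integralZl_EFin//.
    + by rewrite integral_indic// (_ : A k `&` D = A k)//; apply/setIidl => x [].
  - by move=> k; apply: measurable_funeM; exact: mi.
  - by move=> k x _; rewrite mule_ge0 ?lee_fin.
rewrite -ge0_integralZl_EFin//.
- apply: ge0_le_integral => //.
  + by move=> x _; apply: sume_ge0 => k _; rewrite mule_ge0 ?lee_fin.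
  + by apply: emeasurable_sum => k; apply: measurable_funeM; exact: mi.
  + by apply: measurable_funeM; exact/measurable_EFinP.
  + move=> x Dx; under eq_bigr do rewrite -EFinM.
    rewrite sumEFin -EFinM lee_fin.
    apply: (@le_trans _ _ (2 * Num.min r (8 * h x))); last first.
      have : Num.min r (8 * h x) <= 8 * h x by rewrite ge_min lexx orbT.
      by lra.
    apply: le_trans (@dyadic_sum _ r (8 * h x) J r0 (mulr_ge0 _ (h0 x))); last by [].
    apply: ler_sum => k _; apply: ler_wpM2l => //.
    rewrite indicE ler_nat; case: (boolP (x \in A k)) => //.
    rewrite inE => -[_ /=]; rewrite ltr_pdivrMr// (mulrC (h x)) => ->; exact: leqnn.
- by move=> x _; rewrite lee_fin.
- exact/measurable_EFinP.
Qed.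

Section L1Bound.
Context {R : realType} {n : nat}.
Notation field := ('rV[R]_n -> 'rV[R]_n).
Implicit Types (U Q : set 'rV[R]_n) (g u : field).

Lemma test_field_enorm_continuous U g : test_field U g -> continuous (fun x => enorm (g x)).
Proof.
move=> [/(_ 0%N) cg _ _] x.
apply: (@cvg_comp _ _ _ g (fun y : 'rV[R]_n => enorm y)); first exact: cg.
suff -> : (fun y : 'rV[R]_n => enorm y) = (fun y => enorm (y - 0)).
  have := @enormB_continuous R n 0 (g x); rewrite /continuous_at subr0; exact.
by apply/funext => y; rewrite subr0.
Qed.

Lemma test_field_bounded U g : test_field U g ->
  exists2 b, 0 < b & forall x, enorm (g x) <= b.
Proof.
move=> tg; have [_ cg _] := tg; have cn := test_field_enorm_continuous tg.
have /compact_bounded[b [_ hb]] : compact ((fun x => enorm (g x) : R^o) @` fsupport g).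
  by apply: continuous_compact => //; exact: continuous_subspaceT.
exists (Num.max (b + 1) 1) => [|x]; first by rewrite lt_max ltr01 orbT.
have [gx|/fsupport0 ->] := pselect (fsupport g x); last by rewrite enorm0 le_max ler01 orbT.
rewrite le_max (le_trans (ler_norm _))//; apply: hb; first by rewrite ltrDl.
by exists x.
Qed.

(* Slice u along the dyadic level sets of its norm and estimate each slice by
   its supremum times the variation of the level set. *)
Lemma variation_l1_bound U (T : field -> R) (M : {outer_measure set 'rV[R]_n -> \bar R})
    u (h : 'rV[R]_n -> R) Q :
  additive_on_tests U T -> homogeneous_on_tests U T -> test_field U u ->
  fsupport u `<=` Q -> (ovar U T Q < +oo)%E -> M.-caratheodory U ->
  measurable_fun (U : set (caratheodory_type M)) h -> (forall x, 0 <= h x) ->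
  (forall s, 0 < s -> (ovar U T [set x | (s < enorm (u x))%R] <=
     M (U `&` [set x | (s < h x)%R]))%E) ->
  ((T u)%:E <= 16%:E * ointegral M U (fun x => (h x)%:E))%E.
Proof.
move=> TD TZ tu uQ Qoo cU mh h0 uh.
have [b b0 ub] := test_field_bounded tu.
(* Starting at 2 b makes eta_0 equal to 1 everywhere, since |u| <= b. *)
pose r k : R := (2 * b) / 2 ^+ k.
have r0 k : 0 < r k by rewrite divr_gt0 ?mulr_gt0// exprn_gt0.
have rS k : r k = 2 * r k.+1.
  by rewrite /r exprS; field; rewrite expf_neq0.
pose q x : R := edot (u x) (u x).
have qE x : q x = enorm (u x) ^+ 2 by rewrite /q -sqr_enorm.
have sq : smooth q by apply: smooth_sum => i; apply: smoothM; exact: test_field_smooth tu.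
pose eta k x : R := step (q x / r k ^+ 2).
have seta k : smooth (eta k).
  by apply: smooth_step; apply: smoothM => //; exact: smooth_cst.
have eta1 k x : enorm (u x) <= r k / 2 -> eta k x = 1.
  move=> ux; apply: step1; rewrite ler_pdivrMr ?exprn_gt0// qE.
  by have := enorm_ge0 (u x); have := r0 k; nra.
have eta0 k x : r k <= enorm (u x) -> eta k x = 0.
  move=> ux; apply: step0; rewrite ler_pdivlMr ?exprn_gt0// qE.
  by have := r0 k; nra.
have e01 k x : 0 <= eta k x <= 1 by rewrite step_ge0 step_le1.
(* A slice vanishes where |u| is less than r k / 4; the level r k / 8 leaves room for the closure in
   the support. The remainder gets all of Q, whose finite variation is multiplied by r J, which
   tends to 0. *)
pose G J k := if k == J then Q else [set x | r k / 8 < enorm (u x)].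
have suppQ (f : 'rV[R]_n -> R) : fsupport (fun x => f x *: u x) `<=` Q.
  by apply: subset_trans uQ; exact: fsupportZ.
have tele J : ((T u)%:E <= 16%:E * ointegral M U (fun x => (h x)%:E) +
    (r J)%:E * ovar U T Q)%E.
  have := @T_telescope _ _ U T TD TZ u eta r (G J) J tu seta.
  rewrite (_ : (fun x => eta 0%N x *: u x) = u); last first.
    apply/funext => x; rewrite eta1 ?scale1r//.
    by rewrite /r expr0 divr1 mulrC mulKf.
  move=> /(_ (fun k => ltW (r0 k))) H; apply: le_trans (H _ _ _ _) _.
  - move=> k x; have /andP[a0 a1] := e01 k x; have /andP[c0 c1] := e01 k.+1 x.
    have [ux|ux] := leP (r k) (enorm (u x)).
      rewrite !eta0// ?subrr ?normr0 ?mul0r ?(ltW (r0 k))//.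
      by apply: le_trans ux; rewrite (rS k); have := r0 k.+1; lra.
    rewrite -[leRHS]mul1r; apply: ler_pM => //; [exact: enorm_ge0| |exact: ltW].
    by rewrite ler_norml; lra.
  - move=> k; rewrite /G; case: ifP => _; first exact: suppQ.
    apply: (@subset_trans _ [set x | r k / 4 <= enorm (u x)]); last first.
      by move=> x /=; have := r0 k; lra.
    apply: fsupport_sub.
      rewrite (_ : [set x | _] = (fun x => enorm (u x)) @^-1` [set t | r k / 4 <= t])//.
      apply: closed_comp => [x _|]; last exact: closed_ge.
      exact: (test_field_enorm_continuous tu).
    move=> x /negP; rewrite -ltNge => ux.
    by rewrite !eta1 ?subrr ?scale0r//; have := rS k; have := r0 k; lra.
  - move=> x; have /andP[a0 a1] := e01 J x.
    have [ux|ux] := leP (r J) (enorm (u x)).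
      by rewrite eta0// normr0 mul0r ltW.
    rewrite -[leRHS]mul1r; apply: ler_pM => //; [exact: enorm_ge0| |exact: ltW].
    by rewrite ger0_norm.
  - by rewrite /G eqxx; exact: suppQ.
  rewrite big_ord_recr/= {2}/G eqxx leeD2r//.
  apply: le_trans (@dyadic_layers _ _ _ (M : measure (caratheodory_type M) R)
    U h (2 * b) J cU mh h0 _); last by rewrite mulr_ge0// ltW.
  apply: lee_sum => k _; rewrite lee_wpmul2l ?lee_fin ?(ltW (r0 _))//.
  rewrite /G (ltn_eqF (ltn_ord k)); apply: uh.
  by rewrite divr_gt0.
have Qfin : ovar U T Q \is a fin_num by rewrite ge0_fin_numE// ovar_ge0.
apply/lee_addgt0Pr => e e0.
have L0 : 0 <= fine (ovar U T Q) by rewrite fine_ge0// ovar_ge0.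
pose J := Num.truncn (2 * b * fine (ovar U T Q) / e).
apply: le_trans (tele J.+1) _; rewrite leeD2l// -(fineK Qfin) -EFinM lee_fin.
rewrite /r mulrAC ler_pdivrMr ?exprn_gt0// [leRHS]mulrC -ler_pdivrMr//.
apply: (le_trans (ltW (truncnS_gt _))).
by rewrite -[2](natrX R 2 1) -natrX ler_nat expn1 ltnW// ltn_expl.
Qed.

End L1Bound.

Section RestrictedLimit.
Context {R : realType} {n : nat}.
Notation field := ('rV[R]_n -> 'rV[R]_n).
Variables (U : set 'rV[R]_n) (M : {outer_measure set 'rV[R]_n -> \bar R}).
Hypotheses (oU : open U) (rM : radon U M).

Let oM : opens_carath M := radon_opens_carath oU rM.

Lemma test_fieldB g h : test_field U g -> test_field U h ->
  test_field U (fun x => g x - h x).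
Proof.
move=> tg th; have : test_field U (fun x => g x + (-1) *: h x).
  by apply: test_fieldD => //; apply: test_fieldZ => //; exact: smooth_cst.
by under eq_fun do rewrite scaleN1r.
Qed.

(** As N vanishes on U \ A, the level sets of |u| matter only within A, where h agrees with |u|;
    elsewhere h may be any nonnegative measurable function. The absolute value is obtained by
    applying the bound to -u as well. *)
Lemma variation_l1_abs (T : field -> R) (N : {outer_measure set 'rV[R]_n -> \bar R})
    (A : set 'rV[R]_n) (u : field) (h : 'rV[R]_n -> R) :
  additive_on_tests U T -> homogeneous_on_tests U T -> has_variation U T N ->
  (forall B, B `<=` U -> (N B <= M B)%E) -> N (U `\` A) = 0%E ->
  test_field U u -> measurable_fun (U : set (caratheodory_type M)) h ->
  (forall x, 0 <= h x) -> (forall x, A x -> h x = enorm (u x)) ->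
  (`|T u|%:E <= 16%:E * ointegral M U (fun x => (h x)%:E))%E.
Proof.
move=> TD TZ [_ hN] NM NA tu mh h0 hu; have [_ cu uU] := tu.
have [Q [oQ uQ QU Qoo]] := radon_nbhd oU rM cu uU.
have Q1oo : (ovar U T Q < +oo)%E.
  by apply: le_lt_trans Qoo; apply: le_trans (NM _ QU); rewrite hN.
have level s : 0 < s -> (ovar U T [set x | (s < enorm (u x))%R] <=
    M (U `&` [set x | (s < h x)%R]))%E.
  move=> s0; set G := [set x | _].
  have oG : open G.
    rewrite (_ : G = (fun x => enorm (u x)) @^-1` [set t | s < t])//.
    apply: open_comp => [x _|]; last exact: open_gt.
    exact: (test_field_enorm_continuous tu).
  have GU : G `<=` U.
    move=> x Gx; apply: uU; apply: contrapT => /fsupport0 ux.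
    by move: Gx; rewrite /G/= ux enorm0 ltNge ltW.
  have -> : ovar U T G = N G by rewrite hN.
  apply: (@le_trans _ _ (N (G `&` A) + N (G `\` A))%E).
    by rewrite -{1}(setUIDK G A); exact: outer_measureU2.
  rewrite (outer_measure_le0 (setSD GU) NA) adde0.
  apply: le_trans (NM _ _) _; first by move=> x [/GU].
  by apply: le_outer_measure => x [Gx Ax]; split; [exact: GU|rewrite /= hu].
have cU := oM oU.
have bound v : test_field U v -> (forall x, enorm (v x) = enorm (u x)) ->
    fsupport v `<=` Q -> ((T v)%:E <= 16%:E * ointegral M U (fun x => (h x)%:E))%E.
  move=> tv vu vQ; apply: (variation_l1_bound TD TZ tv vQ Q1oo cU mh h0) => s s0.
  by under eq_set do rewrite vu; exact: level.
have tNu : test_field U (fun x => (-1) *: u x).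
  by apply: test_fieldZ => //; exact: smooth_cst.
have [_|_] := ger0P (T u); first exact: bound.
rewrite -mulN1r -TZ//; apply: bound => //.
  by move=> x; rewrite enormZ normrN1 mul1r.
exact: subset_trans (@fsupportZ _ _ u (fun=> -1)) uQ.
Qed.

Variables (T1 T2 : field -> R) (N1 N2 : {outer_measure set 'rV[R]_n -> \bar R})
  (E : set 'rV[R]_n).
Hypotheses (T1D : additive_on_tests U T1) (T1Z : homogeneous_on_tests U T1)
  (T2D : additive_on_tests U T2) (T2Z : homogeneous_on_tests U T2)
  (hN1 : has_variation U T1 N1) (hN2 : has_variation U T2 N2)
  (N1M : forall B, B `<=` U -> (N1 B <= M B)%E)
  (N2M : forall B, B `<=` U -> (N2 B <= M B)%E)
  (N1E : N1 (U `\` E) = 0%E) (N2E : N2 (U `\` (U `\` E)) = 0%E)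
  (cE : M.-caratheodory E) (EU : E `<=` U).

Let restr (g : field) x := if x \in E then g x else 0.
Let err (f g : field) x := enorm (f x - restr g x).

Let err_measurable f g : test_field U f -> test_field U g ->
  measurable_fun (U : set (caratheodory_type M)) (err f g).
Proof.
move=> tf tg; apply: (@measurable_funS _ _ (caratheodory_type M) _ setT) => //.
have m1 := continuous_carath oM (test_field_enorm_continuous (test_fieldB tf tg)).
have m2 := continuous_carath oM (test_field_enorm_continuous tf).
have mE : measurable (E : set (caratheodory_type M)) by [].
have mEc : measurable (~` E : set (caratheodory_type M)) by exact: measurableC.
have ind (A : set (caratheodory_type M)) : measurable A ->
    measurable_fun setT (\1_A : caratheodory_type M -> R).
  by move=> mA; exact: measurable_indic.
have i1 := ind _ mE; have i2 := ind _ mEc.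
have := measurable_funD
  (measurable_funM i1 m1)
  (measurable_funM i2 m2).
congr (measurable_fun _ _); apply/funext => x /=.
rewrite /err /restr /= !indicE in_setC; case: (x \in E) => /=.
  by rewrite mul1r mul0r addr0.
by rewrite mul0r mul1r add0r subr0.
Qed.

(** One error function controls both functionals: it is |f_k - g| on E, which bounds T1 (f_k - g),
    and |f_k| off E, which bounds T2 f_k. The two constants 16 add up to 32. *)
Lemma restr_limit g (f : nat -> field) : test_field U g ->
  (forall k, test_field U (f k)) ->
  ointegral M U (fun x => (enorm (f k x - (if x \in E then g x else 0)))%:E)
    @[k --> \oo] --> 0%E ->
  (fun k => T1 (f k) + T2 (f k)) @ \oo --> T1 g.
Proof.
move=> tg tf If; pose I k := ointegral M U (fun x => (err (f k) g x)%:E).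
have le k : ((`|T1 (f k) + T2 (f k) - T1 g|)%:E <= 32%:E * I k)%E.
  have e0 x : 0 <= err (f k) g x by exact: enorm_ge0.
  have b1 : (`|T1 (fun x => (f k x - g x)%R)|%:E <= 16%:E * I k)%E.
    apply: (variation_l1_abs T1D T1Z hN1 N1M N1E) => //.
    - exact: test_fieldB.
    - exact: err_measurable.
    - by move=> x Ex; rewrite /err /restr mem_set.
  have b2 : (`|T2 (f k)|%:E <= 16%:E * I k)%E.
    apply: (variation_l1_abs T2D T2Z hN2 N2M N2E) => //.
    - exact: err_measurable.
    - by move=> x [_ nE]; rewrite /err /restr memNset ?subr0.
  have -> : 32 = 16 + 16 :> R by lra.
  rewrite EFinD ge0_muleDl ?lee_fin//; apply: le_trans (leeD b1 b2).
  rewrite -EFinD lee_fin.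
  have -> : T1 (fun x => f k x - g x) = T1 (f k) - T1 g.
    have := T1D (test_fieldB (tf k) tg) tg.
    by under eq_fun do rewrite subrK; move=> ->; rewrite addrK.
  by rewrite addrAC; exact: ler_normD.
have If' : (32%:E * I k)%E @[k --> \oo] --> 0%E.
  by rewrite -[0%E in X in _ --> X](mule0 32%:E); apply: cvgeZl.
have : (`|T1 (f k) + T2 (f k) - T1 g|)%:E @[k --> \oo] --> 0%E.
  apply: (squeeze_cvge _ (cvg_cst _) If'); apply: nearW => k.
  by rewrite lee_fin normr_ge0/=.
move=> /fine_cvgP[_ h]; apply/cvgrPdist_lt => e e0.
move/cvgrPdist_lt: h => /(_ e e0); apply: filterS => k /=.
by rewrite sub0r normrN normr_id distrC.
Qed.

(** Needed to rule out the default value in [dist_extend]. With K compact and Op open around the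
    part of E near the support of g, and chi a cutoff between them, chi g differs from the
    restriction of g to E only in Op \ K, by at most sup |g|. *)
Lemma restr_approx g : test_field U g -> exists f : nat -> field,
  (forall k, test_field U (f k)) /\
  ointegral M U (fun x => (enorm (f k x - (if x \in E then g x else 0)))%:E)
    @[k --> \oo] --> 0%E.
Proof.
move=> tg; have [_ cg gU] := tg.
have [Q [oQ gQ QU Qoo]] := radon_nbhd oU rM cg gU.
have [b b0 gb] := test_field_bounded tg.
have cEQ : M.-caratheodory (E `&` Q) by apply: carathI => //; exact: oM.
have step k : exists f : field, test_field U f /\
    (ointegral M U (fun x => (err f g x)%:E) <= (b / k.+1%:R)%:E)%E.
  have k0 : 0 < k.+1%:R^-1 :> R by rewrite invr_gt0.
  have [K [Op [[cK oO] KE EO OQ Osmall]]] :=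
    radon_approx oU rM cEQ (@subIsetr _ _ _) oQ QU Qoo k0.
  have KO : K `<=` Op by exact: subset_trans EO.
  have [chi [P [L [[cs c01 c1] [oP KP] [cL PL LO] c0]]]] := smooth_urysohn cK oO KO.
  exists (fun x => chi x *: g x); split; first exact: test_fieldZ.
  have clK := compact_closed_rV cK.
  have mS : measurable (Op `\` K : set (caratheodory_type M)).
    by apply: carathDD; [exact: oM|exact: closed_carath].
  have tf : test_field U (fun x => chi x *: g x) by exact: test_fieldZ.
  apply: (@le_trans _ _ (\int[(M : measure (caratheodory_type M) R)]_(x in U)
     (b%:E * (\1_(Op `\` K) x)%:E))%E).
    apply: ge0_le_integral => //.
    - exact: (oM oU).
    - by move=> x _; rewrite lee_fin enorm_ge0.
    - by apply/measurable_EFinP; exact: err_measurable.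
    - by apply: measurable_funeM; apply/measurable_EFinP; exact: measurable_indic.
    - move=> x Ux; rewrite -EFinM lee_fin /err /restr indicE.
      have /andP[h0 h1] := c01 x.
      have [Ox|nO] := pselect (Op x); last first.
        rewrite c0 ?scale0r; last by move=> /LO.
        case: ifPn => [|_]; last by rewrite subrr enorm0 mulr_ge0// ltW.
        rewrite inE => Ex; have -> : g x = 0.
          by apply: fsupport0 => /gQ Qx; apply: nO; exact: EO.
        by rewrite subrr enorm0 mulr_ge0// ltW.
      have [Kx|nK] := pselect (K x).
        rewrite c1; last exact: KP.
        rewrite mem_set; last by have [] := KE x Kx.
        by rewrite scale1r subrr enorm0 mulr_ge0// ltW.
      rewrite [x \in Op `\` K]mem_set// mulr1; apply: le_trans (gb x).
      case: ifP => _; last by rewrite subr0 enormZ ger0_norm//; exact: ler_piMl (enorm_ge0 _) _.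
      have -> : chi x *: g x - g x = (chi x - 1) *: g x by rewrite scalerBl scale1r.
      rewrite enormZ; apply: ler_piMl; first exact: enorm_ge0.
      by rewrite ler_norml; lra.
  rewrite ge0_integralZl_EFin//; last exact: ltW.
  - rewrite integral_indic//; last exact: (oM oU).
    rewrite EFinM lee_wpmul2l ?lee_fin ?(ltW b0)//.
    apply: le_trans (ltW Osmall); apply: le_outer_measure; exact: subIsetl.
  - exact: (oM oU).
  - by apply/measurable_EFinP; exact: measurable_indic.
have [f hf] := choice step.
exists f; split; first by move=> k; have [] := hf k.
have b0k : (b / k.+1%:R)%:E @[k --> \oo] --> 0%E.
  apply: cvg_EFin; first by apply: nearW.
  have := @cvgMl_tmp _ _ _ _ (@harmonic R) b 0 (@cvg_harmonic R).
  by rewrite mulr0; exact.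
apply: (squeeze_cvge _ (cvg_cst _) b0k).
apply: nearW => k; have [_ ->] := hf k; rewrite andbT.
by apply: integral_ge0 => x _; rewrite lee_fin enorm_ge0.
Qed.

End RestrictedLimit.

(** The first variation of V - W is identified with that of the restriction of V to U \ E on test
    fields, and [has_variation] tests T on nothing else. *)
Lemma has_variation_eq {R : realType} {n : nat} (U : set 'rV[R]_n)
    (T T' : ('rV[R]_n -> 'rV[R]_n) -> R) (mu : {outer_measure set 'rV[R]_n -> \bar R}) :
  (forall g, test_field U g -> T g = T' g) ->
  has_variation U T mu -> has_variation U T' mu.
Proof.
move=> TT' [reg h]; split => // G oG GU; rewrite h//; congr ereal_sup.
by apply/seteqP; split=> _ [g gG <-]; exists g => //; have [tg _ _] := gG; rewrite TT'.
Qed.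

Theorem corollary3p8 (R : realType) (m n : nat) (m_gt0 : (0 < m)%N)
    (n_gt0 : (0 < n)%N) (mn : (m <= n)%N) (U : set 'rV[R]_n) (oU : open U)
    (V : {outer_measure set ('rV[R]_n * grassmannian R mn) -> \bar R})
    (iV : integral_varifold U V)
    (rV : radon U (dist_variation U (first_variation (vint V))))
    (aV : abs_continuous U (dist_variation U (first_variation (vint V))) (weight V))
    (E : set 'rV[R]_n) (EU : E `<=` U)
    (mE : (weight V \+ dist_variation U (first_variation (vint V)))%E.-caratheodory E)
    (W : {outer_measure set ('rV[R]_n * grassmannian R mn) -> \bar R})
    (WE : W = vrestr V E)
    (VW : forall A, A `<=` U ->
       dist_variation U (first_variation (vint V)) A =
       (dist_variation U (first_variation (vint W)) A +
        dist_variation U (first_variation (vint V \- vint W)%R) A)%E) :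
  forall g, test_field U g -> vboundary U V E g = 0.
Proof.
have [vV [c [F [tau [hF VF]]]]] := iV.
have c0 i : (0 < c i)%N by have [] := hF i.
have cF i : (hausdorff m : {outer_measure set 'rV[R]_n -> \bar R}).-caratheodory (F i).
  by have [] := hF i.
have Hmu X i : X `<=` U -> (hausdorff m (X `&` F i) <= weight V X)%E.
  exact: (hausdorff_le_weight oU vV c0 cF VF).
have muH K : compact K -> K `<=` U -> (forall i, hausdorff m (K `&` F i) = 0%E) ->
    weight V K = 0%E.
  exact: (weight_compact_null oU vV cF VF).
pose M := dist_variation U (first_variation (vint V)).
have rM : radon U M := rV.
have rmu := radon_weight oU vV.
have oM := radon_opens_carath oU rM.
have omu := radon_opens_carath oU rmu.
(* The empty set is admissible in the infimum [ac_part] when A has weight zero. *)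
have acM A : A `<=` U -> weight V A = 0%E -> M A = 0%E.
  move=> AU A0; apply/eqP; rewrite eq_le outer_measure_ge0 andbT.
  rewrite -[leLHS](aV A AU); apply: ereal_inf_lbound; exists set0 => /=.
    by split; [exact: sub_sigma_algebra open0|rewrite setD0].
  exact: outer_measure0.
have cK k (nu : {outer_measure set 'rV[R]_n -> \bar R}) : opens_carath nu ->
    nu.-caratheodory (exhaust U k).
  move=> onu; apply: closed_carath => //; apply: compact_closed_rV.
  exact: exhaust_compact.
have fK k (nu : {outer_measure set 'rV[R]_n -> \bar R}) : radon U nu ->
    (nu (exhaust U k) < +oo)%E.
  by move=> [_ fin _ _]; apply: fin; [exact: exhaust_compact|exact: exhaust_sub].
(* Measurability for the sum of the two measures splits on each compact set of the exhaustion, where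
   both are finite. *)
have cE : (weight V).-caratheodory E.
  apply: (carath_exhaust oU EU) => k.
  by apply: (carath_sum_split mE); [exact: cK|exact: cK|exact: fK|exact: fK].
have cME : M.-caratheodory E.
  apply: (carath_exhaust oU EU) => k.
  apply: (@carath_sum_split _ _ _ (weight V)); [|exact: cK|exact: cK|exact: fK|exact: fK].
  by move=> X; have := mE X; rewrite /= !(addeC (M _)).
have DU : U `\` E `<=` U by exact: subDsetl.
have cD : (weight V).-caratheodory (U `\` E) by apply: carathDD => //; exact: omu.
have cMD : M.-caratheodory (U `\` E) by apply: carathDD => //; exact: oM.
pose T1 := fvar (vrestr V E); pose T2 := fvar (vrestr V (U `\` E)).
have oV D : opens_carath (vrestr V D).
  exact: opens_carath_orestr (varifold_opens_carath oU vV).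
have finV D K : compact K -> K `<=` U -> (weight (vrestr V D) K < +oo)%E.
  exact: weight_vrestr_fin.
have T1D := fvar_additive (oV E) (finV E).
have T1Z := fvar_homogeneous (oV E) (finV E).
have T2D := fvar_additive (oV (U `\` E)) (finV (U `\` E)).
have T2Z := fvar_homogeneous (oV (U `\` E)) (finV (U `\` E)).
have split g : test_field U g ->
    first_variation (vint V) g = T1 g + T2 g.
  exact: fvar_split.
have T2E g : test_field U g -> first_variation (vint V \- vint W) g = T2 g.
  move=> tg; have : first_variation (vint V \- vint W) g =
    first_variation (vint V) g - T1 g by rewrite WE.
  by rewrite split// addrC addKr.
pose N1 := dist_variation U (first_variation (vint W)).
pose N2 := dist_variation U (first_variation (vint V \- vint W)).
have hN1 : has_variation U T1 N1.
  by rewrite /N1 WE; have [] := dist_variationP oU T1D T1Z.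
have hN2 : has_variation U T2 N2.
  apply: (has_variation_eq T2E).
  have [] // := @dist_variationP _ _ U (first_variation (vint V \- vint W)) oU.
    move=> g h tg th; rewrite !T2E//; first exact: T2D.
    exact: test_fieldD.
  move=> a g tg; rewrite !T2E//; first exact: T2Z.
  by apply: test_fieldZ => //; exact: smooth_cst.
have N1M A : A `<=` U -> (N1 A <= M A)%E.
  by move=> AU; rewrite [leRHS](VW _ AU) leeDl// outer_measure_ge0.
have N2M A : A `<=` U -> (N2 A <= M A)%E.
  by move=> AU; rewrite [leRHS](VW _ AU) leeDr// outer_measure_ge0.
have N1E : N1 (U `\` E) = 0%E.
  exact: (variation_null m_gt0 oU vV Hmu muH rM acM EU cE cME N1M hN1).
(* The same theorem with U \ E in place of E, as the first variation of V - W is that of the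
   restriction of V to U \ E. *)
have N2E : N2 (U `\` (U `\` E)) = 0%E.
  exact: (variation_null m_gt0 oU vV Hmu muH rM acM DU cD cMD N2M hN2).
have lim g (f : nat -> 'rV[R]_n -> 'rV[R]_n) : test_field U g ->
    (forall k, test_field U (f k)) ->
    ointegral M U (fun x => (enorm (f k x - (if x \in E then g x else 0)))%:E)
      @[k --> \oo] --> 0%E ->
    first_variation (vint V) (f k) @[k --> \oo] --> T1 g.
  move=> tg tf If; under eq_fun do rewrite split//.
  exact: (restr_limit oU rM T1D T1Z T2D T2Z hN1 hN2 N1M N2M N1E N2E cME tg tf If).
move=> g tg; suff e : dist_restr U (first_variation (vint V)) E g = T1 g.
  rewrite /vboundary /= e; exact: subrr.
(* Any value selected by the extension is a limit along approximating fields, hence T1 g; the other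
   case would mean that no approximating sequence yields a limit. *)
rewrite /dist_restr /dist_extend; case: xgetP => [y _ [f [tf If fy]]|h].
  exact: (cvg_unique _ fy (lim g f tg tf If)).
have [f [tf If]] := restr_approx oU rM cME tg.
by exfalso; apply: (h (T1 g)); exists f; split => //; exact: lim.
Qed.
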